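(* As $\mathbb{C}$-algebras, the skew polynomial ring $\mathcal{M}[\xi;1,\delta]$ is isomorphic to $\mathcal{R}$ (via $E_4^iE_6^j\xi^k\mapsto e_4^ie_6^j\delta^k$).
   Context: Let $\mathrm{Hol}$ be the space of holomorphic functions on the upper half plane, $q=e^{2\pi iz}$, $f'=\frac{1}{2\pi i}\frac{df}{dz}$, and $E_2,E_4,E_6$ the Eisenstein series with constant term $1$. For $k\in\mathbb{R}$ let $D_kf=f'-\frac{k}{12}E_2f$. Let $H=\bigoplus_{n\in\mathbb{R}}H_n$ where each $H_n$ is a copy of $\mathrm{Hol}$, elements written $(f,n)$, with product $(f,n)(g,m)=(fg,n+m)$. $\mathrm{End}^i(H)$ denotes the $\mathbb{C}$-linear maps sending each $H_n$ into $H_{n+i}$ and $\mathrm{End}(H)=\bigoplus_i\mathrm{End}^i(H)$. Define $\delta(f,n)=(D_nf,n+2)$, $e_4(f,n)=(E_4f,n+4)$, $e_6(f,n)=(E_6f,n+6)$; $\mathcal{R}$ is the $\mathbb{C}$-subalgebra of $\mathrm{End}(H)$ generated by $\delta,e_4,e_6$. $\mathcal{M}=\mathbb{C}[E_4,E_6]=\bigoplus_k\mathcal{M}_k$ is the graded ring of level-one holomorphic modular forms, and $\delta$ acts on it as the derivation $f\mapsto D_kf$ for $f\in\mathcal{M}_k$. For a ring $R$, a ring endomorphism $s$ and an $s$-derivation $d$, $R[\xi;s,d]$ is the skew polynomial ring: every element is uniquely a finite sum $\sum r_i\xi^i$ with $r_i\in R$, and $\xi r=s(r)\xi+d(r)$;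 here $s=1$ is the identity. *)

(* Defs.v *)
From mathcomp Require Import all_boot all_algebra.
From mathcomp Require Import complex.
From mathcomp Require Import all_classical all_reals all_analysis.
Import GRing.Theory Num.Theory.

Set Implicit Arguments.
Unset Strict Implicit.
Unset Printing Implicit Defensive.

Local Open Scope ring_scope.
Local Open Scope complex_scope.

Section ModularDefs.
Variable R : realType.
Local Notation C := R[i].

Definition uhp (z : C) : Prop := 0 < complex.Im z.

(** q = e^{2 pi i z} = e^{-2 pi Im z} (cos (2 pi Re z) + i sin (2 pi Re z)). *)
Definition qexp (z : C) : C :=
  (expR (- (2 * pi * complex.Im z)))%:C * (cos (2 * pi * complex.Re z) +i* sin (2 * pi * complex.Re z)).

Definition sigma (k n : nat) : nat := (\sum_(d < n.+1 | d %| n) d ^ k)%N.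

(** Convention: a holomorphic function on the upper half plane is represented
   by a function C -> C which is complex differentiable at every point of the
   upper half plane and is identically 0 off the upper half plane (so that
   functional equality is equality on the upper half plane). *)
Definition Hol (f : C -> C) : Prop :=
  (forall z, uhp z -> derivable (f : C^o -> C^o) z 1) /\
  (forall z, ~ uhp z -> f z = 0).

Definition oneH (z : C) : C := if `[< uhp z >] then 1 else 0.

Definition Eis (c : C) (k : nat) (z : C) : C :=
  if `[< uhp z >] then
    1 + c * limn (series (fun n : nat => (sigma k.-1 n.+1)%:R * qexp z ^+ n.+1 : C^o))
  else 0.

Definition E2 : C -> C := Eis (- 24) 2.
Definition E4 : C -> C := Eis 240 4.
Definition E6 : C -> C := Eis (- 504) 6.

Definition dq (f : C -> C) (z : C) : C :=
  if `[< uhp z >] then 'D_1 (f : C^o -> C^o) z / (2 * (pi : R)%:C * 'i) else 0.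

Definition Dk (k : R) (f : C -> C) : C -> C :=
  fun z => dq f z - (k / 12)%:C * E2 z * f z.

(** An element of H is a family n |-> h n of holomorphic functions with
   finite support; (f, n) is the family supported at n with value f. *)
Definition Hv := R -> (C -> C).

Definition inH (h : Hv) : Prop :=
  (forall n, Hol (h n)) /\ finite_set [set n | h n <> (fun _ => 0)].

Definition Op := Hv -> Hv.

Definition opeq (T S : Op) : Prop := forall h, inH h -> T h = S h.

Definition op_add (T S : Op) : Op := fun h n z => T h n z + S h n z.
Definition op_scale (c : C) (T : Op) : Op := fun h n z => c * T h n z.
Definition op_id : Op := fun h => h.

(** delta (f, n) = (D_n f, n + 2) *)
Definition delta : Op := fun h m => Dk (m - 2) (h (m - 2)).
(** e_4 (f, n) = (E_4 f, n + 4), e_6 (f, n) = (E_6 f, n + 6) *)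
Definition e4 : Op := fun h m z => E4 z * h (m - 4) z.
Definition e6 : Op := fun h m z => E6 z * h (m - 6) z.

Inductive inRalg : Op -> Prop :=
| Ralg_delta : inRalg delta
| Ralg_e4 : inRalg e4
| Ralg_e6 : inRalg e6
| Ralg_id : inRalg op_id
| Ralg_add T S : inRalg T -> inRalg S -> inRalg (op_add T S)
| Ralg_scale c T : inRalg T -> inRalg (op_scale c T)
| Ralg_comp T S : inRalg T -> inRalg S -> inRalg (T \o S).

Definition mono (i j : nat) : C -> C := fun z => oneH z * E4 z ^+ i * E6 z ^+ j.

Definition Mk (k : nat) (f : C -> C) : Prop :=
  exists c : nat -> nat -> C,
    f = fun z => \sum_(i < k.+1) \sum_(j < k.+1 | (4 * i + 6 * j)%N == k)
                   c i j * mono i j z.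

(** delta^l on M_w (landing in M_{w+2l}): D_{w+2(l-1)} o ... o D_{w+2} o D_w *)
Fixpoint dM (l w : nat) (f : C -> C) : C -> C :=
  match l with
  | 0 => f
  | l'.+1 => Dk (w + 2 * l')%:R (dM l' w f)
  end.

(** An element sum_p r_p xi^p (r_p in M) is encoded by its homogeneous
   components: s k p is the weight-k component of r_p. *)
Definition Sk := nat -> nat -> (C -> C).

Definition isSk (s : Sk) : Prop :=
  (forall k p, Mk k (s k p)) /\
  (exists N, forall k p, (N <= k)%N \/ (N <= p)%N -> s k p = (fun _ => 0)).

Definition sk_add (s t : Sk) : Sk := fun k p z => s k p z + t k p z.
Definition sk_scale (c : C) (s : Sk) : Sk := fun k p z => c * s k p z.
Definition sk_one : Sk := fun k p => if (k == 0%N) && (p == 0%N) then oneH else (fun _ => 0).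

(** product determined by xi r = r xi + delta(r):
   (a xi^m)(b xi^n) = sum_l binom(m,l) a delta^l(b) xi^(m+n-l) *)
Definition sk_mul (s t : Sk) : Sk := fun k p z =>
  \sum_(wa < k.+1) \sum_(wb < k.+1) \sum_(l < k.+1) \sum_(m < (p + k).+1)
   \sum_(n < p.+1)
     (if [&& (wa + wb + 2 * l)%N == k, (l <= m)%N & (m + n - l)%N == p]
      then ('C(m, l))%:R * s wa m z * dM l wb (t wb n) z else 0).

Definition sk_mono (i j k : nat) : Sk :=
  fun w p => if (w == 4 * i + 6 * j)%N && (p == k) then mono i j else (fun _ => 0).

End ModularDefs.

(* Main.v *)
(** The map sends [sum_p r_p xi^p] to [sum_p r_p delta^p]. It is multiplicative
    by the Leibniz rule for [delta], and it is injective because a differential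
    operator [sum_p g_p D^p] that kills all powers [(w - z)^j] vanishes at [z];
    no algebraic independence of [E4] and [E6] is needed. Two facts carry the
    analytic weight. First, [delta] can be iterated on [H] only because the
    derivative of a holomorphic function is again holomorphic: this is the Cauchy
    formula [f(z) I(1/(w-z)) = I(f(w)/(w-z))], where [I] is a limit of trapezoidal
    sums along a square and the nonzero factor [I(1/(w-z))] need not be computed.
    Second, [M] is stable under [delta] by the Ramanujan identities
    [D E4 = -E6/3] and [D E6 = -E4^2/2]. On Fourier coefficients these are
    convolution identities for divisor sums; they follow from the bijection
    [(a,b,x,y) -> (a-b,b,x,x+y)] between the solutions of [a x + b y = n] with
    [a > b] and those with [y > x], applied to suitable symmetric forms in [x, y]. *)

Require Import Defs.
From mathcomp Require Import all_boot all_order all_algebra.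
From mathcomp Require Import complex ring lra zify.
From mathcomp Require Import all_classical all_reals all_analysis.
Import Order.TTheory GRing.Theory Num.Theory ComplexField.Normc numFieldNormedType.Exports.
Set Implicit Arguments.
Unset Strict Implicit.
Unset Printing Implicit Defensive.
Local Open Scope ring_scope.
Local Open Scope complex_scope.

(** * Complex derivatives *)

(** The difference quotient [(f w - f z) / (w - z)] behind Cauchy's formula is differentiable except
    at [z], where it is only bounded. Goursat's bisection therefore carries an error budget
    consisting of area plus a point mass at [z], chosen to be additive under subdivision. After
    division by [I(1/(w-z))], [f] is a quotient of two functions that can be differentiated twice
    under the contour. The forms used for divisor sums are even-degree invariants of the
    permutations of [X, Y, -X-Y]. For such [p], [p X (Y - X) = p X (- Y)], so [p X Y - p X (Y - X)]
    is twice the part of [p] odd in [Y]; degrees 4 and 6 provide the three convolutions that occur.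
    In the injectivity argument the degree in [H] sees only [k + 2 p] for a coefficient of weight
    [k] at [xi^p]. The test functions separate the exponents [p]; the degree then separates the
    weights. *)

Section ComplexDerivative.
Variable R : realType.
Local Notation C := R[i].
Implicit Types (f g : C -> C) (z w h l : C).

Lemma normc_ge0 z : 0 <= normc z.
Proof. by case: z => a b; rewrite /normc sqrtr_ge0. Qed.

Lemma norm_normc z : `|z| = (normc z)%:C. Proof. by []. Qed.

Lemma normc_eq0 z : (normc z == 0) = (z == 0).
Proof.
apply/eqP/eqP => [/eq0_normc//|->]; exact: normc0.
Qed.

Lemma normc_gt0 z : (0 < normc z) = (z != 0).
Proof. by rewrite lt0r normc_eq0 normc_ge0 andbT. Qed.

Lemma normc_real (x : R) : normc x%:C = `|x|.
Proof. by rewrite /normc /= expr0n addr0 sqrtr_sqr. Qed.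

Lemma normcX z n : normc (z ^+ n) = normc z ^+ n.
Proof. by elim: n => [|n IH]; rewrite ?expr0 ?normc1 // !exprS normcM IH. Qed.

Lemma le_normc_sub z w : normc (z - w) <= normc z + normc w.
Proof. by rewrite -(normcN w); exact: le_normcD. Qed.

Lemma normc_nat n : normc (n%:R : C) = n%:R.
Proof. by rewrite -(rmorph_nat (real_complex R)) normc_real ger0_norm. Qed.

Lemma normc_sum (I : Type) (r : seq I) (P : pred I) (F : I -> C) :
  normc (\sum_(i <- r | P i) F i) <= \sum_(i <- r | P i) normc (F i).
Proof.
elim/big_rec2 : _ => [|i a b _ H]; first by rewrite normc0.
by apply: (le_trans (le_normcD _ _)); rewrite lerD2l.
Qed.

Lemma Re_le_normc z : `|complex.Re z| <= normc z.
Proof. by have := normc_ge_Re z; rewrite norm_normc lecR. Qed.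

Lemma Im_le_normc z : `|complex.Im z| <= normc z.
Proof.
by case: z => a b; rewrite /normc /= -sqrtr_sqr ler_wsqrtr // lerDr sqr_ge0.
Qed.

Lemma normc_le_ReIm z : normc z <= `|complex.Re z| + `|complex.Im z|.
Proof.
case: z => a b; rewrite [leRHS]/=.
have -> : a +i* b = a%:C + 'i * b%:C by rewrite [LHS]complexE.
apply: (le_trans (le_normcD _ _)); rewrite normcM !normc_real lerD2l.
by rewrite /normc /= expr0n add0r expr1n sqrtr1 mul1r.
Qed.

(** The norm of [R[i]] as a normed space takes its values in [R[i]]. With a real epsilon, the real
    norm [normc] and no division by [h], estimates become real arithmetic. *)
Definition cdiff f z l := forall e : R, 0 < e -> exists2 d : R, 0 < d &
  forall h, normc h < d -> normc (f (z + h) - f z - l * h) <= e * normc h.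

Lemma cdiffP f z l : is_derive (z : C^o) (1 : C^o) (f : C^o -> C^o) l <-> cdiff f z l.
Proof.
pose q (h : C^o) : C^o := h^-1 *: (((f : C^o -> C^o) \o shift (z : C^o)) (h *: (1 : C^o)) - f z).
have qE h : q h = h^-1 * (f (z + h) - f z).
  by rewrite /q /= /shift /= [h *: _]mulr1 [h + z]addrC.
have key : (q @ 0^' --> (l : C^o))%classic <-> cdiff f z l.
  split=> H.
    move=> e e0; have e0' : 0 < e%:C by rewrite ltcR.
    move/cvgrPdist_le : H => /(_ _ e0') => -[d /= d0 H].
    (* A positive element of [R[i]] has imaginary part 0. *)
    have [dr dI] : d = (complex.Re d)%:C /\ 0 < complex.Re d.
      by move: d0; rewrite ltcE /= => /andP[/eqP h1 h2]; split=> //; case: d h1 {H h2} => a b /= ->.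
    exists (complex.Re d) => // h hd.
    have [->|h0] := eqVneq h 0.
      by rewrite addr0 subrr mulr0 subr0 normc0 mulr0.
    have : `|(l : C^o) - q h| <= e%:C.
      by apply: H => //=; rewrite /ball_ /= sub0r normrN dr norm_normc ltcR.
    rewrite qE norm_normc lecR => H1.
    have -> : f (z + h) - f z - l * h = - (l - h^-1 * (f (z + h) - f z)) * h by field.
    by rewrite normcM normcN ler_wpM2r // normc_ge0.
  apply/cvgrPdist_le => e /=; case: e => e e2; rewrite ltcE /= => /andP[/eqP -> e0].
  have [d d0 Hd] := H _ e0.
  exists (d%:C) => /=; first by rewrite ltcR.
  move=> h /=; rewrite sub0r normrN norm_normc ltcR => hd h0.
  rewrite qE norm_normc lecR -(ler_pM2r (x := normc h)) ?normc_gt0 // -normcM.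
  have -> : (l - h^-1 * (f (z + h) - f z)) * h = - (f (z + h) - f z - l * h) by field.
  by rewrite normcN Hd.
rewrite -key; split => [[H1 H2]|H].
  by rewrite -H2 /derive; exact: H1.
split; first by apply/cvg_ex; exists l.
by apply: cvg_lim H; exact: norm_hausdorff.
Qed.

Lemma derivable_cdiff f z : derivable (f : C^o -> C^o) z 1 ->
  cdiff f z ('D_1 (f : C^o -> C^o) z).
Proof. by move=> H; apply/cdiffP; exact: derivableP. Qed.

Lemma cdiff_derivable f z l : cdiff f z l -> derivable (f : C^o -> C^o) z 1.
Proof. by move/cdiffP => H; exact: ex_derive. Qed.

Lemma cdiff_derive f z l : cdiff f z l -> 'D_1 (f : C^o -> C^o) z = l.
Proof. by move/cdiffP => H; exact: derive_val. Qed.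

Lemma cdiff_cst (c : C) z : cdiff (fun _ => c) z 0.
Proof.
by move=> e e0; exists 1 => // h _; rewrite subrr mul0r subr0 normc0 mulr_ge0 ?normc_ge0 // ltW.
Qed.

Lemma cdiff_id z : cdiff (fun w => w) z 1.
Proof.
move=> e e0; exists 1 => // h _; rewrite mul1r.
have -> : z + h - z - h = 0 by ring.
by rewrite normc0 mulr_ge0 ?normc_ge0 // ltW.
Qed.

Lemma cdiffD f g z l m : cdiff f z l -> cdiff g z m ->
  cdiff (fun w => f w + g w) z (l + m).
Proof. by move=> /cdiffP H1 /cdiffP H2; apply/cdiffP; exact: is_deriveD. Qed.

Lemma cdiffM f g z l m : cdiff f z l -> cdiff g z m ->
  cdiff (fun w => f w * g w) z (l * g z + f z * m).
Proof.
move=> /cdiffP H1 /cdiffP H2; apply/cdiffP.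
have -> : l * g z + f z * m = (f z : C^o) *: (m : C^o) + (g z : C^o) *: (l : C^o).
  by rewrite addrC [l * _]mulrC.
exact: (@is_deriveM _ C^o f g).
Qed.

Lemma cdiffZ (c : C) f z l : cdiff f z l -> cdiff (fun w => c * f w) z (c * l).
Proof.
move=> H; have := cdiffM (cdiff_cst c z) H; by rewrite mul0r add0r.
Qed.

Lemma cdiffN f z l : cdiff f z l -> cdiff (fun w => - f w) z (- l).
Proof. by move=> /cdiffP H1; apply/cdiffP; exact: is_deriveN. Qed.

Lemma cdiffB f g z l m : cdiff f z l -> cdiff g z m ->
  cdiff (fun w => f w - g w) z (l - m).
Proof. by move=> H1 H2; apply: cdiffD => //; exact: cdiffN. Qed.

Lemma cdiffX f z l n : cdiff f z l ->
  cdiff (fun w => f w ^+ n) z (n%:R * f z ^+ n.-1 * l).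
Proof.
move=> H; elim: n => [|n IH].
  by rewrite !mul0r; exact: cdiff_cst.
have := cdiffM H IH.
have -> : l * f z ^+ n + f z * (n%:R * f z ^+ n.-1 * l) = n.+1%:R * f z ^+ n.+1.-1 * l.
  case: n {IH} => [|n]; first by rewrite expr0 /=; ring.
  by rewrite /= -!natr1 !exprS; ring.
by under [X in cdiff X _ _ -> _]eq_fun do rewrite -exprS.
Qed.

Lemma cdiffV f z l : f z != 0 -> cdiff f z l ->
  cdiff (fun w => (f w)^-1) z (- l / f z ^+ 2).
Proof.
move=> f0 H; apply/cdiffP; apply: DeriveDef.
  exact: (@derivableV _ C^o f) f0 (cdiff_derivable H).
rewrite (@deriveV _ C^o f _ _ f0 (cdiff_derivable H)) (cdiff_derive H).
by rewrite [LHS]mulrC mulrN mulNr.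
Qed.

(** Functions are cut off to 0 outside the upper half plane; locality allows a formula valid near an
    interior point to be differentiated there. *)
Lemma cdiff_near f g z l (d : R) : 0 < d ->
  (forall h, normc h < d -> f (z + h) = g (z + h)) -> cdiff f z l -> cdiff g z l.
Proof.
move=> d0 E H e e0; have [d' d'0 Hd] := H e e0.
exists (Num.min d d') => [|h]; first by rewrite lt_min d0.
rewrite lt_min => /andP[h1 h2]; rewrite -E // -[g z]/(g z).
by have := E 0; rewrite addr0 => <-; [exact: Hd|rewrite normc0].
Qed.

Lemma cdiff_cont f z l : cdiff f z l -> forall e : R, 0 < e ->
  exists2 d : R, 0 < d & forall h, normc h < d -> normc (f (z + h) - f z) <= e.
Proof.
move=> H e e0; have [d d0 Hd] := H 1 ltr01.
have L : 0 < 1 + normc l by have := normc_ge0 l; lra.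
exists (Num.min d (e / (1 + normc l))); first by rewrite lt_min d0 divr_gt0.
move=> h; rewrite lt_min => /andP[h1 h2].
have -> : f (z + h) - f z = (f (z + h) - f z - l * h) + l * h by ring.
apply: (le_trans (le_normcD _ _)); rewrite normcM.
apply: (le_trans (lerD (Hd _ h1) (lexx _))).
move: h2; rewrite ltr_pdivlMr // => h2; lra.
Qed.

End ComplexDerivative.

(** * Goursat's theorem for trapezoidal sums *)

Section Goursat.
Variable R : realType.
Local Notation C := R[i].
Implicit Types (f g : C -> C) (a b c z w u v : C) (s e x y : R).

(* The trapezoidal sum with [2 ^ n] steps for the integral of [g] along [a, b].
   Halving a square is exact for these sums, so Goursat's bisection applies to
   them directly and no integral has to be constructed. *)
Fixpoint seg n g a b : C :=
  match n with
  | 0 => (b - a) * (g a + g b) / 2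
  | n'.+1 => seg n' g a ((a + b) / 2) + seg n' g ((a + b) / 2) b
  end.

Lemma eq_seg n f g a b : f =1 g -> seg n f a b = seg n g a b.
Proof. by move=> E; elim: n a b => [|n IH] a b /=; rewrite ?E ?IH. Qed.

Lemma seg_rev n g a b : seg n g b a = - seg n g a b.
Proof.
elim: n a b => [|n IH] a b /=; first by ring.
by rewrite [b + a]addrC (IH a) (IH _ b); ring.
Qed.

Lemma segD n f g a b : seg n (fun w => f w + g w) a b = seg n f a b + seg n g a b.
Proof. by elim: n a b => [|n IH] a b /=; [ring|rewrite !IH; ring]. Qed.

Lemma segZ n u g a b : seg n (fun w => u * g w) a b = u * seg n g a b.
Proof. by elim: n a b => [|n IH] a b /=; [ring|rewrite !IH; ring]. Qed.

(** The trapezoidal rule is exact on affine integrands at every level, so the affine part of a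
    function contributes 0 around a closed square. In Goursat's argument this replaces the primitive
    of an affine function. *)
Lemma seg_affine n u v a b :
  seg n (fun w => u + v * w) a b = u * (b - a) + v * (b ^+ 2 - a ^+ 2) / 2.
Proof. by elim: n a b => [|n IH] a b /=; [|rewrite !IH]; field. Qed.

(** All nodes arise from the end points by repeated halving, so closure of [S] under midpoints does
    the work of convexity. *)
Lemma seg_bound (S : C -> Prop) n g a b (M : R) :
  (forall u v, S u -> S v -> S ((u + v) / 2)) -> S a -> S b ->
  (forall w, S w -> normc (g w) <= M) ->
  normc (seg n g a b) <= M * normc (b - a).
Proof.
move=> Sm Sa Sb HM.
have h2 : normc (2^-1 : C) = 2^-1 by rewrite normcV normc_nat.
elim: n a b Sa Sb => [|n IH] a b Sa Sb /=.
  rewrite !normcM h2; have := HM _ Sa; have := HM _ Sb.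
  have := le_normcD (g a) (g b); have := normc_ge0 (b - a).
  move=> h H1 H3 H4; rewrite [M * _]mulrC -mulrA ler_wpM2l //; lra.
have Sab := Sm _ _ Sa Sb.
apply: (le_trans (le_normcD _ _)).
apply: (le_trans (lerD (IH _ _ Sa Sab) (IH _ _ Sab Sb))).
have -> : (a + b) / 2 - a = (b - a) / 2 by field.
have -> : b - (a + b) / 2 = (b - a) / 2 by field.
by rewrite normcM h2; lra.
Qed.

Definition sq n g c s : C :=
  let: (c1, c2, c3) := (c + s%:C, c + s%:C + 'i * s%:C, c + 'i * s%:C) in
  seg n g c c1 + seg n g c1 c2 + seg n g c2 c3 + seg n g c3 c.

Definition insq c s w :=
  (complex.Re c <= complex.Re w <= complex.Re c + s) &&
  (complex.Im c <= complex.Im w <= complex.Im c + s).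

Lemma eq_sq n f g c s : f =1 g -> sq n f c s = sq n g c s.
Proof. by move=> E; rewrite /sq !(eq_seg _ _ _ E). Qed.

Lemma sqD n f g c s : sq n (fun w => f w + g w) c s = sq n f c s + sq n g c s.
Proof. by rewrite /sq !segD; ring. Qed.

Lemma sqZ n u g c s : sq n (fun w => u * g w) c s = u * sq n g c s.
Proof. by rewrite /sq !segZ; ring. Qed.

Lemma sq_affine n u v c s : sq n (fun w => u + v * w) c s = 0.
Proof. by rewrite /sq !seg_affine; field. Qed.

Lemma half_real s : (s / 2)%:C = s%:C / 2 :> C.
Proof. by rewrite rmorphM /= fmorphV rmorph_nat. Qed.

(** Level [n.+1] on the square and level [n] on its quarters use the same nodes; the four inner
    edges are traversed in both directions and cancel. *)
Lemma sq_split n g c s : sq n.+1 g c s =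
  sq n g c (s / 2) + sq n g (c + (s / 2)%:C) (s / 2) +
  sq n g (c + 'i * (s / 2)%:C) (s / 2) +
  sq n g (c + (s / 2)%:C + 'i * (s / 2)%:C) (s / 2).
Proof.
rewrite /sq /= !half_real; set t := s%:C; set j : C := 'i.
have -> : (c + (c + t)) / 2 = c + t / 2 by field.
have -> : (c + t + (c + t + j * t)) / 2 = c + t + j * (t / 2) by field.
have -> : (c + t + j * t + (c + j * t)) / 2 = c + t / 2 + j * t by field.
have -> : (c + j * t + c) / 2 = c + j * (t / 2) by field.
have -> : c + t / 2 + t / 2 = c + t by field.
have -> : c + j * (t / 2) + t / 2 = c + t / 2 + j * (t / 2) by field.
have -> : c + j * (t / 2) + j * (t / 2) = c + j * t by field.
have -> : c + t / 2 + j * (t / 2) + t / 2 = c + t + j * (t / 2) by field.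
have -> : c + t + j * (t / 2) + j * (t / 2) = c + t + j * t by field.
have -> : c + t / 2 + j * (t / 2) + j * (t / 2) = c + t / 2 + j * t by field.
rewrite (seg_rev n g (c + t / 2) (c + t / 2 + j * (t / 2))).
rewrite (seg_rev n g (c + t / 2 + j * (t / 2)) (c + j * (t / 2))).
rewrite (seg_rev n g (c + t / 2 + j * (t / 2)) (c + t / 2 + j * t)).
rewrite (seg_rev n g (c + t + j * (t / 2)) (c + t / 2 + j * (t / 2))).
ring.
Qed.

Lemma ReD z w : complex.Re (z + w) = complex.Re z + complex.Re w.
Proof. by case: z; case: w. Qed.
Lemma ImD z w : complex.Im (z + w) = complex.Im z + complex.Im w.
Proof. by case: z; case: w. Qed.
Lemma ReN z : complex.Re (- z) = - complex.Re z. Proof. by case: z. Qed.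
Lemma ImN z : complex.Im (- z) = - complex.Im z. Proof. by case: z. Qed.
Lemma ReMi s : complex.Re ('i * s%:C) = 0 :> R.
Proof. by rewrite /=; ring. Qed.
Lemma ImMi s : complex.Im ('i * s%:C) = s :> R.
Proof. by rewrite /=; ring. Qed.
Lemma Rehalf z : complex.Re (z / 2) = complex.Re z / 2.
Proof.
have -> : (2^-1 : C) = (2^-1)%:C by rewrite fmorphV rmorph_nat.
by case: z => a b /=; ring.
Qed.
Lemma Imhalf z : complex.Im (z / 2) = complex.Im z / 2.
Proof.
have -> : (2^-1 : C) = (2^-1)%:C by rewrite fmorphV rmorph_nat.
by case: z => a b /=; ring.
Qed.

Definition on_sides c s w := insq c s w &&
  [|| complex.Re w == complex.Re c, complex.Re w == complex.Re c + s,
      complex.Im w == complex.Im c | complex.Im w == complex.Im c + s].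

(** The whole boundary is not closed under midpoints, but each side is, as [seg_bound] requires. *)
Definition side (i : 'I_4) c s w : bool := insq c s w &&
  match val i with
  | 0 => complex.Im w == complex.Im c
  | 1 => complex.Re w == complex.Re c + s
  | 2 => complex.Im w == complex.Im c + s
  | _ => complex.Re w == complex.Re c
  end.

Lemma side_on_sides i c s w : side i c s w -> on_sides c s w.
Proof.
rewrite /side /on_sides; case: i => -[|[|[|[|//]]]] _ /= /andP[-> ->] /=;
  by rewrite ?orbT.
Qed.

Lemma on_sides_insq c s w : on_sides c s w -> insq c s w.
Proof. by case/andP. Qed.

Lemma side_mid i c s u v : side i c s u -> side i c s v -> side i c s ((u + v) / 2).
Proof.
rewrite /side /insq !(Rehalf, Imhalf, ReD, ImD).
case: i => -[|[|[|[|//]]]] _ /= /andP[/andP[/andP[h1 h2] /andP[h3 h4]] /eqP h0]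
  /andP[/andP[/andP[h5 h6] /andP[h7 h8]] /eqP h9];
  (apply/andP; split; [apply/andP; split; apply/andP; split|apply/eqP]; lra).
Qed.

Lemma corner_sides c s : 0 <= s ->
  [/\ side 0 c s c /\ side 0 c s (c + s%:C),
      side 1 c s (c + s%:C) /\ side 1 c s (c + s%:C + 'i * s%:C),
      side 2%R c s (c + s%:C + 'i * s%:C) /\ side 2%R c s (c + 'i * s%:C) &
      side 3%R c s (c + 'i * s%:C) /\ side 3%R c s c].
Proof.
move=> s0; rewrite /side /insq !(ReD, ImD) !(ReMi, ImMi) /= !addr0.
by rewrite !lexx !lerDl !s0 !eqxx.
Qed.

Lemma sq_bound_sides n g c s (M : R) : 0 <= s ->
  (forall w, on_sides c s w -> normc (g w) <= M) -> normc (sq n g c s) <= 4 * M * s.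
Proof.
move=> s0 HM; have [[A1 A2] [B1 B2] [C1 C2] [D1 D2]] := corner_sides c s0.
have ni : normc ('i : C) = 1 by rewrite /normc /= expr0n add0r expr1n sqrtr1.
have ns : normc s%:C = s by rewrite normc_real ger0_norm.
have B i a b : side i c s a -> side i c s b -> normc (b - a) = s -> normc (seg n g a b) <= M * s.
  move=> Sa Sb <-; apply: (seg_bound (S := fun w => side i c s w)) => //.
    exact: side_mid.
  by move=> w /side_on_sides; exact: HM.
rewrite /sq; have -> : 4 * M * s = M * s + M * s + M * s + M * s by ring.
apply: (le_trans (le_normcD _ _)); apply: lerD; last first.
  apply: (B _ _ _ D1 D2); have -> : c - (c + 'i * s%:C) = - ('i * s%:C) by ring.
  by rewrite normcN normcM ni mul1r.
apply: (le_trans (le_normcD _ _)); apply: lerD; last first.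
  apply: (B _ _ _ C1 C2).
  have -> : c + 'i * s%:C - (c + s%:C + 'i * s%:C) = - s%:C by ring.
  by rewrite normcN.
apply: (le_trans (le_normcD _ _)); apply: lerD.
  by apply: (B _ _ _ A1 A2); have -> : c + s%:C - c = s%:C by ring.
apply: (B _ _ _ B1 B2).
have -> : (c + s%:C + 'i * s%:C) - (c + s%:C) = 'i * s%:C by ring.
by rewrite normcM ni mul1r.
Qed.

Lemma sq_bound n g c s (M : R) : 0 <= s ->
  (forall w, insq c s w -> normc (g w) <= M) -> normc (sq n g c s) <= 4 * M * s.
Proof.
by move=> s0 HM; apply: sq_bound_sides => // w /on_sides_insq; exact: HM.
Qed.

(** For [s > 0] the value is 2 inside the interval, 1 at its end points and 0 outside. *)
Definition nu1 x s y : R :=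
  (x <= y < x + s)%R%:R + (x < y <= x + s)%R%:R.

(* [nu c s z] counts the quadrant directions at [z] pointing into the square;
   unlike the indicator of the closed square it is additive under subdivision. *)
Definition nu c s z : R :=
  nu1 (complex.Re c) s (complex.Re z) * nu1 (complex.Im c) s (complex.Im z).

Lemma nu1_split x s y : 0 < s -> nu1 x s y = nu1 x (s / 2) y + nu1 (x + s / 2) (s / 2) y.
Proof.
move=> s0; rewrite /nu1; have -> : x + s / 2 + s / 2 = x + s by field.
have -> : (x <= y < x + s) = (x <= y < x + s / 2) || (x + s / 2 <= y < x + s).
  by apply/idP/idP; lra.
have -> : (x < y <= x + s) = (x < y <= x + s / 2) || (x + s / 2 < y <= x + s).
  by apply/idP/idP; lra.
have E1 : ~~ ((x <= y < x + s / 2) && (x + s / 2 <= y < x + s)) by lra.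
have E2 : ~~ ((x < y <= x + s / 2) && (x + s / 2 < y <= x + s)) by lra.
move: E1 E2; case: (x <= y < x + s / 2); case: (x + s / 2 <= y < x + s);
  case: (x < y <= x + s / 2); case: (x + s / 2 < y <= x + s); rewrite //= => _ _; ring.
Qed.

Lemma nu1_ge0 x s y : 0 <= nu1 x s y.
Proof. by rewrite /nu1 addr_ge0 // ler0n. Qed.

Lemma nu1_ge1 x s y : 0 < s -> x <= y <= x + s -> 1 <= nu1 x s y.
Proof.
move=> s0 /andP[h1 h2]; rewrite /nu1.
have : (x <= y < x + s) || (x < y <= x + s) by lra.
by case: (x <= y < x + s); case: (x < y <= x + s) => //= _; rewrite ?lerDl ?lerDr ?ler01.
Qed.

Lemma nu_split c s z : 0 < s -> nu c s z =
  nu c (s / 2) z + nu (c + (s / 2)%:C) (s / 2) z + nu (c + 'i * (s / 2)%:C) (s / 2) z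
  + nu (c + (s / 2)%:C + 'i * (s / 2)%:C) (s / 2) z.
Proof.
move=> s0; rewrite /nu !(nu1_split _ _ s0) !(ReD, ImD, ReMi, ImMi) /= !addr0; ring.
Qed.

Lemma nested_intervals (x s : nat -> R) :
  (forall k, x k <= x k.+1) -> (forall k, x k.+1 + s k.+1 <= x k + s k) ->
  (forall k, 0 <= s k) -> exists y, forall k, x k <= y <= x k + s k.
Proof.
move=> H1 H2 H3.
have L1 k j : x k <= x (k + j)%N.
  by elim: j => [|j IH]; rewrite ?addn0 // addnS; exact: le_trans IH (H1 _).
have L2 k j : x (k + j)%N + s (k + j)%N <= x k + s k.
  by elim: j => [|j IH]; rewrite ?addn0 // addnS; exact: le_trans (H2 _) IH.
have L k j : x k <= x j + s j.
  apply: (le_trans (L1 k j)); have := H3 (k + j)%N; have := L2 j k; rewrite addnC; lra.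
have ne : has_sup (range x).
  split; first by exists (x 0%N), 0%N.
  by exists (x 0%N + s 0%N) => _ [k _ <-].
exists (sup (range x)) => k; apply/andP; split.
  by apply: (ub_le_sup ne.2); exists k.
by apply: ge_sup ne.1 _ => _ [j _ <-].
Qed.

(** The budget is exactly additive under quartering: [s ^+ 2] is the area, and [nu] gives each
    square touching [z] a share that does not shrink with [s], which pays for an integrand that is
    merely bounded near [z]. *)
Definition small g z e c s := exists n0 : nat, forall n, (n0 <= n)%N ->
  normc (sq n g c s) <= e * (s ^+ 2 + nu c s z).

Lemma small_split g z e c s : 0 < s ->
  small g z e c (s / 2) -> small g z e (c + (s / 2)%:C) (s / 2) ->
  small g z e (c + 'i * (s / 2)%:C) (s / 2) ->
  small g z e (c + (s / 2)%:C + 'i * (s / 2)%:C) (s / 2) -> small g z e c s.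
Proof.
move=> s0 [n1 h1] [n2 h2] [n3 h3] [n4 h4].
exists (maxn (maxn n1 n2) (maxn n3 n4)).+1; case=> // n.
rewrite ltnS !geq_max => /andP[/andP[/h1{}h1 /h2{}h2] /andP[/h3{}h3 /h4{}h4]].
rewrite sq_split (nu_split _ _ s0).
apply: (le_trans (le_normcD _ _)); apply: (le_trans (lerD (le_normcD _ _) (lexx _))).
apply: (le_trans (lerD (lerD (le_normcD _ _) (lexx _)) (lexx _))).
apply: (le_trans (lerD (lerD (lerD h1 h2) h3) h4)).
by rewrite le_eqVlt; apply/orP; left; apply/eqP; field.
Qed.

Lemma insq_dist c s v w : insq c s v -> insq c s w -> normc (v - w) <= 2 * s.
Proof.
move=> /andP[/andP[a1 a2] /andP[a3 a4]] /andP[/andP[b1 b2] /andP[b3 b4]].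
apply: (le_trans (normc_le_ReIm _)); rewrite ReD ImD ReN ImN.
have h1 : `|complex.Re v - complex.Re w| <= s by rewrite ler_norml; lra.
have h2 : `|complex.Im v - complex.Im w| <= s by rewrite ler_norml; lra.
by move: h1 h2; set p := `|_|; set q := `|_|; lra.
Qed.

(** Subtracting the tangent at [w] changes no sum around the square. The factor [e / 8] accounts for
    four sides of length [s] and distances up to [2 * s] from [w]. *)
Lemma small_local g z e w l : 0 < e -> cdiff g w l ->
  exists2 d : R, 0 < d & forall c s, 0 < s < d -> insq c s w -> small g z e c s.
Proof.
move=> e0 gw; have [d d0 Hd] := gw (e / 8) ltac:(lra).
exists (d / 2); first by lra.
move=> c s /andP[s0 sd] ws; exists 0%N => n _.
have E v : g v = (g w - l * w + l * v) + (g v - g w - l * (v - w)) by ring.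
rewrite (eq_sq _ _ _ E) sqD sq_affine add0r.
apply: (@le_trans _ _ (4 * (e / 8 * (2 * s)) * s)).
  apply: sq_bound => [|v vs]; first exact: ltW.
  have vw := insq_dist vs ws.
  have -> : g v = g (w + (v - w)) by congr g; ring.
  apply: (le_trans (Hd _ _)); first by apply: (le_lt_trans vw); lra.
  by rewrite ler_wpM2l //; lra.
have -> : 4 * (e / 8 * (2 * s)) * s = e * (s ^+ 2) by field.
by rewrite ler_pM2l // lerDl mulr_ge0 ?nu1_ge0.
Qed.

(** The perimeter bound [4 * M * s] drops below [e] for small [s], while [nu] is at least 1 on every
    square containing [z]. *)
Lemma small_local_bounded g z e (M d : R) : 0 < e -> 0 < d ->
  (forall h, normc h < d -> normc (g (z + h)) <= M) ->
  exists2 d' : R, 0 < d' & forall c s, 0 < s < d' -> insq c s z -> small g z e c s.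
Proof.
move=> e0 d0 HM.
have M0 : 0 <= M by apply: le_trans (normc_ge0 _) (HM 0 _); rewrite normc0.
exists (Num.min (d / 2) (e / (4 * M + 1))).
  rewrite lt_min; apply/andP; split; first by lra.
  by rewrite divr_gt0 //; lra.
move=> c s /andP[s0]; rewrite lt_min => /andP[sd se] zs; exists 0%N => n _.
apply: (@le_trans _ _ (4 * M * s)).
  apply: sq_bound => [|v vs]; first exact: ltW.
  have -> : v = z + (v - z) by ring.
  by apply: HM; apply: (le_lt_trans (insq_dist vs zs)); lra.
apply: (@le_trans _ _ (e * 1)).
  by move: se; rewrite ltr_pdivlMr; lra.
rewrite ler_pM2l //; have s2 : 0 <= s ^+ 2 by rewrite sqr_ge0.
move: zs => /andP[/(nu1_ge1 s0) h1 /(nu1_ge1 s0) h2].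
have : 1 <= nu c s z by rewrite /nu; nra.
lra.
Qed.

Lemma half_pow_lt s e : 0 < e -> exists k, s / 2 ^+ k < e.
Proof.
move=> e0; have [k Hk] : exists k : nat, s / e < k%:R.
  by exists (Num.bound `|s / e|); apply: le_lt_trans (ler_norm _) (archi_boundP (normr_ge0 _)).
exists k; rewrite ltr_pdivrMr ?exprn_gt0 // mulrC -ltr_pdivrMr //.
by apply: (lt_trans Hk); rewrite -natrX ltr_nat ltn_expl.
Qed.

(** Bisection: a square that is not small has a quarter that is not small, and the nested quarters
    shrink to a point at which the local hypothesis is violated. *)
Lemma small_global g z e c s : 0 < s ->
  (forall w, insq c s w ->
     exists2 d : R, 0 < d & forall c' s', 0 < s' < d -> insq c' s' w -> small g z e c' s') ->
  small g z e c s.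
Proof.
move=> s0 loc; apply: contrapT => nS.
(* The corner of the first quarter, of side [t], that fails to be small; the fourth quarter is the
   default. *)
pose quad (c : C) (t : R) : C :=
  if `[< ~ small g z e c t >] then c
  else if `[< ~ small g z e (c + t%:C) t >] then c + t%:C
  else if `[< ~ small g z e (c + 'i * t%:C) t >] then c + 'i * t%:C
  else c + t%:C + 'i * t%:C.
have quadP c' t : 0 < t -> ~ small g z e c' t -> ~ small g z e (quad c' (t / 2)) (t / 2).
  move=> t0 n0; rewrite /quad; case: asboolP => // /contrapT h1.
  case: asboolP => // /contrapT h2; case: asboolP => // /contrapT h3 h4.
  exact: n0 (small_split t0 h1 h2 h3 h4).
have quadr c' t : 0 <= t -> complex.Re c' <= complex.Re (quad c' t) <= complex.Re c' + t.
  by move=> t0; rewrite /quad; do 3? (case: asboolP => _); rewrite ?ReD ?ReMi /=; lra.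
have quadi c' t : 0 <= t -> complex.Im c' <= complex.Im (quad c' t) <= complex.Im c' + t.
  by move=> t0; rewrite /quad; do 3? (case: asboolP => _); rewrite ?ImD ?ImMi /= ?addr0; lra.
pose t k : R := s / 2 ^+ k.
have t0 k : 0 < t k by rewrite divr_gt0 // exprn_gt0.
have tS k : t k.+1 = t k / 2 by rewrite /t exprS; field; rewrite expf_neq0.
pose cc := fix cc k := if k is k'.+1 then quad (cc k') (t k'.+1) else c.
have nSk k : ~ small g z e (cc k) (t k).
  elim: k => [|k IH]; first by rewrite /t expr0 divr1.
  by rewrite [cc k.+1]/(quad (cc k) (t k.+1)) tS; exact: quadP.
have rk k := quadr (cc k) (t k.+1) (ltW (t0 _)).
have ik k := quadi (cc k) (t k.+1) (ltW (t0 _)).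
have [|||x xP] := @nested_intervals (fun k => complex.Re (cc k)) t.
- by move=> k; have /andP[] := rk k.
- by move=> k; have /andP[_] := rk k; rewrite [cc k.+1]/(quad (cc k) (t k.+1)) tS; lra.
- by move=> k; exact: ltW.
have [|||y yP] := @nested_intervals (fun k => complex.Im (cc k)) t.
- by move=> k; have /andP[] := ik k.
- by move=> k; have /andP[_] := ik k; rewrite [cc k.+1]/(quad (cc k) (t k.+1)) tS; lra.
- by move=> k; exact: ltW.
have wP k : insq (cc k) (t k) (x +i* y) by rewrite /insq xP yP.
have [|d d0 Hd] := loc (x +i* y); first by have := wP 0%N; rewrite /t expr0 divr1.
have [k tk] := half_pow_lt s d0.
by apply: (nSk k); apply: Hd => //; rewrite t0.
Qed.

(** The total budget of the square is [s ^+ 2 + nu c s z], so the bisection is run with [e] divided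
    by it. The exceptional point [z] is there for difference quotients. *)
Lemma goursat g z c s (M d e : R) : 0 < s -> 0 < d -> 0 < e ->
  (forall h, normc h < d -> normc (g (z + h)) <= M) ->
  (forall w, insq c s w -> w <> z -> exists l, cdiff g w l) ->
  exists n0 : nat, forall n, (n0 <= n)%N -> normc (sq n g c s) <= e.
Proof.
move=> s0 d0 e0 gz gd; have sn : 0 < s ^+ 2 + nu c s z.
  by rewrite ltr_pwDl ?exprn_gt0 // mulr_ge0 ?nu1_ge0.
have [|n0 Hn] := @small_global g z (e / (s ^+ 2 + nu c s z)) c s s0.
  move=> w wQ; have e0' : 0 < e / (s ^+ 2 + nu c s z) by rewrite divr_gt0.
  have [->|/gd [//|l gl]] := pselect (w = z); first exact: small_local_bounded gz.
  exact: small_local gl.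
exists n0 => n /Hn; rewrite -mulrA mulVf ?mulr1 //; exact: lt0r_neq0.
Qed.

End Goursat.

(** * Ultralimits in place of integrals *)

Section UltraLimit.
Variable R : realType.
Local Notation C := R[i].

(* The sums [sq n] need not converge for a merely continuous integrand; an
   ultrafilter limit is a linear substitute for the contour integral. *)
Lemma real_ultralimit : exists lim : (nat -> R) -> R,
  [/\ forall u v B, (forall n, `|u n| <= B) -> (forall n, `|v n| <= B) ->
        lim (fun n => u n + v n) = lim u + lim v,
      forall c u B, (forall n, `|u n| <= B) -> lim (fun n => c * u n) = c * lim u &
      forall u B n0 M, (forall n, `|u n| <= B) -> (forall n, (n0 <= n)%N -> u n <= M) -> lim u <= M].
Proof.
have [U [UU sU]] := ultraFilterLemma eventually_filter.
have PU : ProperFilter U := ultra_proper.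
have cv (u : nat -> R) (B : R) : (forall n, `|u n| <= B) -> cvg (u @ U)%classic.
  move=> uB; have [|x [_ xu]] := @segment_compact R (- B) B (u @ U)%classic _.
    have uT : (u @^-1` `[- B, B] = setT)%classic.
      by apply/seteqP; split=> // n _ /=; rewrite in_itv /= -ler_norml.
    by change (U (u @^-1` `[- B, B])%classic); rewrite uT; exact: filterT.
  (* An ultrafilter converges to each of its cluster points: either [A] or its complement has its
     preimage in [U], and the complement would contradict clustering at [x]. *)
  apply/cvg_ex; exists x => A Ax.
  have [//|UA] := in_ultra_setVsetC (u @^-1` A)%classic UU.
  have uA : (u @ U)%classic (~` A)%classic by [].
  by have [y [nAy Ay]] := xu _ _ uA Ax.
exists (fun u => lim (u @ U)%classic); split.
- by move=> u v B uB vB; apply: limD; exact: cv.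
- by move=> c u B uB; apply: cvg_lim => //; apply: cvgMl_tmp; exact: cv uB.
move=> u B n0 M uB uM; apply: limr_le; first exact: cv uB.
by apply: sU; exists n0.
Qed.

Definition cbounded (u : nat -> C) := exists B : R, forall n, normc (u n) <= B.

(** The factor 2 comes from bounding real and imaginary parts separately. Bounds may start at [n0]
    because Goursat's theorem controls only fine subdivisions. The last clause serves to show that
    the winding integral is nonzero. *)
Definition ultralimit (L : (nat -> C) -> C) : Prop :=
  [/\ forall u v, cbounded u -> cbounded v -> L (fun n => u n + v n) = L u + L v,
      forall c u, cbounded u -> L (fun n => c * u n) = c * L u,
      forall u n0 (M : R), cbounded u -> (forall n, (n0 <= n)%N -> normc (u n) <= M) ->
        normc (L u) <= 2 * M &
      forall u (M : R), cbounded u -> (forall n, M <= complex.Im (u n)) -> M <= complex.Im (L u)].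

Lemma complex_ultralimit : exists L, ultralimit L.
Proof.
have [l [lD lZ lle]] := real_ultralimit.
have bRe (u : nat -> C) (B : R) : (forall n, normc (u n) <= B) -> forall n, `|complex.Re (u n)| <= B.
  by move=> uB n; exact: le_trans (Re_le_normc _) (uB n).
have bIm (u : nat -> C) (B : R) : (forall n, normc (u n) <= B) -> forall n, `|complex.Im (u n)| <= B.
  by move=> uB n; exact: le_trans (Im_le_normc _) (uB n).
have lN (u : nat -> R) (B : R) : (forall n, `|u n| <= B) -> l (fun n => - u n) = - l u.
  move=> uB; rewrite -mulN1r -(lZ _ _ _ uB); congr l.
  by apply/funext => n; rewrite mulN1r.
have lle' (u : nat -> R) (B : R) n0 (M : R) : (forall n, `|u n| <= B) -> (forall n, (n0 <= n)%N ->
    M <= u n) -> M <= l u.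
  move=> uB uM; rewrite -lerN2 -(lN _ _ uB); apply: (lle _ B n0) => n.
    by rewrite normrN.
  by move/uM; rewrite lerN2.
exists (fun u => l (fun n => complex.Re (u n)) +i* l (fun n => complex.Im (u n))); split.
- move=> u v [B uB] [B' vB]; pose D := Num.max B B'.
  have uD n : normc (u n) <= D by rewrite le_max uB.
  have vD n : normc (v n) <= D by rewrite le_max vB orbT.
  rewrite -[RHS]/(Complex _ _); congr Complex.
    rewrite -(lD _ _ D (bRe _ _ uD) (bRe _ _ vD)); congr l; apply/funext => n; exact: ReD.
  rewrite -(lD _ _ D (bIm _ _ uD) (bIm _ _ vD)); congr l; apply/funext => n; exact: ImD.
- move=> [a b] u [B uB]; have hR := bRe _ _ uB; have hI := bIm _ _ uB.
  have bM (x : R) (w : nat -> R) n : (forall n, `|w n| <= B) -> `|x * w n| <= (`|a| + `|b|) * B +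
      `|x| * B.
    move=> wB; have B0 : 0 <= B by exact: le_trans (normr_ge0 _) (wB 0%N).
    by rewrite normrM; apply: (le_trans (ler_wpM2l (normr_ge0 x) (wB n))); rewrite lerDr mulr_ge0
        ?addr_ge0.
  (* Additivity of [l] asks for one bound common to both sequences; [2 * (|a| + |b|) * B] serves all
     the products. *)
  have bMa (w : nat -> R) n : (forall n, `|w n| <= B) -> `|a * w n| <= 2 * (`|a| + `|b|) * B.
    move=> wB; have B0 : 0 <= B by exact: le_trans (normr_ge0 _) (wB 0%N).
    apply: (le_trans (bM a w n wB)); have := normr_ge0 b; have := normr_ge0 a.
    set p := `|a|; set q := `|b| => p0 q0; nra.
  have bMb (w : nat -> R) n : (forall n, `|w n| <= B) -> `|b * w n| <= 2 * (`|a| + `|b|) * B.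
    move=> wB; have B0 : 0 <= B by exact: le_trans (normr_ge0 _) (wB 0%N).
    apply: (le_trans (bM b w n wB)); have := normr_ge0 b; have := normr_ge0 a.
    set p := `|a|; set q := `|b| => p0 q0; nra.
  have bMn (w : nat -> R) n : (forall n, `|w n| <= B) -> `|- (b * w n)| <= 2 * (`|a| + `|b|) * B.
    by rewrite normrN; exact: bMb.
  rewrite -[RHS]/(Complex _ _); congr Complex.
    rewrite -(lZ a _ B hR) -(lZ b _ B hI) -(lN _ (2 * (`|a| + `|b|) * B)) -?(lD _ _ (2 * (`|a| +
        `|b|) * B)).
    + by congr l; apply/funext => n; case: (u n).
    + by move=> n; exact: (bMa _ n hR).
    + by move=> n; exact: (bMn _ n hI).
    by move=> n; exact: (bMb _ n hI).
  rewrite -(lZ a _ B hI) -(lZ b _ B hR) -(lD _ _ (2 * (`|a| + `|b|) * B)).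
  + by congr l; apply/funext => n; case: (u n).
  + by move=> n; exact: (bMa _ n hI).
  by move=> n; exact: (bMb _ n hR).
- move=> u n0 M [B uB] uM; apply: (le_trans (normc_le_ReIm _)); rewrite /=.
  have hR : `|l (fun n => complex.Re (u n))| <= M.
    rewrite ler_norml; apply/andP; split.
      apply: (lle' _ B n0) => [|n /uM h]; first exact: bRe.
      by have := le_trans (Re_le_normc _) h; rewrite ler_norml => /andP[].
    apply: (lle _ B n0) => [|n /uM h]; first exact: bRe.
    by have := le_trans (Re_le_normc _) h; rewrite ler_norml => /andP[].
  have hI : `|l (fun n => complex.Im (u n))| <= M.
    rewrite ler_norml; apply/andP; split.
      apply: (lle' _ B n0) => [|n /uM h]; first exact: bIm.
      by have := le_trans (Im_le_normc _) h; rewrite ler_norml => /andP[].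
    apply: (lle _ B n0) => [|n /uM h]; first exact: bIm.
    by have := le_trans (Im_le_normc _) h; rewrite ler_norml => /andP[].
  by move: hR hI; set p := `|_|; set q := `|_|; lra.
by move=> u M [B uB] uM /=; apply: (lle' _ B 0%N) => //; exact: bIm.
Qed.

End UltraLimit.

(** * Cauchy formula *)

Section CauchyFormula.
Variable R : realType.
Local Notation C := R[i].
Implicit Types (f g F : C -> C) (a b c z w u v : C) (s e x y : R).

(** With [u] the direction of the segment, [u * g w] is the integrand of its parametrisation.
    Applied to the four sides, this bounds the winding integral away from 0. *)
Lemma seg_im (S : C -> Prop) n g a b u (t k : R) :
  (forall u v, S u -> S v -> S ((u + v) / 2)) -> S a -> S b -> 0 <= t ->
  b - a = t%:C * u -> (forall w, S w -> k <= complex.Im (u * g w)) ->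
  t * k <= complex.Im (seg n g a b).
Proof.
move=> Sm + + + + Hk; elim: n a b t => [|n IH] a b t Sa Sb t0 ab /=.
  rewrite ab -!mulrA.
  have -> : t%:C * (u * ((g a + g b) / 2)) = t%:C * ((u * g a + u * g b) / 2) by ring.
  have -> : complex.Im (t%:C * ((u * g a + u * g b) / 2)) =
      t * (complex.Im (u * g a) + complex.Im (u * g b)) / 2.
    rewrite -mulrA -ImD -Imhalf; case: ((u * g a + u * g b) / 2) => p q /=; ring.
  have := Hk _ Sa; have := Hk _ Sb; set p := complex.Im _; set q := complex.Im _ => h1 h2.
  by rewrite -mulrA ler_wpM2l //; lra.
have Sab := Sm _ _ Sa Sb; rewrite ImD.
have -> : t * k = t / 2 * k + t / 2 * k by field.
apply: lerD; apply: IH => //; rewrite ?divr_ge0 // half_real;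
  by rewrite [RHS]mulrAC -ab; field.
Qed.

(** The quadratic remainder is uniform in [x0] at distance at least [r] from 0, which is what
    differentiation under the contour requires. *)
Lemma inv_diff_bound (x0 h : C) (r : R) : 0 < r -> r <= normc x0 -> normc h <= r / 2 ->
  normc ((x0 - h)^-1 - x0^-1 - (x0 ^+ 2)^-1 * h) <= 2 / r ^+ 3 * normc h ^+ 2.
Proof.
move=> r0 rx hr; have x00 : x0 != 0 by rewrite -normc_gt0; lra.
have xh : r / 2 <= normc (x0 - h).
  have := le_normcD (x0 - h) h; rewrite subrK; lra.
have xh0 : x0 - h != 0 by rewrite -normc_gt0; lra.
have -> : (x0 - h)^-1 - x0^-1 - (x0 ^+ 2)^-1 * h = h ^+ 2 * (x0 ^+ 2)^-1 * (x0 - h)^-1.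
  by field; rewrite xh0 x00.
rewrite !normcM !normcV !normcM -!expr2 -mulrA [leRHS]mulrC ler_wpM2l ?sqr_ge0 //.
have -> : 2 / r ^+ 3 = (r ^+ 2)^-1 * (r / 2)^-1 by field; exact: lt0r_neq0.
rewrite ler_pM ?invr_ge0 ?exprn_ge0 ?normc_ge0 //.
  by rewrite lef_pV2 ?posrE ?exprn_gt0 // ?(lt_le_trans r0) // lerXn2r ?nnegrE //; lra.
by rewrite lef_pV2 ?posrE //; lra.
Qed.

Lemma inv2_diff_bound (x0 h : C) (r : R) : 0 < r -> r <= normc x0 -> normc h <= r / 2 ->
  normc (((x0 - h) ^+ 2)^-1 - (x0 ^+ 2)^-1 - 2 * (x0 ^+ 3)^-1 * h) <= 16 / r ^+ 4 * normc h ^+ 2.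
Proof.
move=> r0 rx hr; have x00 : x0 != 0 by rewrite -normc_gt0; lra.
have xh : r / 2 <= normc (x0 - h).
  have := le_normcD (x0 - h) h; rewrite subrK; lra.
have xh0 : x0 - h != 0 by rewrite -normc_gt0; lra.
have -> : ((x0 - h) ^+ 2)^-1 - (x0 ^+ 2)^-1 - 2 * (x0 ^+ 3)^-1 * h =
   h ^+ 2 * ((3 - 2 * h * x0^-1) * (x0 ^- 2 * (x0 - h) ^- 2)).
  by field; rewrite xh0 x00.
rewrite normcM normcX mulrC ler_wpM2r ?sqr_ge0 //.
have hx : normc (h * x0^-1) <= 2^-1.
  rewrite normcM normcV ler_pdivrMr; lra.
(* [16 = 4 * 4]: the factor [3 - 2 * h / x0] is at most [3 + 1], and [(r / 2) ^+ 2] gives the other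
   4. *)
rewrite normcM; have -> : 16 / r ^+ 4 = 4 * ((r ^+ 2)^-1 * ((r / 2) ^+ 2)^-1).
  by field; exact: lt0r_neq0.
apply: ler_pM; rewrite ?normc_ge0 //.
  apply: (le_trans (le_normc_sub _ _)); rewrite -mulrA normcM !normc_nat; lra.
rewrite normcM !normcV !normcX ler_pM ?invr_ge0 ?exprn_ge0 ?normc_ge0 //.
  by rewrite lef_pV2 ?posrE ?exprn_gt0 // ?(lt_le_trans r0) // lerXn2r ?nnegrE //; lra.
by rewrite lef_pV2 ?posrE ?exprn_gt0 ?lerXn2r ?nnegrE //; lra.
Qed.

Definition bdd_sides c s g := exists M : R, forall w, on_sides c s w -> normc (g w) <= M.

Definition contour (L : (nat -> C) -> C) c s g := L (fun n => sq n g c s).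

Section Contour.
Variables (L : (nat -> C) -> C) (c : C) (s : R).
Hypotheses (LP : ultralimit L) (s0 : 0 < s).
Let I := contour L c s.

Lemma sq_cbounded g : bdd_sides c s g -> cbounded (fun n => sq n g c s).
Proof. by move=> [M gM]; exists (4 * M * s) => n; apply: sq_bound_sides => //; exact: ltW. Qed.

Lemma contourD f g : bdd_sides c s f -> bdd_sides c s g ->
  I (fun w => f w + g w) = I f + I g.
Proof.
have [LD _ _ _] := LP; move=> fb gb.
rewrite /I /contour -(LD _ _ (sq_cbounded fb) (sq_cbounded gb)).
by congr L; apply/funext => n; exact: sqD.
Qed.

Lemma contourZ u f : bdd_sides c s f -> I (fun w => u * f w) = u * I f.
Proof.
have [_ LZ _ _] := LP; move=> fb; rewrite /I /contour -(LZ u _ (sq_cbounded fb)).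
by congr L; apply/funext => n; exact: sqZ.
Qed.

Lemma contour_bound f (M : R) : (forall w, on_sides c s w -> normc (f w) <= M) ->
  normc (I f) <= 8 * M * s.
Proof.
have [_ _ LB _] := LP; move=> fM.
have -> : 8 * M * s = 2 * (4 * M * s) by ring.
apply: (LB _ 0%N) => [|n _]; first by apply: sq_cbounded; exists M.
by apply: sq_bound_sides => //; exact: ltW.
Qed.

Lemma bddZ u f : bdd_sides c s f -> bdd_sides c s (fun w => u * f w).
Proof.
by move=> [M fM]; exists (normc u * M) => w /fM h; rewrite normcM ler_wpM2l ?normc_ge0.
Qed.

Lemma bddD f g : bdd_sides c s f -> bdd_sides c s g -> bdd_sides c s (fun w => f w + g w).
Proof.
move=> [M fM] [N gN]; exists (M + N) => w wS.
by apply: (le_trans (le_normcD _ _)); rewrite lerD ?fM ?gN.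
Qed.

(** Differentiation under the contour: linearity of the ultralimit and a quadratic remainder uniform
    on the sides take the place of dominated convergence. *)
Lemma contour_cdiff (k0 k1 : C -> C -> C) z (A d : R) : 0 < d ->
  (forall h, normc h < d -> bdd_sides c s (k0 (z + h))) -> bdd_sides c s (k1 z) ->
  (forall w h, on_sides c s w -> normc h < d ->
     normc (k0 (z + h) w - k0 z w - k1 z w * h) <= A * normc h ^+ 2) ->
  cdiff (fun z => I (k0 z)) z (I (k1 z)).
Proof.
move=> d0 b0 b1 H e e0; set B := 8 * `|A| * s.
have B0 : 0 <= B by rewrite !mulr_ge0 //; exact: ltW.
exists (Num.min d (e / (B + 1))); first by rewrite lt_min d0 divr_gt0 //; lra.
move=> h; rewrite lt_min => /andP[h1 h2].
have bz : bdd_sides c s (k0 z) by have := b0 0; rewrite addr0; apply; rewrite normc0.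
have -> : I (k0 (z + h)) - I (k0 z) - I (k1 z) * h =
    I (fun w => k0 (z + h) w + ((-1) * k0 z w + (- h) * k1 z w)).
  have bz' := bddZ (-1) bz; have b1' := bddZ (- h) b1; have bz1 := bddD bz' b1'.
  by rewrite (contourD (b0 _ h1) bz1) (contourD bz' b1') !contourZ //; ring.
apply: (@le_trans _ _ (8 * (`|A| * normc h ^+ 2) * s)).
  apply: contour_bound => w wS.
  have -> : k0 (z + h) w + ((-1) * k0 z w + (- h) * k1 z w) = k0 (z + h) w - k0 z w - k1 z w * h by ring.
  by apply: (le_trans (H _ _ wS h1)); rewrite ler_wpM2r ?sqr_ge0 // ler_norm.
have -> : 8 * (`|A| * normc h ^+ 2) * s = (B * normc h) * normc h by rewrite /B; ring.
rewrite ler_wpM2r ?normc_ge0 //.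
by move: h2; rewrite ltr_pdivlMr; have := normc_ge0 h; nra.
Qed.

Definition cauchy_kernel F m z w : C := F w * ((w - z) ^+ m)^-1.

Lemma bdd_kernel F m z (B r : R) : 0 < r ->
  (forall w, on_sides c s w -> normc (F w) <= B) ->
  (forall w, on_sides c s w -> r <= normc (w - z)) ->
  bdd_sides c s (cauchy_kernel F m z).
Proof.
move=> r0 FB zr; exists (B * (r ^+ m)^-1) => w wS; rewrite normcM normcV normcX.
rewrite ler_pM ?normc_ge0 ?invr_ge0 ?exprn_ge0 ?normc_ge0 ?FB //.
by rewrite lef_pV2 ?posrE ?exprn_gt0 ?(lt_le_trans r0) ?zr ?lerXn2r ?nnegrE ?normc_ge0 ?zr //;
    exact: ltW.
Qed.

Lemma shift_dist z h w (r : R) : normc h < r / 2 -> r <= normc (w - z) ->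
  r / 2 <= normc (w - (z + h)).
Proof.
move=> hr zr; have -> : w - (z + h) = (w - z) - h by ring.
have := le_normcD (w - z - h) h; rewrite subrK; lra.
Qed.

(** A Cauchy transform of a bounded function is smooth off the contour. Its first two derivatives,
    here and in [contour_kernel2], are those used in [derive_cdiff]. *)
Lemma contour_kernel1 F z (B r : R) : 0 < r ->
  (forall w, on_sides c s w -> normc (F w) <= B) ->
  (forall w, on_sides c s w -> r <= normc (w - z)) ->
  cdiff (fun z => I (cauchy_kernel F 1 z)) z (I (cauchy_kernel F 2 z)).
Proof.
move=> r0 FB zr; have r2 : 0 < r / 2 by lra.
apply: (@contour_cdiff _ _ _ (B * (2 / r ^+ 3)) (r / 2)) => // [h hr||w h wS hr].
- by apply: (bdd_kernel _ r2 FB) => w /zr; exact: shift_dist.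
- exact: (bdd_kernel _ r0 FB).
rewrite /cauchy_kernel !expr1 -mulrA -!mulrBr normcM -mulrA.
have -> : w - (z + h) = (w - z) - h by ring.
rewrite ler_pM ?normc_ge0 ?FB //.
by apply: inv_diff_bound => //; [exact: zr|exact: ltW].
Qed.

Lemma contour_kernel2 F z (B r : R) : 0 < r ->
  (forall w, on_sides c s w -> normc (F w) <= B) ->
  (forall w, on_sides c s w -> r <= normc (w - z)) ->
  cdiff (fun z => I (cauchy_kernel F 2 z)) z (2 * I (cauchy_kernel F 3 z)).
Proof.
move=> r0 FB zr; have r2 : 0 < r / 2 by lra.
have b3 := bdd_kernel 3 r0 FB zr; rewrite -(contourZ 2 b3).
apply: (@contour_cdiff _ (fun z w => 2 * cauchy_kernel F 3 z w) _ (B * (16 / r ^+ 4)) (r / 2)) =>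
    // [h hr||w h wS hr].
- by apply: (bdd_kernel _ r2 FB) => w /zr; exact: shift_dist.
- exact: bddZ.
rewrite /cauchy_kernel.
have -> : w - (z + h) = (w - z) - h by ring.
have -> : F w / (w - z - h) ^+ 2 - F w / (w - z) ^+ 2 - 2 * (F w / (w - z) ^+ 3) * h =
  F w * (((w - z - h) ^+ 2)^-1 - ((w - z) ^+ 2)^-1 - 2 * ((w - z) ^+ 3)^-1 * h) by ring.
rewrite normcM -[B * _ * _]mulrA ler_pM ?normc_ge0 ?FB //.
by apply: inv2_diff_bound => //; [exact: zr|exact: ltW].
Qed.

Lemma frac_ge (p q r t : R) : 0 < r -> r <= p -> 0 < q -> q <= t -> r / t <= p / q.
Proof.
move=> r0 rp q0 qt; apply: ler_pM; rewrite ?invr_ge0 ?(ltW r0) ?(le_trans (ltW q0)) //.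
by rewrite lef_pV2 // posrE // (lt_le_trans q0).
Qed.

(** On a side of direction [u], the imaginary part of [u / (w - z)] is the distance from [z] to the
    line of that side divided by the squared distance of [w] and [z], hence at least
    [r / (2 * s ^+ 2)]. The contributions of the four sides add up; the classical value of the
    integral is 2 pi i. *)
Lemma contour_winding z (r : R) : 0 < r ->
  complex.Re c + r <= complex.Re z <= complex.Re c + s - r ->
  complex.Im c + r <= complex.Im z <= complex.Im c + s - r ->
  I (cauchy_kernel (fun=> 1) 1 z) != 0.
Proof.
move=> r0 /andP[z1 z2] /andP[z3 z4].
have sd w : on_sides c s w -> r <= normc (w - z).
  move=> /andP[_ /or4P[] /eqP wE].
  - apply: le_trans (Re_le_normc _); rewrite ReD ReN wE ler_normr; lra.
  - apply: le_trans (Re_le_normc _); rewrite ReD ReN wE ler_normr; lra.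
  - apply: le_trans (Im_le_normc _); rewrite ImD ImN wE ler_normr; lra.
  apply: le_trans (Im_le_normc _); rewrite ImD ImN wE ler_normr; lra.
have bk : bdd_sides c s (cauchy_kernel (fun=> 1) 1 z).
  by apply: (@bdd_kernel _ 1 z 1 r) => // w _; rewrite normc1.
have [_ _ _ LI] := LP.
suff H : s * (r / (2 * s ^+ 2)) * 4 <= complex.Im (I (cauchy_kernel (fun=> 1) 1 z)).
  apply/eqP => E; move: H; rewrite E /= leNgt => /negP; apply.
  by rewrite !mulr_gt0 ?invr_gt0 ?mulr_gt0 ?exprn_gt0.
apply: LI => [|n]; first exact: sq_cbounded.
have [[A1 A2] [B1 B2] [C1 C2] [D1 D2]] := corner_sides c (ltW s0).
(* The second alternative, [w = z], is refuted on each side, where one coordinate differs by at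
   least [r]. *)
have key w : insq c s w -> forall p, r <= p ->
    r / (2 * s ^+ 2) <= p / ((complex.Re w - complex.Re z) ^+ 2 + (complex.Im w - complex.Im z) ^+ 2)
    \/ (complex.Re w - complex.Re z) ^+ 2 + (complex.Im w - complex.Im z) ^+ 2 = 0.
  move=> /andP[/andP[w1 w2] /andP[w3 w4]] p rp.
  have h1 : (complex.Re w - complex.Re z) ^+ 2 <= s ^+ 2.
    by rewrite -real_normK ?num_real // lerXn2r ?nnegrE // ?ler_norml; lra.
  have h2 : (complex.Im w - complex.Im z) ^+ 2 <= s ^+ 2.
    by rewrite -real_normK ?num_real // lerXn2r ?nnegrE // ?ler_norml; lra.
  have h3 := sqr_ge0 (complex.Re w - complex.Re z); have h4 := sqr_ge0 (complex.Im w - complex.Im z).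
  set q := _ + _; have [->|q0] := eqVneq q 0; [by right|left].
  by apply: frac_ge => //; rewrite /q; [rewrite lt0r q0 addr_ge0|lra].
have S i := @side_mid R i c s.
have insd i w : side i c s w -> insq c s w by case/andP.
have nz (a b : R) : a ^+ 2 + b ^+ 2 = 0 -> a = 0 /\ b = 0.
  by move=> /eqP; rewrite paddr_eq0 ?sqr_ge0 // !sqrf_eq0 => /andP[/eqP -> /eqP ->].
rewrite /sq !ImD; have -> : s * (r / (2 * s ^+ 2)) * 4 = s * (r / (2 * s ^+ 2)) + s * (r / (2 * s
    ^+ 2)) + s * (r / (2 * s ^+ 2)) + s * (r / (2 * s ^+ 2)) by ring.
rewrite !lerD //.
- apply: (@seg_im (fun w => side 0 c s w) _ _ _ _ 1) => //; [exact: S|exact: ltW| ring|].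
  move=> w wS; have := key w (insd _ _ wS) (complex.Im z - complex.Im w).
  move: wS; rewrite /cauchy_kernel !mul1r expr1 /side /= => /andP[_ /eqP wE].
  case: (w) (z) wE z3 => [w1' w2'] [z1' z2'] /= -> h /(_ ltac:(lra)) [H|/nz [_ H]]; last lra.
  by apply: (le_trans H); rewrite -mulNr opprB.
- apply: (@seg_im (fun w => side 1 c s w) _ _ _ _ 'i%R) => //; [exact: S|exact: ltW| ring|].
  move=> w wS; have := key w (insd _ _ wS) (complex.Re w - complex.Re z).
  move: wS; rewrite /cauchy_kernel !mul1r expr1 /side /= => /andP[_ /eqP wE].
  case: (w) (z) wE z2 => [w1' w2'] [z1' z2'] /= -> h /(_ ltac:(lra)) [H|/nz [H _]]; last lra.
  by apply: (le_trans H); rewrite mul0r add0r mul1r.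
- apply: (@seg_im (fun w => side 2%R c s w) _ _ _ _ (-1)) => //; [exact: S|exact: ltW| ring|].
  move=> w wS; have := key w (insd _ _ wS) (complex.Im w - complex.Im z).
  move: wS; rewrite /cauchy_kernel !mul1r expr1 mulN1r ImN /side /= => /andP[_ /eqP wE].
  case: (w) (z) wE z4 => [w1' w2'] [z1' z2'] /= -> h /(_ ltac:(lra)) [H|/nz [_ H]]; last lra.
  by apply: (le_trans H); rewrite opprK.
apply: (@seg_im (fun w => side 3%R c s w) _ _ _ _ (- 'i)%R) => //; [exact: S|exact: ltW| ring|].
move=> w wS; have := key w (insd _ _ wS) (complex.Re z - complex.Re w).
move: wS; rewrite /cauchy_kernel !mul1r expr1 mulNr ImN /side /= => /andP[_ /eqP wE].
case: (w) (z) wE z1 => [w1' w2'] [z1' z2'] /= -> h /(_ ltac:(lra)) [H|/nz [H _]]; last lra.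
by apply: (le_trans H); rewrite mul0r add0r mul1r -mulNr opprB.
Qed.

(** The difference quotient [g] is differentiable away from [z] and bounded near [z], so Goursat's
    theorem with exceptional point [z] makes its contour value 0. *)
Lemma contour_cauchy f z (M r : R) : 0 < r ->
  (forall w, on_sides c s w -> normc (f w) <= M) ->
  (forall w, on_sides c s w -> r <= normc (w - z)) ->
  (exists l, cdiff f z l) ->
  (forall w, insq c s w -> exists l, cdiff f w l) ->
  I (cauchy_kernel f 1 z) = f z * I (cauchy_kernel (fun=> 1) 1 z).
Proof.
move=> r0 fM zr [l fz] fd; have [_ _ LB _] := LP.
pose g w := (f w - f z) * (w - z)^-1.
have b1 : bdd_sides c s (cauchy_kernel (fun=> 1) 1 z).
  by apply: (@bdd_kernel _ 1 z 1 r) => // w _; rewrite normc1.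
have bf := bdd_kernel 1 r0 fM zr; have b1' := bddZ (- f z) b1.
have gE : g = fun w => cauchy_kernel f 1 z w + (- f z) * cauchy_kernel (fun=> 1) 1 z w.
  by apply/funext => w; rewrite /g /cauchy_kernel expr1; ring.
have Ig : I g = I (cauchy_kernel f 1 z) - f z * I (cauchy_kernel (fun=> 1) 1 z).
  by rewrite gE contourD // contourZ // mulNr.
apply/eqP; rewrite -subr_eq0 -Ig -normc_eq0; apply/eqP/le_anti; rewrite normc_ge0 andbT.
apply/ler_addgt0Pl => e e0; rewrite addr0.
have [d d0 gd] := fz 1 ltr01.
have gb h : normc h < d -> normc (g (z + h)) <= normc l + 1.
  move=> hd; rewrite /g [z + h - z]addrAC subrr add0r.
  (* At [h = 0] the quotient is 0 by the convention [0^-1 = 0]. *)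
  have [->|h0] := eqVneq h 0; first by rewrite invr0 mulr0 normc0 addr_ge0 ?normc_ge0.
  have := gd h hd; rewrite mul1r => H.
  rewrite normcM normcV ler_pdivrMr ?normc_gt0 //.
  have -> : f (z + h) - f z = (f (z + h) - f z - l * h) + l * h by ring.
  by apply: (le_trans (le_normcD _ _)); rewrite normcM; lra.
have [||n0 Hn] := goursat (g := g) (z := z) (c := c) (e := e / 2) s0 d0 _ gb.
- by lra.
- move=> w wQ wz; have [m fw] := fd w wQ.
  have wz0 : w - z != 0 by rewrite subr_eq0; apply/eqP.
  eexists; apply: cdiffM.
    by apply: cdiffB; [exact: fw|exact: cdiff_cst].
  by apply: cdiffV => //; apply: cdiffB; [exact: cdiff_id|exact: cdiff_cst].
(* The factor 2 is the one in the norm bound of [ultralimit]. *)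
have -> : e = 2 * (e / 2) by field.
by apply: (LB _ n0) => //; apply: sq_cbounded; rewrite gE; exact: bddD.
Qed.

End Contour.

(** Near [z0], Cauchy's formula presents [f] as a quotient of two Cauchy transforms along one fixed
    square. Both have two derivatives, so the quotient rule yields a formula for [f'] that can be
    differentiated once more. *)
Lemma derive_cdiff f z0 (d : R) : 0 < d ->
  (forall h, normc h < d -> exists l, cdiff f (z0 + h) l) ->
  exists l, cdiff (fun z => 'D_1 (f : C^o -> C^o) z) z0 l.
Proof.
move=> d0 fd; have [L LP] := complex_ultralimit R.
have [l0 f0] : exists l, cdiff f z0 l by have := fd 0; rewrite addr0; apply; rewrite normc0.
have [d1 d10 fb] := cdiff_cont f0 ltr01.
(* The square of side [s] centred at [z0] stays within [2 * s] of [z0]: inside the domain of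
   differentiability, and where [f] differs from [f z0] by at most 1. *)
have [s s0 [sd sd1]] : exists2 s : R, 0 < s & 2 * s < d /\ 2 * s < d1.
  have m0 : 0 < Num.min d d1 by rewrite lt_min d0.
  have [m1 m2] : Num.min d d1 <= d /\ Num.min d d1 <= d1 by rewrite !ge_min !lexx orbT.
  by exists (Num.min d d1 / 4); [lra|split; lra].
pose c := z0 - ((s / 2)%:C + 'i * (s / 2)%:C).
have Rec : complex.Re c = complex.Re z0 - s / 2.
  by rewrite /c ReD ReN ReD ReMi /= addr0.
have Imc : complex.Im c = complex.Im z0 - s / 2.
  by rewrite /c ImD ImN ImD ImMi /= add0r.
clearbody c.
have z0Q : insq c s z0 by rewrite /insq Rec Imc; apply/andP; split; apply/andP; split; lra.
have Qd w : insq c s w -> normc (w - z0) <= 2 * s by move=> wQ; exact: insq_dist wQ z0Q.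
(* Points within [s / 4] of the centre keep distance at least [s / 2 - s / 4 = r] from the sides. *)
have [r rE] : exists r, r = s / 4 by exists (s / 4).
have r0 : 0 < r by lra.
have inner h : normc h < r ->
    [/\ complex.Re c + r <= complex.Re (z0 + h) <= complex.Re c + s - r,
        complex.Im c + r <= complex.Im (z0 + h) <= complex.Im c + s - r &
        forall w, on_sides c s w -> r <= normc (w - (z0 + h))].
  move=> hr; have := le_trans (Re_le_normc h) (ltW hr); rewrite ler_norml => /andP[h1 h2].
  have := le_trans (Im_le_normc h) (ltW hr); rewrite ler_norml => /andP[h3 h4].
  split; rewrite ?ReD ?ImD ?Rec ?Imc; [by apply/andP; split; lra..|].
  move=> w /andP[_ /or4P[] /eqP wE].
  - apply: le_trans (Re_le_normc _); rewrite ReD ReN ReD wE Rec ler_normr; lra.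
  - apply: le_trans (Re_le_normc _); rewrite ReD ReN ReD wE Rec ler_normr; lra.
  - apply: le_trans (Im_le_normc _); rewrite ImD ImN ImD wE Imc ler_normr; lra.
  apply: le_trans (Im_le_normc _); rewrite ImD ImN ImD wE Imc ler_normr; lra.
have fQ w : insq c s w -> exists l, cdiff f w l.
  move=> wQ; have -> : w = z0 + (w - z0) by ring.
  by apply: fd; exact: le_lt_trans (Qd _ wQ) sd.
have fM w : on_sides c s w -> normc (f w) <= 1 + normc (f z0).
  move=> /on_sides_insq wQ; have -> : f w = f w - f z0 + f z0 by ring.
  apply: (le_trans (le_normcD _ _)); rewrite lerD2r.
  have -> : w = z0 + (w - z0) by ring.
  by apply: fb; exact: le_lt_trans (Qd _ wQ) sd1.
have oM w : on_sides c s w -> normc ((fun=> 1 : C) w : C) <= 1 by rewrite normc1.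
pose K F m z := contour L c s (cauchy_kernel F m z).
pose o := fun _ : C => (1 : C).
have Ko h : normc h < r -> K o 1%N (z0 + h) != 0.
  by move=> /inner [h1 h2 _]; exact: (contour_winding LP s0 r0).
have fK h : normc h < r -> f (z0 + h) = K f 1%N (z0 + h) * (K o 1%N (z0 + h))^-1.
  move=> hr; have [_ _ h3] := inner h hr.
  rewrite /K (contour_cauchy LP s0 r0 fM h3) ?mulfK //; first exact: Ko.
  by apply: fd; apply: (lt_trans hr); lra.
(* The quotient rule applied to [K f 1 / K o 1]. *)
pose G z := K f 2%N z * (K o 1%N z)^-1 + K f 1%N z * (- K o 2%N z / K o 1%N z ^+ 2).
have fG h : normc h < r -> cdiff f (z0 + h) (G (z0 + h)).
  move=> hr; have [_ _ h3] := inner h hr.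
  apply: (@cdiff_near _ (fun z => K f 1%N z * (K o 1%N z)^-1) _ _ _ (r - normc h)).
  - by rewrite subr_gt0.
  - move=> k kr; rewrite -addrA fK //; apply: (le_lt_trans (le_normcD _ _)); lra.
  apply: cdiffM; first exact: (contour_kernel1 LP s0 r0 fM h3).
  apply: cdiffV; first exact: Ko.
  exact: (contour_kernel1 LP s0 r0 oM h3).
have [l Gl] : exists l, cdiff G z0 l.
  have [_ _] := inner 0 ltac:(by rewrite normc0); rewrite addr0 => h3.
  have Ko0 : K o 1%N z0 != 0 by have := Ko 0; rewrite addr0; apply; rewrite normc0.
  have A1 := contour_kernel1 LP s0 r0 fM h3; have A2 := contour_kernel2 LP s0 r0 fM h3.
  have B1 := contour_kernel1 LP s0 r0 oM h3; have B2 := contour_kernel2 LP s0 r0 oM h3.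
  eexists; apply: cdiffD; apply: cdiffM.
  - exact: A2.
  - by apply: cdiffV => //; exact: B1.
  - exact: A1.
  apply: cdiffM; first by apply: cdiffN; exact: B2.
  apply: cdiffV; first by rewrite expf_neq0.
  by apply: cdiffX; exact: B1.
exists l; apply: (cdiff_near r0 _ Gl) => h hr; exact/esym/cdiff_derive/fG.
Qed.

End CauchyFormula.

(** * Convolutions of divisor sums *)

Section DivisorSums.
Variables (F : numFieldType) (n : nat).
Hypothesis n0 : (0 < n)%N.
Local Notation U := ('I_n.+1 * 'I_n.+1)%type.
Implicit Types (u v : U) (t : U * U).

(** The ordinals only make the sums finite: for [0 < m <= n] both factors of [m] fit below
    [n.+1]. *)
Definition facts m u : bool := [&& (0 < u.1)%N, (0 < u.2)%N & (u.1 * u.2 == m)%N].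

(** In the notation of the bijection, [t] is [((a, x), (b, y))]. *)
Definition quads t : bool :=
  [&& (0 < t.1.1)%N, (0 < t.1.2)%N, (0 < t.2.1)%N, (0 < t.2.2)%N &
      (t.1.1 * t.1.2 + t.2.1 * t.2.2 == n)%N].

Lemma quads_shift (h : nat -> nat -> F) :
  \sum_(t | quads t && (t.2.1 < t.1.1)%N) h t.1.2 t.2.2 =
  \sum_(t | quads t && (t.1.2 < t.2.2)%N) h t.1.2 (t.2.2 - t.1.2)%N.
Proof.
rewrite (reindex_onto
  (fun t : U * U => ((inord (t.1.1 + t.2.1), t.1.2), (t.2.1, inord (t.2.2 - t.1.2))) : U * U)
  (fun t : U * U => ((inord (t.1.1 - t.2.1), t.1.2), (t.2.1, inord (t.1.2 + t.2.2))) : U * U));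
      last first.
  case=> -[a x] [b y] /= /andP[/and5P[a0 x0 b0 y0 /eqP E] ba]; rewrite /= in a0 x0 b0 y0 E ba *.
  have ha := ltn_ord a; have hy := ltn_ord y.
  have xy : (x + y < n.+1)%N by nia.
  have ab : (a - b < n.+1)%N by lia.
  by congr (_, _, (_, _)); apply: val_inj; rewrite /= !inordK //; lia.
apply: eq_big => [[[a x] [b y]]|[[a x] [b y]]] /=.
  have ha := ltn_ord a; have hy := ltn_ord y; have hb := ltn_ord b; have hx := ltn_ord x.
  apply/idP/idP.
    rewrite /quads /= => /andP[/andP[/and5P[a0 x0 b0 y0 /eqP E] ba] /eqP[E1 E2]].
    have hab : (a + b < n.+1)%N.
      (* Out of range, [inord] defaults to 0, which contradicts positivity. *)
      by apply: contraTT a0 => H; rewrite /inord /insubd insubN.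
    have hyx : (y - x < n.+1)%N by lia.
    move: E a0 y0; rewrite !inordK // => E a0 y0.
    move: E2 => /(congr1 val); rewrite /= inordK ?inordK //; last by nia.
    move: E1 => /(congr1 val); rewrite /= !inordK //; last by lia.
    move=> E1 E2; move: ba; rewrite inordK // => ba.
    apply/andP; split; last by lia.
    by apply/and5P; split=> //; try lia; apply/eqP; nia.
  rewrite /quads /= => /andP[/and5P[a0 x0 b0 y0 /eqP E] xy].
  have hab : (a + b < n.+1)%N by nia.
  have hyx : (y - x < n.+1)%N by lia.
  rewrite !inordK //; have -> : (a + b - b = a)%N by lia.
  have -> : (x + (y - x) = y)%N by lia.
  rewrite !inord_val !eqxx andbT; apply/andP; split; last by lia.
  by apply/and5P; split=> //; try lia; apply/eqP; nia.
by move=> _; have hy := ltn_ord y; rewrite inordK //; lia.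
Qed.

Lemma quads_swap (Q : nat -> nat -> nat -> nat -> bool) (h : nat -> nat -> F) :
  \sum_(t | quads t && Q t.1.1 t.1.2 t.2.1 t.2.2) h t.1.2 t.2.2 =
  \sum_(t | quads t && Q t.2.1 t.2.2 t.1.1 t.1.2) h t.2.2 t.1.2.
Proof.
rewrite (reindex_onto (fun t : U * U => (t.2, t.1)) (fun t : U * U => (t.2, t.1))) /=; last by case.
apply: eq_bigl => -[[a x] [b y]] /=; rewrite eqxx andbT /quads /=.
congr (_ && _); rewrite addnC.
by case: (0 < a)%N; case: (0 < x)%N; case: (0 < b)%N; case: (0 < y)%N.
Qed.

Lemma sum_trichotomy (f g : U * U -> nat) (h : U * U -> F) :
  \sum_(t | quads t) h t = \sum_(t | quads t && (f t < g t)%N) h t +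
    \sum_(t | quads t && (g t < f t)%N) h t + \sum_(t | quads t && (f t == g t)%N) h t.
Proof.
rewrite (bigID (fun t => f t < g t)%N) /= -addrA; congr (_ + _).
rewrite (bigID (fun t => g t < f t)%N) /=; congr (_ + _); apply: eq_bigl => t.
  by rewrite -andbA; congr (_ && _); lia.
by rewrite -andbA; congr (_ && _); lia.
Qed.

(* Compare the decomposition of the sum of [p] according to the sign of [a - b]
   with the one according to the sign of [x - y]: [quads_shift] relates their
   off-diagonal parts, and only the two diagonals survive. *)
Lemma quads_identity (p G : F -> F -> F) :
  (forall X Y, p X Y = p Y X) -> (forall X Y, G X Y = G Y X) ->
  (forall X Y, p X Y - p X (Y - X) = G X Y) ->
  \sum_(t | quads t) G t.1.2%:R t.2.2%:R =
    \sum_(t | quads t && (t.1.2 == t.2.2 :> nat)) (G t.1.2%:R t.1.2%:R - p t.1.2%:R t.1.2%:R) +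
    \sum_(t | quads t && (t.2.1 == t.1.1 :> nat)) p t.1.2%:R t.2.2%:R.
Proof.
move=> ps Gs pG.
have E1 := sum_trichotomy (fun t => t.1.2) (fun t => t.2.2) (fun t => p t.1.2%:R t.2.2%:R).
have E2 := sum_trichotomy (fun t => t.2.1) (fun t => t.1.1) (fun t => p t.1.2%:R t.2.2%:R).
have E3 := sum_trichotomy (fun t => t.1.2) (fun t => t.2.2) (fun t => G t.1.2%:R t.2.2%:R).
have A1 : \sum_(t | quads t && (t.2.2 < t.1.2)%N) p t.1.2%:R t.2.2%:R =
    \sum_(t | quads t && (t.1.2 < t.2.2)%N) p t.1.2%:R t.2.2%:R.
  rewrite (quads_swap (fun _ x _ y => y < x)%N (fun x y => p x%:R y%:R)).
  by apply: eq_bigr => t _; rewrite ps.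
have A2 : \sum_(t | quads t && (t.1.1 < t.2.1)%N) p t.1.2%:R t.2.2%:R =
    \sum_(t | quads t && (t.2.1 < t.1.1)%N) p t.1.2%:R t.2.2%:R.
  rewrite (quads_swap (fun a _ b _ => a < b)%N (fun x y => p x%:R y%:R)).
  by apply: eq_bigr => t _; rewrite ps.
have A3 : \sum_(t | quads t && (t.2.2 < t.1.2)%N) G t.1.2%:R t.2.2%:R =
    \sum_(t | quads t && (t.1.2 < t.2.2)%N) G t.1.2%:R t.2.2%:R.
  rewrite (quads_swap (fun _ x _ y => y < x)%N (fun x y => G x%:R y%:R)).
  by apply: eq_bigr => t _; rewrite Gs.
have A4 := quads_shift (fun x y => p x%:R y%:R).
have A5 : \sum_(t | quads t && (t.1.2 < t.2.2)%N) G t.1.2%:R t.2.2%:R =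
   \sum_(t | quads t && (t.1.2 < t.2.2)%N) p t.1.2%:R t.2.2%:R -
   \sum_(t | quads t && (t.1.2 < t.2.2)%N) p t.1.2%:R (t.2.2 - t.1.2)%N%:R.
  rewrite -sumrB; apply: eq_bigr => t /andP[_ xy].
  by rewrite natrB ?pG // ltnW.
rewrite A2 in E2; rewrite A1 in E1; rewrite A3 in E3.
rewrite sumrB E3 A5 -A4.
have -> : \sum_(t | quads t && (t.1.2 == t.2.2 :> nat)) G t.1.2%:R t.2.2%:R =
  \sum_(t | quads t && (t.1.2 == t.2.2 :> nat)) G t.1.2%:R t.1.2%:R.
  by apply: eq_bigr => t /andP[_ /eqP <-].
have E4 : \sum_(t | quads t && (t.1.2 == t.2.2 :> nat)) p t.1.2%:R t.2.2%:R =
  \sum_(t | quads t && (t.1.2 == t.2.2 :> nat)) p t.1.2%:R t.1.2%:R.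
  by apply: eq_bigr => t /andP[_ /eqP <-].
rewrite E4 in E1.
move: E1 E2.
set s0 := \sum_(t | quads t) _; set s1 := \sum_(t | _) p _ _; set s2 := \sum_(t | _) p _ _.
set s3 := \sum_(t | _) p _ _; set s4 := \sum_(t | _) p _ _; set g := \sum_(t | _) G _ _.
move=> -> H.
have -> : s4 = s1 + s1 + s2 - s3 - s3 by rewrite H; ring.
ring.
Qed.

Lemma sum_ord_nat (f : nat -> F) (d : nat) : (d <= n.+1)%N ->
  \sum_(i < n.+1 | (0 < i < d)%N) f i = \sum_(1 <= i < d) f i.
Proof.
move=> dn; rewrite (big_nat_widen _ _ _ _ _ dn) (big_nat_widenl _ 0) // big_mkord.
by apply: eq_bigl => i; rewrite andbC.
Qed.

(** On the diagonal [x = y] the equation reads [(a + b) * x = n], and [a + b = m] has [m - 1]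
    solutions in positive integers. *)
Lemma sum_diag_dilation (k : nat -> F) :
  \sum_(t | quads t && (t.1.2 == t.2.2 :> nat)) k t.1.2 =
  \sum_(u | facts n u) (u.1%:R - 1) * k u.2.
Proof.
rewrite (partition_big (fun t => (inord (t.1.1 + t.2.1), t.1.2) : U) (facts n)) /=; last first.
  move=> [[a x] [b y]] /andP[/and5P[/= a0 x0 b0 y0 /eqP E] /eqP xy]; rewrite /facts /=.
  by rewrite inordK; [apply/and3P; split; try lia; apply/eqP; nia|nia].
apply: eq_bigr => -[m x] /= /and3P[/= m0 x0 /eqP E].
have hm := ltn_ord m.
rewrite (reindex_onto (fun i : 'I_n.+1 => ((i, x), (inord (m - i), x)) : U * U) (fun t => t.1.1))
    /=; last first.
  move=> [[a x'] [b y]] /andP[/andP[/and5P[/= a0 x'0 b0 y0 /eqP E'] /eqP xy] /eqP[E1 E2]].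
  have ab : (a + b < n.+1)%N by nia.
  subst x'; move: E1 => /(congr1 val) /=; rewrite inordK // => E1.
  by congr (_, _, (_, _)); apply: val_inj => //=; rewrite inordK; lia.
rewrite (eq_bigl (fun i : 'I_n.+1 => (0 < i < m)%N)).
  by rewrite (sum_ord_nat (fun=> k x)) 1?ltnW // sumr_const_nat -[k x *+ _]mulr_natl natrB.
move=> i /=; have hi := ltn_ord i; apply/idP/idP.
  rewrite /quads /= => /andP[/andP[/andP[/and5P[i0 _ mi _ /eqP E'] _] _] _].
  have mi' : (m - i < n.+1)%N by lia.
  by move: mi; rewrite inordK //; lia.
move=> /andP[i0 im]; have mi' : (m - i < n.+1)%N by lia.
rewrite /quads /= inordK // !eqxx andbT /=; have -> : (i + (m - i) = m)%N by lia.
rewrite inord_val !eqxx !andbT; apply/and5P; split=> //; lia.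
Qed.

(** On the diagonal [a = b] the equation reads [a * (x + y) = n]; the factor [d = x + y] is split in
    every way. *)
Lemma sum_diag_factor (p : nat -> nat -> F) :
  \sum_(t | quads t && (t.2.1 == t.1.1 :> nat)) p t.1.2 t.2.2 =
  \sum_(u | facts n u) \sum_(1 <= i < u.2) p i (u.2 - i)%N.
Proof.
rewrite (partition_big (fun t => (t.1.1, inord (t.1.2 + t.2.2)) : U) (facts n)) /=; last first.
  move=> [[a x] [b y]] /andP[/and5P[/= a0 x0 b0 y0 /eqP E] /eqP xy]; rewrite /facts /=.
  by rewrite inordK; [apply/and3P; split; try lia; apply/eqP; nia|nia].
apply: eq_bigr => -[a d] /= /and3P[/= a0 d0 /eqP E].
have hd := ltn_ord d.
rewrite (reindex_onto (fun i : 'I_n.+1 => ((a, i), (a, inord (d - i))) : U * U) (fun t => t.1.2))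
    /=; last first.
  move=> [[a' x] [b y]] /andP[/andP[/and5P[/= a'0 x0 b0 y0 /eqP E'] /eqP ba] /eqP[E1 E2]].
  have xy : (x + y < n.+1)%N by nia.
  subst a'; move: E2 => /(congr1 val) /=; rewrite inordK // => E2.
  by congr (_, _, (_, _)); apply: val_inj => //=; rewrite inordK; lia.
rewrite -(sum_ord_nat (fun i => p i (d - i)%N)) 1?ltnW //.
apply: eq_big => i /=; have hi := ltn_ord i; last first.
  by move=> _; rewrite inordK //; lia.
apply/idP/idP.
  rewrite /quads /= => /andP[/andP[/andP[/and5P[_ i0 _ di /eqP E'] _] _] _].
  have di' : (d - i < n.+1)%N by lia.
  by move: di; rewrite inordK //; lia.
move=> /andP[i0 id]; have di' : (d - i < n.+1)%N by lia.
rewrite /quads /= inordK // !eqxx andbT /=; have -> : (i + (d - i) = d)%N by lia.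
rewrite inord_val !eqxx !andbT; apply/and5P; split=> //; lia.
Qed.

Lemma sigma_facts k m : (0 < m <= n)%N ->
  (sigma k m)%:R = \sum_(u | facts m u) u.2%:R ^+ k :> F.
Proof.
move=> /andP[m0 mn]; rewrite /sigma natr_sum.
rewrite (reindex_onto (fun d : 'I_n.+1 => (inord (m %/ d), d) : U) (fun u => u.2)) /=; last first.
  move=> [a d] /and3P[/= a0 d0 /eqP E]; congr (_, _); apply: val_inj => /=.
  by rewrite -E mulnK // inord_val.
rewrite (big_ord_widen_cond n.+1 (fun d => (d %| m)%N) (fun d => (d ^ k)%:R)) //.
apply: eq_big => [d|d _]; last by rewrite natrX.
have hd := ltn_ord d; rewrite eqxx andbT /facts /=.
have hmd : (m %/ d < n.+1)%N by rewrite ltnS (leq_trans (leq_div _ _)).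
rewrite inordK //; apply/idP/idP.
  move=> /andP[dm _]; have d0 : (0 < d)%N by case: (nat_of_ord d) dm m0 => //; rewrite dvd0n => /eqP ->.
  by rewrite divnK // eqxx d0 divn_gt0 // dvdn_leq.
move=> /and3P[_ d0 /eqP E]; have dm : (d %| m)%N by rewrite -E dvdn_mull.
by rewrite dm ltnS dvdn_leq.
Qed.

(** Group the quadruples by [i = a * x]; the remaining pair then factors [n - i]. *)
Lemma sigma_convolution r s :
  \sum_(1 <= i < n) (sigma r i)%:R * (sigma s (n - i))%:R =
  \sum_(t | quads t) t.1.2%:R ^+ r * t.2.2%:R ^+ s :> F.
Proof.
rewrite -(sum_ord_nat (fun i => (sigma r i)%:R * (sigma s (n - i))%:R)) //.
rewrite [RHS](partition_big (fun t => inord (t.1.1 * t.1.2) : 'I_n.+1) (fun i : 'I_n.+1 => (0 < i <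
    n)%N)) /=; last first.
  move=> [[a x] [b y]] /and5P[/= a0 x0 b0 y0 /eqP E].
  by rewrite inordK; nia.
apply: eq_bigr => i /andP[i0 i_n]; rewrite !sigma_facts; try lia.
rewrite big_distrlr /= pair_big /=; apply: eq_bigl => -[[a x] [b y]] /=.
rewrite /facts /quads /=; apply/idP/idP.
  move=> /andP[/and3P[a0 x0 /eqP E1] /and3P[b0 y0 /eqP E2]].
  rewrite E1 E2 inord_val eqxx andbT; apply/and5P; split=> //; apply/eqP; lia.
move=> /andP[/and5P[a0 x0 b0 y0 /eqP E] /eqP Ei].
have ax : (a * x < n.+1)%N by lia.
move: Ei => /(congr1 val) /=; rewrite inordK // => Ei.
by rewrite a0 x0 b0 y0 Ei eqxx /=; apply/eqP; lia.
Qed.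

End DivisorSums.

(** * Ramanujan's identities on Fourier coefficients *)

Section RamanujanCoefficients.
Variable F : numFieldType.
Implicit Types (D X Y : F) (m n d : nat).

Lemma sum_telescope (f g : F -> F) m : (forall X, g (X + 1) - g X = f X) -> g 1 = 0 ->
  (0 < m)%N -> \sum_(1 <= i < m) f i%:R = g m%:R.
Proof.
move=> fg g1; elim: m => // -[_ _|m IH _]; first by rewrite big_geq.
by rewrite big_nat_recr //= IH // -fg -[m.+2%:R]natr1; ring.
Qed.

Lemma sum_form (p : F -> F -> F) (g : F -> F -> F) d :
  (forall D X, g D (X + 1) - g D X = p X (D - X)) -> (forall D, g D 1 = 0) -> (0 < d)%N ->
  \sum_(1 <= i < d) p i%:R (d - i)%N%:R = g d%:R d%:R.
Proof.
move=> pg g1 d0; rewrite -(sum_telescope (pg d%:R)) //.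
by apply: eq_big_nat => i /andP[_ id]; rewrite natrB // ltnW.
Qed.

Section Convolutions.
Variable n : nat.
Hypothesis n0 : (0 < n)%N.
Local Notation U := ('I_n.+1 * 'I_n.+1)%type.

(** Faulhaber's polynomials: at a positive integer [m], [Pk m] is the sum of the [k]-th powers of
    [1, ..., m - 1]. *)
Let P1 (m : F) : F := m * (m - 1) / 2.
Let P2 (m : F) : F := (m - 1) * m * (2 * m - 1) / 6.
Let P3 (m : F) : F := m ^+ 2 * (m - 1) ^+ 2 / 4.
Let P4 (m : F) : F := (m - 1) * m * (2 * m - 1) * (3 * m ^+ 2 - 3 * m - 1) / 30.
Let P5 (m : F) : F := m ^+ 2 * (m - 1) ^+ 2 * (2 * m ^+ 2 - 2 * m - 1) / 12.
Let P6 (m : F) : F :=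
  (m - 1) * m * (2 * m - 1) * (3 * m ^+ 4 - 6 * m ^+ 3 + 3 * m + 1) / 42.

Let S r s : F := \sum_(1 <= i < n) (sigma r i)%:R * (sigma s (n - i))%:R.

Lemma sum_quads_sym r s : 
  \sum_(t : U * U | quads t) (t.1.2%:R ^+ r * t.2.2%:R ^+ s + t.1.2%:R ^+ s * t.2.2%:R ^+ r) = 2 * S r s.
Proof.
rewrite big_split /= -sigma_convolution // mulr2n mulrDl mul1r; congr (_ + _).
rewrite /S sigma_convolution //.
transitivity (\sum_(t : U * U | quads t && true) t.1.2%:R ^+ s * t.2.2%:R ^+ r : F).
  by apply: eq_bigl => t; rewrite andbT.
rewrite (@quads_swap F n (fun _ _ _ _ => true) (fun x y => x%:R ^+ s * y%:R ^+ r)).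
by apply: eq_big => [t|t _]; [rewrite andbT|rewrite mulrC].
Qed.

(** Both diagonals of [quads_identity] reduce to factorisations of [n]. The function [g] is a
    discrete antiderivative, so that [g D D] sums [p i (D - i)] over [1 <= i < D]. *)
Lemma convolution_identity (p G g : F -> F -> F) :
  (forall X Y, p X Y = p Y X) -> (forall X Y, G X Y = G Y X) ->
  (forall X Y, p X Y - p X (Y - X) = G X Y) ->
  (forall D X, g D (X + 1) - g D X = p X (D - X)) -> (forall D, g D 1 = 0) ->
  \sum_(t : U * U | quads t) G t.1.2%:R t.2.2%:R =
  \sum_(u : U | facts n u) ((u.1%:R - 1) * (G u.2%:R u.2%:R - p u.2%:R u.2%:R) + g u.2%:R u.2%:R).
Proof.
move=> ps Gs pG pg g1; rewrite (quads_identity n0 ps Gs pG) [RHS]big_split /=.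
rewrite (sum_diag_dilation n0 (fun x => G x%:R x%:R - p x%:R x%:R)); congr (_ + _).
rewrite (sum_diag_factor n0 (fun x y => p x%:R y%:R)).
by apply: eq_bigr => u /and3P[_ u0 _]; exact: sum_form.
Qed.

(* In the next three lemmas [p] is a symmetric form, chosen so that
   [p X Y - p X (Y - X)] is symmetric as well. *)
Lemma conv_sigma13 : 8 * S 1 3 = \sum_(u : U | facts n u)
  (- (u.1%:R - 1) * u.2%:R ^+ 4 + (7 / 10 * u.2%:R ^+ 5 - u.2%:R ^+ 4 + u.2%:R ^+ 3 / 3 - u.2%:R / 30)).
Proof.
have -> : 8 * S 1 3 = 4 * (2 * S 1 3) by ring.
rewrite -sum_quads_sym mulr_sumr.
(* Replacing [Y] by [Y - X] turns [X^2 + X Y + Y^2] into [X^2 - X Y + Y^2], so [G] is a difference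
   of squares. The third function is [p X (D - X)], expanded in powers of [D] and summed termwise
   over [X]. *)
have := @convolution_identity (fun X Y => (X ^+ 2 + X * Y + Y ^+ 2) ^+ 2)
  (fun X Y => 4 * (X ^+ 1 * Y ^+ 3 + X ^+ 3 * Y ^+ 1))
  (fun D X => D ^+ 4 * (X - 1) - 2 * D ^+ 3 * P1 X + 3 * D ^+ 2 * P2 X - 2 * D * P3 X + P4 X).
move=> -> => [|X Y|X Y|X Y|D X|D]; rewrite /P1 /P2 /P3 /P4; try by [ring|field].
by apply: eq_bigr => u _; field.
Qed.

Lemma conv_sigma33 : 4 * S 3 3 = \sum_(u : U | facts n u)
  (u.2%:R ^+ 7 / 30 - u.2%:R ^+ 3 / 30).
Proof.
have -> : 4 * S 3 3 = 2 * (2 * S 3 3) by ring.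
rewrite -sum_quads_sym mulr_sumr.
(* The other basic invariant: [X Y (X + Y)] becomes [X Y (Y - X)], and the squares differ by
   [4 X^3 Y^3]. *)
have := @convolution_identity (fun X Y => (X * Y * (X + Y)) ^+ 2)
  (fun X Y => 2 * (X ^+ 3 * Y ^+ 3 + X ^+ 3 * Y ^+ 3))
  (fun D X => D ^+ 2 * (D ^+ 2 * P2 X - 2 * D * P3 X + P4 X)).
move=> -> => [|X Y|X Y|X Y|D X|D]; rewrite /P1 /P2 /P3 /P4; try by [ring|field].
by apply: eq_bigr => u _; field.
Qed.

Lemma conv_sigma15 : 12 * S 1 5 = \sum_(u : U | facts n u)
  (- (u.1%:R - 1) * u.2%:R ^+ 6 + (10 / 21 * u.2%:R ^+ 7 - u.2%:R ^+ 6 + u.2%:R ^+ 5 / 2 + u.2%:R / 42)).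
Proof.
have -> : 12 * S 1 5 = 6 * (2 * S 1 5) by ring.
rewrite -sum_quads_sym mulr_sumr.
(* This [p] is [(X^2 + X Y + Y^2)^3 - 7/2 (X Y (X + Y))^2]; the coefficient [7/2] removes the term
   [X^3 Y^3], leaving only the odd terms of type [X Y^5]. *)
have := @convolution_identity
  (fun X Y => X ^+ 6 + 3 * X ^+ 5 * Y + 5 / 2 * (X ^+ 4 * Y ^+ 2 + X ^+ 2 * Y ^+ 4) + 3 * X * Y ^+
      5 + Y ^+ 6)
  (fun X Y => 6 * (X ^+ 1 * Y ^+ 5 + X ^+ 5 * Y ^+ 1))
  (fun D X => D ^+ 6 * (X - 1) - 3 * D ^+ 5 * P1 X + 5 / 2 * D ^+ 4 * P2 X + 5 / 2 * D ^+ 2 * P4 X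
     - 3 * D * P5 X + P6 X).
move=> -> => [|X Y|X Y|X Y|D X|D]; rewrite /P1 /P2 /P3 /P4 /P5 /P6; try by [ring|field].
by apply: eq_bigr => u _; field.
Qed.

End Convolutions.

Definition eis_coef (c : F) k m : F := if m == 0%N then 1 else c * (sigma k.-1 m)%:R.

Lemma eis_conv (c c' : F) k l n : (0 < n)%N ->
  \sum_(i < n.+1) eis_coef c k i * eis_coef c' l (n - i) =
  c * (sigma k.-1 n)%:R + c' * (sigma l.-1 n)%:R +
  c * c' * \sum_(1 <= i < n) (sigma k.-1 i)%:R * (sigma l.-1 (n - i))%:R.
Proof.
case: n => // n _; rewrite -(big_mkord xpredT (fun i => eis_coef c k i * eis_coef c' l (n.+1 - i))).
rewrite big_nat_recl // big_nat_recr //= subn0 subnn /eis_coef /= big_add1 /= mulr_sumr.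
rewrite [X in _ + (X + _)](eq_big_nat _ _ (F2 := fun i =>
  c * c' * ((sigma k.-1 i.+1)%:R * (sigma l.-1 (n.+1 - i.+1))%:R))); first by ring.
by move=> i /andP[_ i_n]; rewrite subSS subn_eq0 leqNgt i_n /=; ring.
Qed.

Lemma eis_coef_sigma (c : F) k n : (0 < n)%N -> eis_coef c k n =
  \sum_(u : 'I_n.+1 * 'I_n.+1 | facts n u) c * u.2%:R ^+ k.-1.
Proof.
move=> n0; rewrite /eis_coef eqn0Ngt n0 /= (@sigma_facts F n) ?n0 ?leqnn //.
by rewrite mulr_sumr.
Qed.

Lemma facts_mul n (u : 'I_n.+1 * 'I_n.+1) : facts n u -> n%:R = u.1%:R * u.2%:R :> F.
Proof. by move=> /and3P[_ _ /eqP E]; rewrite -natrM E. Qed.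

(** These are the coefficients of [E2 E4 = 3 E4' + E6], which is equivalent to [D E4 = -E6/3]. *)
Lemma ramanujan_E4_coef n :
  \sum_(i < n.+1) eis_coef (- 24) 2 i * eis_coef 240 4 (n - i) =
  3 * (n%:R * eis_coef 240 4 n) + eis_coef (- 504) 6 n.
Proof.
case: (posnP n) => [->|n0].
  by rewrite big_ord1 /eis_coef /= !mul0r; ring.
rewrite eis_conv //; set S := \sum_(1 <= i < n) _.
have -> : S = 8^-1 * (8 * S) by field.
rewrite conv_sigma13 // !eis_coef_sigma // !(@sigma_facts F n) ?n0 ?leqnn //.
(* All terms are now sums over factorisations; once [n] is written as [u.1 * u.2] the summands agree
   one by one. *)
rewrite !mulr_sumr -!big_split /=; by apply: eq_bigr => u /facts_mul ->; field.
Qed.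

(** These are the coefficients of [E2 E6 = 2 E6' + E4^2]; the square accounts for the convolution of
    [sigma 3] with itself. *)
Lemma ramanujan_E6_coef n :
  \sum_(i < n.+1) eis_coef (- 24) 2 i * eis_coef (- 504) 6 (n - i) =
  2 * (n%:R * eis_coef (- 504) 6 n) +
  \sum_(i < n.+1) eis_coef 240 4 i * eis_coef 240 4 (n - i).
Proof.
case: (posnP n) => [->|n0].
  by rewrite !big_ord1 /eis_coef /= !mul0r; ring.
rewrite !eis_conv //; set S := \sum_(1 <= i < n) _; set S' := \sum_(1 <= i < n) _.
have -> : S = 12^-1 * (12 * S) by field.
have -> : S' = 4^-1 * (4 * S') by field.
rewrite conv_sigma15 // conv_sigma33 // !eis_coef_sigma // !(@sigma_facts F n) ?n0 ?leqnn //.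
rewrite !mulr_sumr -!big_split /=; by apply: eq_bigr => u /facts_mul ->; field.
Qed.

End RamanujanCoefficients.

(** * Complex power series *)

Section ComplexSeries.
Variable R : realType.
Local Notation C := R[i].
Implicit Types (u v a b : nat -> C) (l m q h : C) (x t s A B e : R) (n k N : nat).

Definition sums_to u l := forall e : R, 0 < e -> exists N, forall n, (N <= n)%N ->
  normc (\sum_(i < n) u i - l) <= e.

Definition geo_bounded u := exists A t, 0 <= t < 1 /\ forall n, normc (u n) <= A * t ^+ n.

Lemma geo_small A t e : 0 <= t < 1 -> 0 < e ->
  exists N, forall n, (N <= n)%N -> A * t ^+ n <= e.
Proof.
move=> /andP[t0 t1] e0; have nt : `|t| < 1 by rewrite ger0_norm.
have /cvgrPdist_le/(_ _ e0) [N _ HN] := @cvg_geometric R A t nt.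
by exists N => n /HN /=; rewrite sub0r normrN => H; exact: le_trans (ler_norm _) H.
Qed.

Lemma sums_to_cvg u l : sums_to u l -> (series (u : nat -> C^o) @ \oo --> (l : C^o))%classic.
Proof.
move=> H; apply/cvgrPdist_le => e; case: e => e e2; rewrite ltcE /= => /andP[/eqP -> e0].
have [N HN] := H e e0; exists N => // n Nn /=.
by rewrite -normrN opprB /series /= big_mkord norm_normc lecR HN.
Qed.

Lemma sums_to_lim u l : sums_to u l -> limn (series (u : nat -> C^o)) = l.
Proof. by move=> /sums_to_cvg; apply: cvg_lim; exact: norm_hausdorff. Qed.

Lemma sums_to_uniq u l m : sums_to u l -> sums_to u m -> l = m.
Proof. by move=> /sums_to_lim <- /sums_to_lim <-. Qed.

Lemma geo_bounded_sums u : geo_bounded u -> exists l, sums_to u l.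
Proof.
move=> [A [t [/andP[t0 t1] uA]]].
have nt : `|t| < 1 by rewrite ger0_norm.
have real_cv (w : nat -> R) : (forall n, `|w n| <= A * t ^+ n) -> exists l : R, forall e : R, 0 < e ->
    exists N, forall n, (N <= n)%N -> `|\sum_(i < n) w i - l| <= e.
  move=> wA; have : cvgn (series w).
    apply: normed_cvg; apply: (@series_le_cvg R _ (geometric A t)) => //.
    - by move=> n /=.
    - by move=> n; exact: le_trans (normr_ge0 _) (wA n).
    - exact: is_cvg_geometric_series.
  move=> /cvg_ex [l /cvgrPdist_le Hl]; exists l => e e0.
  have [N _ HN] := Hl e e0; exists N => n /HN /=.
  by rewrite -normrN opprB /series /= big_mkord.
have [l1 H1] := real_cv (fun n => complex.Re (u n)) (fun n => le_trans (Re_le_normc _) (uA n)).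
have [l2 H2] := real_cv (fun n => complex.Im (u n)) (fun n => le_trans (Im_le_normc _) (uA n)).
exists (l1 +i* l2) => e e0.
have e2 : 0 < e / 2 by lra.
have [N1 K1] := H1 _ e2; have [N2 K2] := H2 _ e2.
exists (maxn N1 N2) => n; rewrite geq_max => /andP[/K1 k1 /K2 k2].
apply: (le_trans (normc_le_ReIm _)).
have -> : complex.Re (\sum_(i < n) u i - (l1 +i* l2)) = \sum_(i < n) complex.Re (u i) - l1.
  by rewrite ReD ReN (big_morph _ (@ReD R) (erefl : complex.Re 0 = 0)).
have -> : complex.Im (\sum_(i < n) u i - (l1 +i* l2)) = \sum_(i < n) complex.Im (u i) - l2.
  by rewrite ImD ImN (big_morph _ (@ImD R) (erefl : complex.Im 0 = 0)).
have -> : e = e / 2 + e / 2 by field.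
exact: lerD.
Qed.

Lemma sums_toD u v l m : sums_to u l -> sums_to v m -> sums_to (fun n => u n + v n) (l + m).
Proof.
move=> H1 H2 e e0; have e2 : 0 < e / 2 by lra.
have [N1 K1] := H1 _ e2; have [N2 K2] := H2 _ e2.
exists (maxn N1 N2) => n; rewrite geq_max => /andP[/K1 k1 /K2 k2].
have -> : \sum_(i < n) (u i + v i) - (l + m) = (\sum_(i < n) u i - l) + (\sum_(i < n) v i - m).
  by rewrite big_split /=; ring.
apply: (le_trans (le_normcD _ _)); have -> : e = e / 2 + e / 2 by field.
exact: lerD.
Qed.

Lemma sums_toZ (c : C) u l : sums_to u l -> sums_to (fun n => c * u n) (c * l).
Proof.
move=> H e e0; have c1 : 0 < normc c + 1 by have := normc_ge0 c; lra.
have [N K] := H (e / (normc c + 1)) ltac:(by rewrite divr_gt0).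
exists N => n /K h; rewrite -mulr_sumr -mulrBr normcM.
apply: (@le_trans _ _ ((normc c + 1) * (e / (normc c + 1)))).
  by rewrite ler_pM ?normc_ge0 // lerDl.
by rewrite mulrC divfK ?lt0r_neq0.
Qed.

Lemma sums_to_recl u l : sums_to (fun n => u n.+1) l -> sums_to u (u 0 + l).
Proof.
move=> H e e0; have [N K] := H e e0; exists N.+1 => -[//|n]; rewrite ltnS => /K h.
by rewrite big_ord_recl opprD addrACA subrr add0r.
Qed.

Lemma eq_sums_to u v l : u =1 v -> sums_to u l -> sums_to v l.
Proof. by move=> /funext ->. Qed.

Lemma sums_to_bound u l A t : 0 <= t < 1 -> 0 <= A -> (forall n, normc (u n) <= A * t ^+ n) ->
  sums_to u l -> normc l <= A / (1 - t).
Proof.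
move=> /andP[t0 t1] A0 uA ul; apply/ler_addgt0Pr => e e0.
have [N K] := ul e e0; have := K N (leqnn N) => h.
have -> : l = \sum_(i < N) u i - (\sum_(i < N) u i - l) by ring.
apply: (le_trans (le_normc_sub _ _)); apply: lerD => //.
apply: (le_trans (normc_sum _ _ _)).
apply: (@le_trans _ _ (\sum_(i < N) A * t ^+ i)); first by apply: ler_sum => i _.
rewrite -mulr_sumr ler_wpM2l //.
have t1' : 0 < 1 - t by lra.
rewrite -[(1 - t)^-1]mul1r ler_pdivlMr // mulrC.
have -> : (1 - t) * \sum_(i < N) t ^+ i = 1 - t ^+ N.
  by elim: N {K h} => [|N IH]; rewrite ?big_ord0 ?big_ord_recr /= ?mulrDr ?IH ?exprS ?expr0; ring.
by rewrite gerBl exprn_ge0.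
Qed.

Lemma sum_triangle (f : nat -> nat -> C) N :
  \sum_(n < N) \sum_(i < n.+1) f i (n - i)%N = \sum_(i < N) \sum_(j < N - i) f i j.
Proof.
elim: N => [|N IH]; first by rewrite !big_ord0.
rewrite big_ord_recr /= IH [RHS](eq_bigr (fun i : 'I_N.+1 => \sum_(j < N - i) f i j + f i (N - i)%N)).
  by rewrite [RHS]big_split /= [in RHS]big_ord_recr /= subnn big_ord0 addr0.
by move=> i _; rewrite subSn ?big_ord_recr // -ltnS.
Qed.

(** Each factor [n.+1] is absorbed by enlarging the ratio from [s] to [r]: with [x = s / r < 1],
    [n.+1 * x^n] is at most the sum of [x^i] over [i <= n], hence at most [1 / (1 - x)]. *)
Lemma poly_geo k t : 0 <= t < 1 -> exists A s, 0 <= s < 1 /\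
  forall n, n.+1%:R ^+ k * t ^+ n <= A * s ^+ n.
Proof.
move=> tt; elim: k => [|k [A [s [/andP[s0 s1] H]]]].
  by exists 1, t; split => // n; rewrite expr0.
pose r := (1 + s) / 2; have r01 : 0 < r < 1 by rewrite /r; lra.
have sr : s < r by rewrite /r; lra.
have [r0 r1] := andP r01; pose x := s / r.
have x0 : 0 <= x by rewrite divr_ge0 // ltW.
have x1 : x < 1 by rewrite /x ltr_pdivrMr // mul1r.
have A0 : 0 <= A by have := H 0; rewrite !expr0 expr1n !mulr1; lra.
have xn n : n.+1%:R * x ^+ n <= (1 - x)^-1.
  rewrite -[(1 - x)^-1]mul1r ler_pdivlMr ?subr_gt0 //.
  have : n.+1%:R * x ^+ n <= \sum_(i < n.+1) x ^+ i.
    rewrite mulr_natl -[X in _ *+ X]card_ord -sumr_const; apply: ler_sum => i _.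
    by rewrite ler_wiXn2l // ?ltW // -ltnS.
  have : (1 - x) * \sum_(i < n.+1) x ^+ i = 1 - x ^+ n.+1.
    elim: n.+1 => [|N IH]; rewrite ?big_ord0 ?big_ord_recr /= ?mulrDr ?IH ?exprS ?expr0; ring.
  have := exprn_ge0 n.+1 x0; set S := \sum_(i < n.+1) _; set y := _ * x ^+ n; nra.
exists (A * (1 - x)^-1), r; split; first by rewrite (ltW r0).
move=> n; rewrite exprS -mulrA.
apply: (@le_trans _ _ (n.+1%:R * (A * s ^+ n))); first by rewrite ler_wpM2l.
have -> : s = x * r by rewrite /x divfK // lt0r_neq0.
rewrite exprMn.
have -> : n.+1%:R * (A * (x ^+ n * r ^+ n)) = A * (n.+1%:R * x ^+ n) * r ^+ n by ring.
rewrite ler_wpM2r ?exprn_ge0 ?(ltW r0) //.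
by rewrite ler_wpM2l.
Qed.

Lemma sums_to_prod u v l m : geo_bounded u -> geo_bounded v -> sums_to u l -> sums_to v m ->
  sums_to (fun n => \sum_(i < n.+1) u i * v (n - i)%N) (l * m).
Proof.
move=> [A [t [/andP[t0 t1] uA]]] [B [s [/andP[s0 s1] vB]]] ul vm e e0.
have A0 : 0 <= A by apply: le_trans (normc_ge0 (u 0)) _; have := uA 0; rewrite expr0 mulr1.
have B0 : 0 <= B by apply: le_trans (normc_ge0 (v 0)) _; have := vB 0; rewrite expr0 mulr1.
pose r := Num.max t s; have r0 : 0 <= r by rewrite le_max t0.
have r1 : r < 1 by rewrite gt_max t1.
have uA' n : normc (u n) <= A * r ^+ n.
  apply: (le_trans (uA n)); rewrite ler_wpM2l // lerXn2r ?nnegrE //.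
  by rewrite le_max lexx.
have vB' n : normc (v n) <= B * r ^+ n.
  apply: (le_trans (vB n)); rewrite ler_wpM2l // lerXn2r ?nnegrE //.
  by rewrite le_max lexx orbT.
have [D [q [qq HD]]] := @poly_geo 2 r ltac:(by rewrite r0).
(* The product of partial sums exceeds the triangle by at most [N ^+ 2] terms with [i + j >= N],
   each bounded by [A * B * r ^+ N]. *)
have tri N : normc ((\sum_(i < N) u i) * (\sum_(i < N) v i) -
    \sum_(n < N) \sum_(i < n.+1) u i * v (n - i)%N) <= A * B * D * q ^+ N.
  rewrite (sum_triangle (fun i j => u i * v j)) mulr_suml -sumrB.
  apply: (le_trans (normc_sum _ _ _)).
  apply: (@le_trans _ _ (\sum_(i < N) A * B * N%:R * r ^+ N)); last first.
    rewrite sumr_const card_ord -[_ * r ^+ N *+ N]mulr_natr.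
    apply: (@le_trans _ _ (A * B * (N.+1%:R ^+ 2 * r ^+ N))).
      have -> : A * B * N%:R * r ^+ N * N%:R = A * B * (N%:R ^+ 2 * r ^+ N) by ring.
      rewrite ler_wpM2l ?mulr_ge0 // ler_wpM2r ?exprn_ge0 //.
      by rewrite lerXn2r ?nnegrE ?ler0n // ler_nat.
    by rewrite -[A * B * D * _]mulrA ler_wpM2l ?mulr_ge0.
  apply: ler_sum => i _; rewrite -mulr_sumr -mulrBr normcM.
  have -> : \sum_(j < N) v j - \sum_(j < N - i) v j = \sum_(N - i <= j < N) v j.
    rewrite -(big_mkord xpredT v) -(big_mkord xpredT v) (@big_cat_nat _ _ _ (N - i)) ?leq_subr //=.
    by rewrite addrAC subrr add0r.
  have iN := ltn_ord i.
  apply: (@le_trans _ _ ((A * r ^+ i) * (i%:R * (B * r ^+ (N - i))))); last first.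
    have -> : A * r ^+ i * (i%:R * (B * r ^+ (N - i))) = A * B * i%:R * (r ^+ i * r ^+ (N - i)) by ring.
    rewrite -exprD subnKC 1?ltnW // ler_wpM2r ?exprn_ge0 // ler_wpM2l ?mulr_ge0 //.
    by rewrite ler_nat ltnW.
  apply: ler_pM; rewrite ?normc_ge0 //.
  apply: (le_trans (normc_sum _ _ _)).
  apply: (@le_trans _ _ (\sum_(N - i <= j < N) B * r ^+ (N - i))).
    rewrite big_nat_cond [leRHS]big_nat_cond; apply: ler_sum => j /andP[/andP[j1 _] _].
    by apply: (le_trans (vB' j)); rewrite ler_wpM2l // ler_wiXn2l // ltW.
  by rewrite sumr_const_nat subKn 1?ltnW // [leRHS]mulr_natl.
have e2 : 0 < e / 2 by lra.
have [N1 H1] := geo_small (A * B * D) qq e2.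
have lm : 0 < normc l + 1 + normc m by have := normc_ge0 l; have := normc_ge0 m; lra.
(* [d <= 1] bounds the partial sum [P] by [normc l + 1], whence the denominator. *)
pose d := Num.min 1 (e / 2 / (normc l + 1 + normc m)).
have d0 : 0 < d by rewrite lt_min ltr01 divr_gt0.
have [d1 d2] : d <= 1 /\ d * (normc l + 1 + normc m) <= e / 2.
  split; first by rewrite ge_min lexx.
  by rewrite -ler_pdivlMr // ge_min lexx orbT.
have [N2 H2] := ul d d0; have [N3 H3] := vm d d0.
exists (maxn N1 (maxn N2 N3)) => n; rewrite !geq_max => /and3P[/H1{}H1 /H2{}H2 /H3{}H3].
have := tri n; move: H2 H3; set P := \sum_(_ < n) u _; set Q := \sum_(_ < n) v _.
set T := \sum_(_ < n) _ => H2 H3 H4.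
have -> : T - l * m = - (P * Q - T) + (P * (Q - m) + (P - l) * m) by ring.
have -> : e = e / 2 + e / 2 by field.
apply: (le_trans (le_normcD _ _)); rewrite normcN; apply: lerD; first exact: le_trans H1.
apply: (le_trans (le_normcD _ _)); rewrite !normcM.
have Pl : normc P <= normc l + d.
  have -> : P = (P - l) + l by ring.
  by apply: (le_trans (le_normcD _ _)); lra.
have := normc_ge0 P; have := normc_ge0 m; have := normc_ge0 (Q - m); have := normc_ge0 (P - l).
nra.
Qed.

End ComplexSeries.

(** * Power series with coefficients of polynomial growth *)

Section PowerSeries.
Variable R : realType.
Local Notation C := R[i].
Implicit Types (a b : nat -> C) (z w q h : C).

Definition poly_growth a := exists (A : R) k, forall n, normc (a n) <= A * n.+1%:R ^+ k.

Definition psum a q : C := limn (series (fun n => a n * q ^+ n : C^o)).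

Lemma poly_growth_geo a (r : R) : poly_growth a -> 0 <= r < 1 ->
  exists A s, [/\ 0 <= A, 0 <= s < 1 & forall n, normc (a n) * r ^+ n <= A * s ^+ n].
Proof.
move=> [A [k aA]] r01; have [D [s [ss H]]] := poly_geo k r01.
have A0 : 0 <= A.
  by apply: le_trans (normc_ge0 (a 0)) _; have := aA 0; rewrite expr1n mulr1.
have D0 : 0 <= D.
  by apply: le_trans (ler01) _; have := H 0; rewrite !expr0 expr1n !mulr1.
exists (A * D), s; split=> // [|n]; first exact: mulr_ge0.
have [r0 _] := andP r01.
apply: (@le_trans _ _ (A * n.+1%:R ^+ k * r ^+ n)); first by rewrite ler_wpM2r ?exprn_ge0.
by rewrite -!mulrA ler_wpM2l.
Qed.

Lemma geo_bounded_psum a q : poly_growth a -> normc q < 1 ->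
  geo_bounded (fun n => a n * q ^+ n).
Proof.
move=> ag q1; have [A [s [A0 ss H]]] := @poly_growth_geo a (normc q) ag ltac:(by rewrite normc_ge0).
by exists A, s; split=> // n; rewrite normcM normcX.
Qed.

Lemma sums_to_psum a q : poly_growth a -> normc q < 1 ->
  sums_to (fun n => a n * q ^+ n) (psum a q).
Proof.
move=> ag q1; have [l Hl] := geo_bounded_sums (geo_bounded_psum ag q1).
by rewrite /psum (sums_to_lim Hl).
Qed.

Lemma sums_to_conv a b q : poly_growth a -> poly_growth b -> normc q < 1 ->
  sums_to (fun n => (\sum_(i < n.+1) a i * b (n - i)%N) * q ^+ n) (psum a q * psum b q).
Proof.
move=> ag bg q1.
have := sums_to_prod (geo_bounded_psum ag q1) (geo_bounded_psum bg q1)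
  (sums_to_psum ag q1) (sums_to_psum bg q1).
apply: eq_sums_to => n; rewrite mulr_suml; apply: eq_bigr => i _.
by rewrite mulrACA -exprD subnKC // -ltnS.
Qed.

Lemma poly_growth_natmul a : poly_growth a -> poly_growth (fun n => n%:R * a n).
Proof.
move=> [A [k H]]; exists A, k.+1 => n; rewrite normcM normc_nat exprS mulrCA.
by rewrite ler_pM ?normc_ge0 // ler_nat.
Qed.

(** The factor [r ^+ 2] on the left avoids the exponent [n - 2]. Passing to [n.+1] multiplies the
    remainder by [q + h] and adds [n h^2 q^(n-1)], and [n^2 + n <= (n+1)^2]. *)
Lemma pow_diff_bound q h (r : R) n : 0 < r -> normc q <= r -> normc (q + h) <= r ->
  r ^+ 2 * normc ((q + h) ^+ n - q ^+ n - n%:R * q ^+ n.-1 * h) <= n%:R ^+ 2 * normc h ^+ 2 * r ^+ n.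
Proof.
move=> r0 qr qhr; elim: n => [|n IH].
  by rewrite !expr0 subrr !mul0r subr0 normc0 expr0n /= mulr0 !mul0r.
have -> : (q + h) ^+ n.+1 - q ^+ n.+1 - n.+1%:R * q ^+ n.+1.-1 * h =
   (q + h) * ((q + h) ^+ n - q ^+ n - n%:R * q ^+ n.-1 * h) + n%:R * h ^+ 2 * q ^+ n.-1.
  case: n {IH} => [|n] /=; rewrite !exprS -?natr1; ring.
apply: (le_trans (ler_wpM2l (sqr_ge0 r) (le_normcD _ _))).
rewrite mulrDr !normcM mulrCA normc_nat.
have h0 := normc_ge0 h; set N := normc h in IH h0 *.
set T := normc (_ - _ - _) in IH *; have T0 : 0 <= T by exact: normc_ge0.
apply: (@le_trans _ _ (r * (n%:R ^+ 2 * N ^+ 2 * r ^+ n) + n%:R * N ^+ 2 * r ^+ n.+1)).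
  apply: lerD.
    by apply: ler_pM => //; [exact: normc_ge0|rewrite mulr_ge0 ?sqr_ge0].
  rewrite normcX; case: n {IH T T0} => [|n]; first by rewrite !mul0r mulr0.
  rewrite /= [r ^+ n.+2]exprS [r ^+ n.+1]exprS.
  have : normc q ^+ n <= r ^+ n by rewrite lerXn2r ?nnegrE ?normc_ge0 // ltW.
  move=> H; rewrite [leRHS](_ : _ = r ^+ 2 * (n.+1%:R * (N * N) * r ^+ n)); last by ring.
  by rewrite ler_wpM2l ?sqr_ge0 // ler_wpM2l // mulr_ge0 // mulr_ge0.
have XY : 0 <= (n%:R + 1) * (N ^+ 2 * (r * r ^+ n)).
  by rewrite !mulr_ge0 ?exprn_ge0 ?addr_ge0 // ltW.
rewrite -natr1 [r ^+ n.+1]exprS -subr_ge0; apply: le_trans XY _.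
by rewrite le_eqVlt; apply/orP; left; apply/eqP; ring.
Qed.

(** The derivative is described through [q * l], that is, by the operator [q d/dq]: it multiplies
    the coefficients by [n] without shifting indices, and it is what [dq] becomes in the variable
    [q]. *)
Lemma psum_cdiff a q : poly_growth a -> normc q < 1 ->
  exists l, cdiff (psum a) q l /\ q * l = psum (fun n => n%:R * a n) q.
Proof.
move=> ag q1; pose r : R := (1 + normc q) / 2.
have [qr r0 r1] : [/\ normc q < r, 0 < r & r < 1].
  by have := normc_ge0 q; rewrite /r; split; lra.
have ag1 := poly_growth_natmul ag; have ag2 := poly_growth_natmul ag1.
have [A [s [A0 ss HA]]] := @poly_growth_geo _ r ag1 ltac:(by rewrite ltW).
have [B [t [B0 tt HB]]] := @poly_growth_geo _ r ag2 ltac:(by rewrite ltW).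
have gd : geo_bounded (fun n => n%:R * a n * q ^+ n.-1).
  exists (A / r), s; split=> // n; rewrite normcM normcX mulrAC ler_pdivlMr //.
  apply: le_trans (HA n); rewrite -mulrA ler_wpM2l ?normc_ge0 //.
  case: n => [|n] /=; first by rewrite !expr0 mul1r ltW.
  by rewrite mulrC exprS ler_wpM2l ?(ltW r0) // lerXn2r ?nnegrE ?normc_ge0 ?(ltW r0) ?(ltW qr).
have [l Hl] := geo_bounded_sums gd.
exists l; split; last first.
  apply: sums_to_uniq (sums_toZ q Hl) _; apply: eq_sums_to (sums_to_psum ag1 q1) => -[|n] /=.
    by rewrite !mul0r mulr0.
  by rewrite exprS; ring.
(* [K * normc h ^+ 2] bounds the sum of the remainders of all terms, because
   [n^2 * normc (a n) * r ^+ n] is dominated by [B * t ^+ n]. *)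
move=> e e0; pose K := B / r ^+ 2 / (1 - t).
have [t0 t1] := andP tt.
have K0 : 0 <= K by rewrite /K !mulr_ge0 ?invr_ge0 ?sqr_ge0 //; lra.
have d0 : 0 < Num.min (r - normc q) (e / (K + 1)).
  by rewrite lt_min subr_gt0 qr divr_gt0 //; lra.
exists (Num.min (r - normc q) (e / (K + 1))) => // h; rewrite lt_min => /andP[h1 h2].
have qh : normc (q + h) <= r by apply: (le_trans (le_normcD _ _)); lra.
have qh1 : normc (q + h) < 1 by exact: le_lt_trans r1.
have S : sums_to (fun n => a n * ((q + h) ^+ n - q ^+ n - n%:R * q ^+ n.-1 * h))
    (psum a (q + h) - psum a q - l * h).
  have := sums_toD (sums_toD (sums_to_psum ag qh1) (sums_toZ (-1) (sums_to_psum ag q1))) (sums_toZ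
      (- h) Hl).
  have -> : psum a (q + h) + -1 * psum a q + - h * l = psum a (q + h) - psum a q - l * h by ring.
  by apply: eq_sums_to => n; ring.
have C0 : 0 <= B / r ^+ 2 * normc h ^+ 2.
  by apply: mulr_ge0; rewrite ?sqr_ge0 // divr_ge0 ?sqr_ge0.
have bnd n : normc (a n * ((q + h) ^+ n - q ^+ n - n%:R * q ^+ n.-1 * h)) <=
    B / r ^+ 2 * normc h ^+ 2 * t ^+ n.
  rewrite normcM.
  have E := pow_diff_bound n r0 (ltW qr) qh.
  rewrite -(ler_pM2l (x := r ^+ 2)) ?exprn_gt0 // mulrCA.
  apply: (le_trans (ler_wpM2l (normc_ge0 _) E)).
  have -> : r ^+ 2 * (B / r ^+ 2 * normc h ^+ 2 * t ^+ n) = normc h ^+ 2 * (B * t ^+ n).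
    by field; exact: lt0r_neq0.
  have -> : normc (a n) * (n%:R ^+ 2 * normc h ^+ 2 * r ^+ n) =
     normc h ^+ 2 * (n%:R * (n%:R * normc (a n)) * r ^+ n) by ring.
  rewrite ler_wpM2l ?sqr_ge0 //; apply: le_trans (HB n).
  by rewrite !normcM !normc_nat.
apply: (le_trans (sums_to_bound tt C0 bnd S)).
have -> : B / r ^+ 2 * normc h ^+ 2 / (1 - t) = K * normc h * normc h by rewrite /K; ring.
rewrite ler_wpM2r ?normc_ge0 //.
by move: h2; rewrite ltr_pdivlMr; have := normc_ge0 h; nra.
Qed.

End PowerSeries.

(** * The chain rule and the derivative of [qexp] *)

Section Eisenstein.
Variable R : realType.
Local Notation C := R[i].
Implicit Types (f g : C -> C) (z w q h : C).

Lemma cdiff_comp f g z l m : cdiff g z m -> cdiff f (g z) l -> cdiff (fun w => f (g w)) z (l * m).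
Proof.
move=> gz fz e e0; have M0 : 0 < normc m + 1 by have := normc_ge0 m; lra.
have L0 : 0 < normc l + 1 by have := normc_ge0 l; lra.
have e1 : 0 < e / 2 / (normc m + 1) by rewrite !divr_gt0.
have [d d0 fd] := fz _ e1.
have [d1 d10 gd1] := gz 1 ltr01.
have [d2 d20 gd2] := gz (e / 2 / (normc l + 1)) ltac:(by rewrite !divr_gt0).
exists (Num.min (d / (normc m + 1)) (Num.min d1 d2)).
  by rewrite !lt_min d10 d20 divr_gt0.
move=> h; rewrite !lt_min => /and3P[hd /gd1 h1 /gd2 h2].
pose k := g (z + h) - g z.
have gk : g (z + h) = g z + k by rewrite /k; ring.
have kh : normc k <= (normc m + 1) * normc h.
  have -> : k = (g (z + h) - g z - m * h) + m * h by rewrite /k; ring.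
  by apply: (le_trans (le_normcD _ _)); rewrite normcM; lra.
have kd : normc k < d.
  by apply: (le_lt_trans kh); move: hd; rewrite ltr_pdivlMr // mulrC.
have -> : f (g (z + h)) - f (g z) - l * m * h =
    (f (g z + k) - f (g z) - l * k) + l * (g (z + h) - g z - m * h).
  by rewrite -gk /k; ring.
apply: (le_trans (le_normcD _ _)); have -> : e * normc h = e / 2 * normc h + e / 2 * normc h by field.
apply: lerD.
  apply: (le_trans (fd _ kd)); apply: (@le_trans _ _ (e / 2 / (normc m + 1) * ((normc m + 1) *
      normc h))).
    by rewrite ler_wpM2l // ltW.
  by rewrite mulrA divfK ?lt0r_neq0.
rewrite normcM; apply: (@le_trans _ _ ((normc l + 1) * (e / 2 / (normc l + 1) * normc h))).
  by apply: ler_pM; rewrite ?normc_ge0 // lerDl.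
by rewrite mulrA mulrCA divff ?mulr1 ?lt0r_neq0.
Qed.

Lemma is_derive_eps (f : R -> R) (df : R) : is_derive (0 : R) 1 f df ->
  forall e : R, 0 < e -> exists2 d : R, 0 < d &
    forall x : R, `|x| < d -> `|f x - f 0 - df * x| <= e * `|x|.
Proof.
move=> [H1 H2] e e0; have : ((fun h : R => h^-1 *: ((f \o shift 0) (h *: 1) - f 0)) @ 0^' -->
    df)%classic.
  by rewrite -H2 /derive; exact: H1.
move=> /cvgrPdist_le/(_ _ e0) [d /= d0 H]; exists d => // x xd.
have [->|x0] := eqVneq x 0; first by rewrite subrr mulr0 subr0 normr0 mulr0.
have := H x; rewrite /= sub0r normrN => /(_ xd x0).
rewrite [_ *: 1]mulr1 addr0 => K.
have -> : f x - f 0 - df * x = - (df - x^-1 * (f x - f 0)) * x by field.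
by rewrite normrM normrN ler_wpM2r.
Qed.

Lemma qexpD z w : qexp (z + w) = qexp z * qexp w.
Proof.
case: z w => [x y] [x' y']; rewrite /qexp /=.
have -> : 2 * pi * (y + y') = 2 * pi * y + 2 * pi * y' :> R by ring.
have -> : 2 * pi * (x + x') = 2 * pi * x + 2 * pi * x' :> R by ring.
rewrite opprD expRD cosD sinD; congr Complex; ring.
Qed.

Lemma normc_qexp z : normc (qexp z) = expR (- (2 * pi * complex.Im z)).
Proof.
rewrite /qexp normcM normc_real ger0_norm ?expR_ge0 // /normc /=.
by rewrite cos2Dsin2 sqrtr1 mulr1.
Qed.

Lemma normc_qexp_lt1 z : uhp z -> normc (qexp z) < 1.
Proof.
move=> z0; rewrite normc_qexp -expR0 ltr_expR oppr_lt0 !mulr_gt0 //.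
exact: pi_gt0.
Qed.

(** The addition formula reduces the claim to the origin, where the real derivatives of exp, cos and
    sin are combined. *)
Lemma qexp_cdiff z : cdiff (@qexp R) z (2 * (pi : R)%:C * 'i * qexp z).
Proof.
pose c : C := 2 * (pi : R)%:C * 'i.
have pi0 : 0 < pi :> R := pi_gt0 R.
suff H0 : cdiff (@qexp R) 0 c.
  have E : (fun w => qexp w) =1 (fun w => qexp z * qexp (w - z) : C).
    by move=> w; rewrite -qexpD addrC subrK.
  have := @cdiff_comp (@qexp R) (fun w => w - z) z c (1 - 0).
  move=> H; have {}H := H (cdiffB (cdiff_id z) (cdiff_cst z z)).
  rewrite subrr subr0 mulr1 in H; have := cdiffZ (qexp z) (H H0).
  by rewrite mulrC -(funext E).
(* The errors below add up to [6 * eta * S] with [S = 2 * pi * normc h]; the constant 10 leaves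
   room. *)
move=> e e0; pose eta := Num.min 1 (e / (10 * (2 * pi))).
have eta0 : 0 < eta by rewrite lt_min ltr01 divr_gt0 // !mulr_gt0.
have [eta1 etae] : eta <= 1 /\ eta * (10 * (2 * pi)) <= e.
  split; first by rewrite ge_min lexx.
  by rewrite -ler_pdivlMr ?mulr_gt0 // ge_min lexx orbT.
have [d1 d10 H1] := is_derive_eps (is_derive_expR 0) eta0.
have [d2 d20 H2] := is_derive_eps (is_derive_cos 0) eta0.
have [d3 d30 H3] := is_derive_eps (is_derive_sin 0) eta0.
pose d := Num.min (eta / 2) (Num.min d1 (Num.min d2 d3)).
have d0 : 0 < d by rewrite !lt_min d10 d20 d30 andbT divr_gt0.
exists (d / (2 * pi)); first by rewrite divr_gt0 // mulr_gt0.
case=> x y hd; pose X := 2 * pi * x; pose Y := 2 * pi * y.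
have pp : 0 < 2 * pi :> R by rewrite mulr_gt0.
have Nh : 2 * pi * normc (x +i* y) < d by rewrite mulrC -ltr_pdivlMr.
have NX : `|X| <= 2 * pi * normc (x +i* y).
  by rewrite normrM (gtr0_norm pp) ler_wpM2l ?(ltW pp) //; exact: (Re_le_normc (x +i* y)).
have NY : `|- Y| <= 2 * pi * normc (x +i* y).
  by rewrite normrN normrM (gtr0_norm pp) ler_wpM2l ?(ltW pp) //; exact: (Im_le_normc (x +i* y)).
have /and4P[dX1 dX2 dX3 dX4] : [&& `|X| < eta / 2, `|X| < d1, `|X| < d2 & `|X| < d3].
  by have := le_lt_trans NX Nh; rewrite !lt_min.
have /and4P[dY1 dY2 dY3 dY4] : [&& `|- Y| < eta / 2, `|- Y| < d1, `|- Y| < d2 & `|- Y| < d3].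
  by have := le_lt_trans NY Nh; rewrite !lt_min.
have := H1 _ dY2; have := H2 _ dX3; have := H3 _ dX4.
rewrite expR0 cos0 sin0 subr0 oppr0 mul0r subr0 !mul1r => K3 K2 K1.
set E := expR (- Y) in K1 *; set T : C := cos X +i* sin X.
have hE : qexp (x +i* y) = E%:C * T by [].
have q0 : qexp (0 : C) = 1.
  by rewrite /qexp /= !mulr0 oppr0 expR0 cos0 sin0 mul1r.
rewrite add0r q0 hE.
(* The first-order errors of exp and of [cos + i sin], followed by a cross term of second order. *)
have -> : E%:C * T - 1 - c * (x +i* y) =
   (E - 1 - - Y)%:C + E%:C * ((cos X - 1)%:C + 'i * (sin X - X)%:C) + (E - 1)%:C * ('i * X%:C).
  rewrite /c /T /X /Y; apply/eqP; rewrite eq_complex /=.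
  by apply/andP; split; apply/eqP; ring.
have ni : normc ('i : C) = 1 by rewrite /normc /= expr0n add0r expr1n sqrtr1.
set S := 2 * pi * normc (x +i* y) in NX NY Nh.
have ES : `|E - 1| <= 2 * `|- Y|.
  have -> : E - 1 = (E - 1 - - Y) + - Y by ring.
  by apply: (le_trans (ler_normD _ _)); have := normr_ge0 (- Y); nra.
have E2 : `|E| <= 2.
  have -> : E = (E - 1) + 1 by ring.
  by apply: (le_trans (ler_normD _ _)); rewrite normr1; lra.
apply: (le_trans (le_normcD _ _)); apply: (le_trans (lerD (le_normcD _ _) (lexx _))).
rewrite !normcM !normc_real ni mul1r.
have t1 : `|E - 1 - - Y| <= eta * S by apply: (le_trans K1); rewrite ler_wpM2l // ltW.
have t2 : normc ((cos X - 1)%:C + 'i * (sin X - X)%:C) <= 2 * eta * S.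
  apply: (le_trans (le_normcD _ _)); rewrite normcM !normc_real ni mul1r.
  by apply: (le_trans (lerD K2 K3)); nra.
have t3 : `|E - 1| * `|X| <= eta * S.
  by apply: ler_pM => //; lra.
have S0 : 0 <= S by apply: le_trans NX.
have t4 : `|E| * normc ((cos X - 1)%:C + 'i * (sin X - X)%:C) <= 2 * (2 * eta * S).
  by apply: ler_pM; rewrite ?normc_ge0.
apply: (@le_trans _ _ (eta * S + 2 * (2 * eta * S) + eta * S)); first by rewrite !lerD.
apply: (@le_trans _ _ (eta * (10 * (2 * pi)) * normc (x +i* y))); last first.
  by rewrite ler_wpM2r ?normc_ge0.
have -> : eta * (10 * (2 * pi)) * normc (x +i* y) = 10 * (eta * S) by rewrite /S; ring.
by have : 0 <= eta * S by [exact: mulr_ge0 (ltW _) _|]; nra.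
Qed.

End Eisenstein.

(** * Ramanujan identities *)

Section ModularDerivation.
Variable R : realType.
Local Notation C := R[i].
Implicit Types (f g : C -> C) (z w q h : C) (x y : R).

Definition twopii : C := 2 * (pi : R)%:C * 'i.

Lemma twopii_neq0 : twopii != 0.
Proof.
rewrite !mulf_neq0 // ?pnatr_eq0 //.
  by apply/eqP => -[]; apply/eqP; rewrite gt_eqF ?pi_gt0.
by apply/eqP => /eqP; rewrite eq_complex /= oner_eq0 andbF.
Qed.

Lemma uhp_open z h : uhp z -> normc h < complex.Im z -> uhp (z + h).
Proof.
rewrite /uhp ImD => z0 hz; have := le_lt_trans (Im_le_normc h) hz.
by rewrite ltr_norml; lra.
Qed.

Lemma sigma_le k n : (sigma k n <= n.+1 ^ k.+1)%N.
Proof.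
have dk (d : 'I_n.+1) : (d ^ k <= n.+1 ^ k)%N by case: k => // k; rewrite leq_exp2r // ltnW.
rewrite /sigma; apply: (@leq_trans (\sum_(d < n.+1) n.+1 ^ k)%N).
  by rewrite big_mkcond; apply: leq_sum => d _; case: ifP.
by rewrite sum_nat_const card_ord expnS.
Qed.

Lemma poly_growth_eis (c : C) k : poly_growth (eis_coef c k).
Proof.
exists (1 + normc c), k.-1.+1 => n; rewrite /eis_coef.
have n1 : 1 <= n.+1%:R ^+ k.-1.+1 :> R by rewrite exprn_ege1 // ler1n.
case: eqP => _.
  rewrite normc1; have := normc_ge0 c; nra.
rewrite normcM normc_nat mulrDl ler_wpDl ?exprn_ge0 ?mul1r ?(le_trans ler01) //.
by rewrite ler_wpM2l ?normc_ge0 // -natrX ler_nat sigma_le.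
Qed.

(** The definition keeps the constant term and the factor [c] outside the series; as a single power
    series, [Eis] can be multiplied and differentiated. *)
Lemma Eis_psum (c : C) k z : uhp z -> Eis c k z = psum (eis_coef c k) (qexp z).
Proof.
move=> zu; have q1 := normc_qexp_lt1 zu; rewrite /Eis asboolT //.
set u := fun n : nat => (sigma k.-1 n.+1)%:R * qexp z ^+ n.+1 : C.
have g : geo_bounded u.
  have [A [s [/andP[s0 s1] H]]] := geo_bounded_psum (poly_growth_eis 1 k) q1.
  exists (A * s), s; split; first by rewrite s0.
  by move=> n; have := H n.+1; rewrite /eis_coef /= mul1r [s ^+ n.+1]exprS mulrA.
have [l Hl] := geo_bounded_sums g.
rewrite (sums_to_lim Hl).
have := sums_to_psum (poly_growth_eis c k) q1; apply: sums_to_uniq.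
have -> : 1 + c * l = (eis_coef c k 0 * qexp z ^+ 0) + c * l by rewrite /eis_coef /= expr0 mulr1.
apply: (@sums_to_recl _ (fun n => eis_coef c k n * qexp z ^+ n)).
by apply: eq_sums_to (sums_toZ c Hl) => n; rewrite /u /eis_coef /= mulrA.
Qed.

Lemma dq_cdiff f z l : uhp z -> cdiff f z l -> dq f z = l / twopii.
Proof. by move=> zu fz; rewrite /dq asboolT // (cdiff_derive fz). Qed.

Lemma Eis_cdiff (c : C) k z : uhp z ->
  cdiff (Eis c k) z (twopii * psum (fun n => n%:R * eis_coef c k n) (qexp z)).
Proof.
move=> zu; have q1 := normc_qexp_lt1 zu.
have [l [H1 H2]] := psum_cdiff (poly_growth_eis c k) q1.
have := cdiff_comp (qexp_cdiff z) H1.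
have -> : l * (2 * (pi : R)%:C * 'i * qexp z) = twopii * (qexp z * l) by rewrite /twopii; ring.
rewrite H2 => Hc; apply: (cdiff_near zu _ Hc) => h hz.
rewrite (Eis_psum c k (uhp_open zu hz)); reflexivity.
Qed.

Lemma dq_Eis (c : C) k z : uhp z ->
  dq (Eis c k) z = psum (fun n => n%:R * eis_coef c k n) (qexp z).
Proof.
by move=> zu; rewrite (dq_cdiff zu (Eis_cdiff c k zu)) mulrAC divff ?mul1r ?twopii_neq0.
Qed.

(** By the identity on coefficients, [E2 E4] and [3 E4' + E6] are sums of one and the same power
    series in [qexp z], and sums are unique. *)
Lemma ramanujan_E4 z : uhp z -> dq (@E4 R) z = (E2 z * E4 z - E6 z) / 3.
Proof.
move=> zu; have q1 := normc_qexp_lt1 zu; rewrite /E2 /E4 /E6 dq_Eis // !Eis_psum //.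
have g4 := poly_growth_eis (240 : C) 4; have g6 := poly_growth_eis (- 504 : C) 6.
have gn := poly_growth_natmul g4.
have := sums_toD (sums_toZ 3 (sums_to_psum gn q1)) (sums_to_psum g6 q1).
have key (N A D : C) : A = 3 * N + D -> N = (A - D) / 3 by move=> ->; field.
move=> H; apply: key; apply: sums_to_uniq (sums_to_conv (poly_growth_eis (- 24) 2) g4 q1) _.
apply: eq_sums_to H.
move=> n; rewrite ramanujan_E4_coef.
by move: (eis_coef _ _ _) (eis_coef _ _ _) (qexp z ^+ n) => a b t; ring.
Qed.

Lemma ramanujan_E6 z : uhp z -> dq (@E6 R) z = (E2 z * E6 z - E4 z ^+ 2) / 2.
Proof.
move=> zu; have q1 := normc_qexp_lt1 zu; rewrite /E2 /E4 /E6 dq_Eis // !Eis_psum // expr2.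
have g4 := poly_growth_eis (240 : C) 4; have g6 := poly_growth_eis (- 504 : C) 6.
have gn := poly_growth_natmul g6.
have := sums_toD (sums_toZ 2 (sums_to_psum gn q1)) (sums_to_conv g4 g4 q1).
have key (N A D : C) : A = 2 * N + D -> N = (A - D) / 2 by move=> ->; field.
move=> H; apply: key; apply: sums_to_uniq (sums_to_conv (poly_growth_eis (- 24) 2) g6 q1) _.
apply: eq_sums_to H.
move=> n; rewrite [in RHS]ramanujan_E6_coef.
by move: (eis_coef _ _ _) (\sum_(i < _) _) (qexp z ^+ n) => a b t; ring.
Qed.

End ModularDerivation.

(** * The derivation on modular forms *)

Section HolomorphicDerivation.
Variable R : realType.
Local Notation C := R[i].
Implicit Types (f g : C -> C) (z w h : C) (x y : R) (c : C).

Lemma Hol_cdiff f z : Hol f -> uhp z -> cdiff f z ('D_1 (f : C^o -> C^o) z).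
Proof. by move=> [fd _] zu; exact/derivable_cdiff/fd. Qed.

Lemma Hol_off f z : Hol f -> ~ uhp z -> f z = 0.
Proof. by move=> [_]; apply. Qed.

Lemma HolI f : (forall z, uhp z -> exists l, cdiff f z l) -> (forall z, ~ uhp z -> f z = 0) -> Hol f.
Proof. by move=> H H0; split=> // z /H [l /cdiff_derivable]. Qed.

Lemma Hol0 : Hol (fun=> 0 : C).
Proof. by apply: HolI => // z _; exists 0; exact: cdiff_cst. Qed.

Lemma HolD f g : Hol f -> Hol g -> Hol (fun z => f z + g z).
Proof.
move=> fH gH; apply: HolI => z zu; last by rewrite (Hol_off fH zu) (Hol_off gH zu) addr0.
by eexists; apply: cdiffD; exact: Hol_cdiff.
Qed.

Lemma HolM f g : Hol f -> Hol g -> Hol (fun z => f z * g z).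
Proof.
move=> fH gH; apply: HolI => z zu; last by rewrite (Hol_off fH zu) mul0r.
by eexists; apply: cdiffM; exact: Hol_cdiff.
Qed.

Lemma HolZ c f : Hol f -> Hol (fun z => c * f z).
Proof.
move=> fH; apply: HolI => z zu; last by rewrite (Hol_off fH zu) mulr0.
by eexists; apply: cdiffZ; exact: Hol_cdiff.
Qed.

Lemma Hol_sum (I : Type) (r : seq I) (P : pred I) (F : I -> C -> C) :
  (forall i, P i -> Hol (F i)) -> Hol (fun z => \sum_(i <- r | P i) F i z).
Proof.
move=> FH; elim: r => [|i r IH].
  have -> : (fun z => \sum_(i <- [::] | P i) F i z) = fun=> 0; last exact: Hol0.
  by apply/funext => z; rewrite big_nil.
have [Pi|nPi] := boolP (P i).
  have -> : (fun z => \sum_(i <- i :: r | P i) F i z) = fun z => F i z + \sum_(i <- r | P i) F i z.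
    by apply/funext => z; rewrite big_cons Pi.
  by apply: HolD => //; exact: FH.
have -> // : (fun z => \sum_(i <- i :: r | P i) F i z) = fun z => \sum_(i <- r | P i) F i z.
by apply/funext => z; rewrite big_cons (negbTE nPi).
Qed.

Lemma Hol_Eis c k : Hol (Eis c k).
Proof.
apply: HolI => z zu; first by eexists; exact: Eis_cdiff.
by rewrite /Eis (asboolF zu).
Qed.

Lemma Hol_on_uhp f : (forall z, uhp z -> exists l, cdiff f z l) ->
  Hol (fun z => oneH z * f z).
Proof.
move=> fd; apply: HolI => z zu; last by rewrite /oneH (asboolF zu) mul0r.
have [l fl] := fd z zu; exists l; apply: (cdiff_near (d := complex.Im z)) fl => // h hz.
by rewrite /oneH asboolT ?mul1r //; exact: uhp_open.
Qed.

Lemma Hol_oneH : Hol (@oneH R).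
Proof.
have -> : @oneH R = fun z => oneH z * 1 by apply/funext => z; rewrite mulr1.
by apply: (@Hol_on_uhp (fun=> 1)) => z _; exists 0; exact: cdiff_cst.
Qed.

(** This is where Cauchy's formula enters: [Hol] grants one complex derivative of [f], and [dq f]
    must again have one. *)
Lemma Hol_dq f : Hol f -> Hol (dq f).
Proof.
move=> fH; apply: HolI => z zu; last by rewrite /dq (asboolF zu).
have [|l Hl] := @derive_cdiff _ f z (complex.Im z) zu.
  move=> h hz; eexists; apply: Hol_cdiff => //; exact: uhp_open.
eexists; apply: (cdiff_near (d := complex.Im z)) (cdiffM Hl (cdiff_cst (twopii R)^-1 z)) => // h hz.
by rewrite /dq asboolT //; exact: uhp_open.
Qed.

Lemma dqD f g : Hol f -> Hol g -> dq (fun z => f z + g z) = fun z => dq f z + dq g z.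
Proof.
move=> fH gH; apply/funext => z; have [zu|zu] := pselect (uhp z); last first.
  by rewrite /dq (asboolF zu) addr0.
rewrite (dq_cdiff zu (cdiffD (Hol_cdiff fH zu) (Hol_cdiff gH zu))).
by rewrite (dq_cdiff zu (Hol_cdiff fH zu)) (dq_cdiff zu (Hol_cdiff gH zu)) mulrDl.
Qed.

Lemma dqM f g : Hol f -> Hol g -> dq (fun z => f z * g z) = fun z => dq f z * g z + f z * dq g z.
Proof.
move=> fH gH; apply/funext => z; have [zu|zu] := pselect (uhp z); last first.
  by rewrite /dq (asboolF zu) mul0r mulr0 addr0.
rewrite (dq_cdiff zu (cdiffM (Hol_cdiff fH zu) (Hol_cdiff gH zu))).
by rewrite (dq_cdiff zu (Hol_cdiff fH zu)) (dq_cdiff zu (Hol_cdiff gH zu)) mulrDl mulrAC mulrA.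
Qed.

Lemma dqZ c f : Hol f -> dq (fun z => c * f z) = fun z => c * dq f z.
Proof.
move=> fH; apply/funext => z; have [zu|zu] := pselect (uhp z); last first.
  by rewrite /dq (asboolF zu) mulr0.
rewrite (dq_cdiff zu (cdiffZ c (Hol_cdiff fH zu))).
by rewrite (dq_cdiff zu (Hol_cdiff fH zu)) mulrA.
Qed.

Lemma Hol_E2 : Hol (@E2 R). Proof. exact: Hol_Eis. Qed.
Lemma Hol_E4 : Hol (@E4 R). Proof. exact: Hol_Eis. Qed.
Lemma Hol_E6 : Hol (@E6 R). Proof. exact: Hol_Eis. Qed.

(* Otherwise comparing two Eisenstein series during unification unfolds the series. *)
Local Opaque E2 E4 E6 dq.

Lemma Hol_Dk x f : Hol f -> Hol (Dk x f).
Proof.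
move=> fH; have -> : Dk x f = fun z => dq f z + (- (x / 12)%:C) * (E2 z * f z).
  by apply/funext => z; rewrite /Dk; congr (_ + _); rewrite mulNr mulrA.
apply: HolD; first exact: Hol_dq.
by apply: HolZ; apply: HolM => //; exact: Hol_E2.
Qed.

Lemma DkD x f g : Hol f -> Hol g -> Dk x (fun z => f z + g z) = fun z => Dk x f z + Dk x g z.
Proof.
move=> fH gH; apply/funext => z; rewrite /Dk dqD //.
by move: (dq f z) (dq g z) (f z) (g z) (E2 z) (_%:C) => a b p q r s; ring. Qed.

Lemma DkZ x c f : Hol f -> Dk x (fun z => c * f z) = fun z => c * Dk x f z.
Proof.
move=> fH; apply/funext => z; rewrite /Dk dqZ //.
by move: (dq f z) (f z) (E2 z) (_%:C) => a p r s; ring. Qed.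

Lemma Dk0 x : Dk x (fun=> 0) = fun=> 0 :> C.
Proof.
have := DkZ x 0 Hol0.
have -> : (fun z : C => 0 * 0 : C) = fun=> 0 by apply/funext => z; rewrite mul0r.
by move=> ->; apply/funext => z; rewrite mul0r.
Qed.

(** The [E2] term is linear in the weight, so weights add in the product rule. *)
Lemma DkM x y f g : Hol f -> Hol g ->
  Dk (x + y) (fun z => f z * g z) = fun z => Dk x f z * g z + f z * Dk y g z.
Proof.
move=> fH gH; apply/funext => z; rewrite /Dk dqM // mulrDl rmorphD /=.
by move: (dq f z) (dq g z) (f z) (g z) (E2 z) (x / _)%:C (y / _)%:C => a b p q r s t; ring.
Qed.

Lemma Dk_sum x (I : Type) (r : seq I) (P : pred I) (F : I -> C -> C) :
  (forall i, P i -> Hol (F i)) ->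
  Dk x (fun z => \sum_(i <- r | P i) F i z) = fun z => \sum_(i <- r | P i) Dk x (F i) z.
Proof.
move=> FH; elim: r => [|i r IH].
  have -> : (fun z : C => \sum_(i <- [::] | P i) F i z) = fun=> 0.
    by apply/funext => z; rewrite big_nil.
  by rewrite Dk0; apply/funext => z; rewrite big_nil.
have [Pi|nPi] := boolP (P i).
  have -> : (fun z => \sum_(i <- i :: r | P i) F i z) = fun z => F i z + \sum_(i <- r | P i) F i z.
    by apply/funext => z; rewrite big_cons Pi.
  rewrite DkD ?IH; [by apply/funext => z; rewrite big_cons Pi|exact: FH|exact: Hol_sum].
have -> : (fun z => \sum_(i <- i :: r | P i) F i z) = fun z => \sum_(i <- r | P i) F i z.
  by apply/funext => z; rewrite big_cons (negbTE nPi).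
by rewrite IH; apply/funext => z; rewrite big_cons (negbTE nPi).
Qed.

Lemma Dk_E4 : Dk 4 (@E4 R) = fun z => - 3^-1 * E6 z.
Proof.
apply/funext => z; have [zu|zu] := pselect (uhp z); last first.
  by rewrite (Hol_off (Hol_Dk 4 Hol_E4) zu) (Hol_off Hol_E6 zu) mulr0.
rewrite /Dk ramanujan_E4 //.
have -> : (4 / 12 : R)%:C = 3^-1 by rewrite -(rmorph_nat (real_complex R)) -fmorphV; congr _%:C; field.
by move: (E2 z) (E4 z) (E6 z) => a b c; field.
Qed.

Lemma Dk_E6 : Dk 6 (@E6 R) = fun z => - 2^-1 * (E4 z * E4 z).
Proof.
apply/funext => z; have [zu|zu] := pselect (uhp z); last first.
  by rewrite (Hol_off (Hol_Dk 6 Hol_E6) zu) (Hol_off Hol_E4 zu) mulr0 mulr0.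
rewrite /Dk ramanujan_E6 //.
have -> : (6 / 12 : R)%:C = 2^-1 by rewrite -(rmorph_nat (real_complex R)) -fmorphV; congr _%:C; field.
by move: (E2 z) (E4 z) (E6 z) => a b c; field.
Qed.

Lemma Dk_oneH : Dk 0 (@oneH R) = fun=> 0.
Proof.
apply/funext => z; have [zu|zu] := pselect (uhp z); last first.
  exact: (Hol_off (Hol_Dk 0 Hol_oneH) zu).
rewrite /Dk mul0r mul0r mul0r subr0 (@dq_cdiff _ _ _ 0) ?mul0r //.
apply: (cdiff_near zu _ (cdiff_cst 1 z)) => h hz.
by rewrite /oneH (asboolT (uhp_open zu hz)).
Qed.

Lemma oneH_mul f z : Hol f -> oneH z * f z = f z.
Proof.
rewrite /oneH; case: asboolP => zu fH; first by rewrite mul1r.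
by rewrite mul0r (Hol_off fH zu).
Qed.

Lemma mono00 : mono 0 0 = @oneH R.
Proof. by apply/funext => z; rewrite /mono !expr0 !mulr1. Qed.

Lemma monoS4 i j : mono i.+1 j = fun z => E4 z * @mono R i j z.
Proof. by apply/funext => z; rewrite /mono exprS; move: (E4 z) (oneH z) (E6 z) => a b c; ring. Qed.

Lemma monoS6 i j : mono i j.+1 = fun z => E6 z * @mono R i j z.
Proof. by apply/funext => z; rewrite /mono exprS; move: (E4 z) (oneH z) (E6 z) => a b c; ring. Qed.

Lemma Hol_mono i j : Hol (@mono R i j).
Proof.
elim: i => [|i IH]; last by rewrite monoS4; apply: HolM => //; exact: Hol_E4.
elim: j => [|j IH]; first by rewrite mono00; exact: Hol_oneH.
by rewrite monoS6; apply: HolM => //; exact: Hol_E6.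
Qed.

Lemma Mk_ind k (P : (C -> C) -> Prop) : P (fun=> 0) ->
  (forall f g, P f -> P g -> P (fun z => f z + g z)) ->
  (forall c f, P f -> P (fun z => c * f z)) ->
  (forall i j, (4 * i + 6 * j)%N = k -> P (mono i j)) ->
  forall f, Mk k f -> P f.
Proof.
move=> P0 PD PZ Pm f [c ->].
have Psum (I : Type) (r : seq I) (Q : pred I) (F : I -> C -> C) :
    (forall i, Q i -> P (F i)) -> P (fun z => \sum_(i <- r | Q i) F i z).
  move=> FP; elim: r => [|i r IH].
    by have -> : (fun z => \sum_(i <- [::] | Q i) F i z) = fun=> 0 by apply/funext => z; rewrite big_nil.
  have [Qi|nQi] := boolP (Q i).
    have -> : (fun z => \sum_(i <- i :: r | Q i) F i z) = fun z => F i z + \sum_(i <- r | Q i) F i z.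
      by apply/funext => z; rewrite big_cons Qi.
    by apply: PD => //; exact: FP.
  have -> // : (fun z => \sum_(i <- i :: r | Q i) F i z) = fun z => \sum_(i <- r | Q i) F i z.
  by apply/funext => z; rewrite big_cons (negbTE nQi).
apply: (Psum _ _ _ (fun (i : 'I_k.+1) z => \sum_(j < k.+1 | (4 * i + 6 * j)%N == k) c i j * mono i
    j z)) => i _.
by apply: (Psum _ _ _ (fun (j : 'I_k.+1) z => c i j * mono i j z)) => j /eqP E; apply: PZ; exact: Pm.
Qed.

Lemma Mk_Hol k f : Mk k f -> Hol f.
Proof.
apply: Mk_ind; [exact: Hol0|exact: HolD|move=> c g; exact: HolZ|move=> i j _; exact: Hol_mono].
Qed.

Lemma Mk0 k : Mk k (fun=> 0 : C).
Proof.
exists (fun _ _ => 0); apply/funext => z; rewrite big1 // => i _.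
by rewrite big1 // => j _; rewrite mul0r.
Qed.

Lemma MkD k f g : Mk k f -> Mk k g -> Mk k (fun z => f z + g z).
Proof.
move=> [c ->] [d ->]; exists (fun i j => c i j + d i j); apply/funext => z.
rewrite -big_split; apply: eq_bigr => i _; rewrite -big_split; apply: eq_bigr => j _.
by rewrite /= mulrDl.
Qed.

Lemma MkZ k (a : C) f : Mk k f -> Mk k (fun z => a * f z).
Proof.
move=> [c ->]; exists (fun i j => a * c i j); apply/funext => z.
rewrite mulr_sumr; apply: eq_bigr => i _; rewrite mulr_sumr; apply: eq_bigr => j _.
by rewrite mulrA.
Qed.

Lemma Mk_mono i j : Mk (4 * i + 6 * j) (@mono R i j).
Proof.
have hi : (i < (4 * i + 6 * j).+1)%N by lia.
have hj : (j < (4 * i + 6 * j).+1)%N by lia.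
exists (fun i' j' => ((i' == i) && (j' == j))%:R); apply/funext => z.
rewrite (bigD1 (Ordinal hi)) //= (bigD1 (Ordinal hj)) //= !eqxx mul1r.
rewrite big1 ?addr0 => [|j' /andP[_ nj]]; last first.
  by rewrite [_ == j](negbTE _) ?mul0r //; move: nj; rewrite -val_eqE.
rewrite big1 ?addr0 // => i' ni; rewrite big1 // => j' _.
by rewrite [_ == i](negbTE _) ?mul0r //; move: ni; rewrite -val_eqE.
Qed.

Lemma Mk_sum k (I : Type) (r : seq I) (P : pred I) (F : I -> C -> C) :
  (forall i, P i -> Mk k (F i)) -> Mk k (fun z => \sum_(i <- r | P i) F i z).
Proof.
move=> FH; elim: r => [|i r IH].
  have -> : (fun z => \sum_(i <- [::] | P i) F i z) = fun=> 0; last exact: Mk0.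
  by apply/funext => z; rewrite big_nil.
have [Pi|nPi] := boolP (P i).
  have -> : (fun z => \sum_(i <- i :: r | P i) F i z) = fun z => F i z + \sum_(i <- r | P i) F i z.
    by apply/funext => z; rewrite big_cons Pi.
  by apply: MkD => //; exact: FH.
have -> // : (fun z => \sum_(i <- i :: r | P i) F i z) = fun z => \sum_(i <- r | P i) F i z.
by apply/funext => z; rewrite big_cons (negbTE nPi).
Qed.

Lemma mono_mul i j i' j' : (fun z => mono i j z * @mono R i' j' z) = mono (i + i') (j + j').
Proof.
apply/funext => z; rewrite /mono !exprD.
have E : oneH z * oneH z = oneH z :> C by exact: oneH_mul Hol_oneH.
rewrite -[in RHS]E; move: (E4 z ^+ _) (E4 z ^+ _) (E6 z ^+ _) (E6 z ^+ _) (oneH z) => a b c d e; ring.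
Qed.

Lemma MkM k l f g : Mk k f -> Mk l g -> Mk (k + l) (fun z => f z * g z).
Proof.
move=> + gM; move: f; apply: Mk_ind.
- have -> : (fun z : C => 0 * g z) = fun=> 0 by apply/funext => z; rewrite mul0r.
  exact: Mk0.
- move=> f f' H H'.
  have -> : (fun z => (f z + f' z) * g z) = fun z => f z * g z + f' z * g z.
    by apply/funext => z; rewrite mulrDl.
  exact: MkD.
- move=> c f H.
  have -> : (fun z => c * f z * g z) = fun z => c * (f z * g z).
    by apply/funext => z; rewrite mulrA.
  exact: MkZ.
move=> i j E; move: g gM; apply: Mk_ind.
- have -> : (fun z : C => mono i j z * 0) = fun=> 0 by apply/funext => z; rewrite mulr0.
  exact: Mk0.
- move=> f f' H H'.
  have -> : (fun z => mono i j z * (f z + f' z)) = fun z => mono i j z * f z + mono i j z * f' z.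
    by apply/funext => z; rewrite mulrDr.
  exact: MkD.
- move=> c f H.
  have -> : (fun z => mono i j z * (c * f z)) = fun z => c * (mono i j z * f z).
    by apply/funext => z; rewrite mulrCA.
  exact: MkZ.
move=> i' j' E'; rewrite mono_mul -E -E'.
have -> : (4 * i + 6 * j + (4 * i' + 6 * j') = 4 * (i + i') + 6 * (j + j'))%N by lia.
exact: Mk_mono.
Qed.

Lemma Mk_E4 : Mk 4 (@E4 R).
Proof.
have -> : @E4 R = mono 1 0.
  by apply/funext => z; rewrite monoS4 mono00 mulrC oneH_mul //; exact: Hol_E4.
exact: (Mk_mono 1 0).
Qed.

Lemma Mk_E6 : Mk 6 (@E6 R).
Proof.
have -> : @E6 R = mono 0 1.
  by apply/funext => z; rewrite monoS6 mono00 mulrC oneH_mul //; exact: Hol_E6.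
exact: (Mk_mono 0 1).
Qed.

(** One Eisenstein factor is peeled off at a time: the product rule isolates [D E4] or [D E6], given
    by Ramanujan's identities, and the recursion ends at [oneH], which [Dk 0] kills. *)
Lemma Mk_Dk_mono i j : Mk (4 * i + 6 * j + 2) (Dk (4 * i + 6 * j)%:R (@mono R i j)).
Proof.
elim: i => [|i IH]; last first.
  have -> : (4 * i.+1 + 6 * j)%:R = 4 + (4 * i + 6 * j)%:R :> R by rewrite -natrD; congr _%:R; lia.
  rewrite monoS4 DkM; [|exact: Hol_E4|exact: Hol_mono].
  rewrite Dk_E4; apply: MkD.
    have -> : (4 * i.+1 + 6 * j + 2 = 6 + (4 * i + 6 * j))%N by lia.
    by apply: MkM; [apply: MkZ; exact: Mk_E6|exact: Mk_mono].
  have -> : (4 * i.+1 + 6 * j + 2 = 4 + (4 * i + 6 * j + 2))%N by lia.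
  by apply: MkM => //; exact: Mk_E4.
elim: j => [|j IH].
  by rewrite mono00 Dk_oneH; exact: Mk0.
have -> : (4 * 0 + 6 * j.+1)%:R = 6 + (4 * 0 + 6 * j)%:R :> R by rewrite -natrD; congr _%:R; lia.
rewrite monoS6 DkM; [|exact: Hol_E6|exact: Hol_mono].
rewrite Dk_E6; apply: MkD.
  have -> : (4 * 0 + 6 * j.+1 + 2 = (4 + 4) + (4 * 0 + 6 * j))%N by lia.
  by apply: MkM; [apply: MkZ; apply: MkM; exact: Mk_E4|exact: Mk_mono].
have -> : (4 * 0 + 6 * j.+1 + 2 = 6 + (4 * 0 + 6 * j + 2))%N by lia.
by apply: MkM => //; exact: Mk_E6.
Qed.

Lemma Mk_Dk k f : Mk k f -> Mk (k + 2) (Dk k%:R f).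
Proof.
(* Holomorphy is carried through the induction because [DkD] and [DkZ] ask for it. *)
move=> fM; suff: Hol f /\ Mk (k + 2) (Dk k%:R f) by case.
move: f fM; apply: Mk_ind.
- by rewrite Dk0; split; [exact: Hol0|exact: Mk0].
- move=> f g [fH fM] [gH gM]; rewrite DkD //; split; [exact: HolD|exact: MkD].
- move=> c f [fH fM]; rewrite DkZ //; split; [exact: HolZ|exact: MkZ].
by move=> i j <-; split; [exact: Hol_mono|exact: Mk_Dk_mono].
Qed.

Lemma Mk_dM l (w : nat) f : Mk w f -> Mk (w + 2 * l) (dM l w f).
Proof.
move=> fM; elim: l => [|l IH]; first by rewrite muln0 addn0.
by rewrite mulnS addnA addnAC; exact: Mk_Dk.
Qed.

End HolomorphicDerivation.

(** * Operators on H *)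

Section Operators.
Variable R : realType.
Local Notation C := R[i].
Local Notation Hv := (Hv R).
Local Notation Op := (Op R).
Implicit Types (f g : C -> C) (z : C) (x y d : R) (c : C) (h : Hv) (k l m n p w N : nat).

Local Opaque E2 E4 E6 dq Dk.

Lemma inH_Hol h x : inH h -> Hol (h x).
Proof. by case. Qed.

Lemma inH_shift (F : R -> (C -> C) -> (C -> C)) h x : inH h ->
  (forall y f, Hol f -> Hol (F y f)) -> (forall y, F y (fun=> 0) = fun=> 0) ->
  inH (fun d => F d (h (d - x))).
Proof.
move=> [hH hfin] FH F0; split=> [d|]; first exact: FH.
apply: sub_finite_set (finite_image (fun y => y + x) hfin) => d /= Fd.
exists (d - x); last by rewrite subrK.
by move=> E; apply: Fd; rewrite E.
Qed.

Lemma inH_delta h : inH h -> inH (delta h).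
Proof.
move=> hH; apply: (@inH_shift (fun d => Dk (d - 2)) h 2 hH) => [y f|y]; first exact: Hol_Dk.
exact: Dk0.
Qed.

Lemma inH_iter_delta p h : inH h -> inH (iter p (@delta R) h).
Proof. by move=> hH; elim: p => //= p; exact: inH_delta. Qed.

(** Multiplication by a form of weight [k]; [e4] and [e6] are the cases of [E4] and [E6]. *)
Definition mulop k g : Op := fun h d z => g z * h (d - k%:R) z.

Lemma inH_mulop k g h : Hol g -> inH h -> inH (mulop k g h).
Proof.
move=> gH hH; apply: (@inH_shift (fun _ f z => g z * f z) h k%:R hH) => [y f|y].
  exact: HolM.
by apply/funext => z; rewrite mulr0.
Qed.

Lemma inH0 : inH (fun _ _ => 0 : C).
Proof.
split=> [d|]; first exact: Hol0.
by apply: (@sub_finite_set _ _ set0) => // x /=; apply.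
Qed.

Lemma inHD h h' : inH h -> inH h' -> inH (fun d z => h d z + h' d z).
Proof.
move=> [hH hf] [hH' hf']; split=> [d|]; first exact: HolD.
apply: (@sub_finite_set _ _ ([set n | h n <> (fun=> 0)] `|` [set n | h' n <> (fun=> 0)])%classic).
  move=> d /= D; have [E|] := pselect (h d = fun=> 0); last by left.
  right=> E'; apply: D; rewrite E E'; apply/funext => z; exact: addr0.
by rewrite finite_setU.
Qed.

Lemma inHZ c h : inH h -> inH (fun d z => c * h d z).
Proof.
move=> [hH hf]; split=> [d|]; first exact: HolZ.
apply: sub_finite_set hf => d /= D E; apply: D; rewrite E.
by apply/funext => z; exact: mulr0.
Qed.

Lemma inH_sum (I : Type) (r : seq I) (F : I -> Hv) :
  (forall i, inH (F i)) -> inH (fun d z => \sum_(i <- r) F i d z).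
Proof.
move=> FH; elim: r => [|i r IH].
  have -> : (fun d z => \sum_(i <- [::]) F i d z) = (fun _ _ => 0) :> Hv; last exact: inH0.
  by apply/funext => d; apply/funext => z; rewrite big_nil.
have -> : (fun d z => \sum_(i <- i :: r) F i d z) =
    (fun d z => F i d z + (fun d z => \sum_(i <- r) F i d z) d z) :> Hv.
  by apply/funext => d; apply/funext => z; rewrite big_cons.
exact: inHD.
Qed.

Lemma delta_sum (I : Type) (r : seq I) (F : I -> Hv) : (forall i, inH (F i)) ->
  delta (fun d z => \sum_(i <- r) F i d z) = fun d z => \sum_(i <- r) delta (F i) d z.
Proof.
move=> FH; apply/funext => d; rewrite /delta (@Dk_sum R (d - 2) I r xpredT (fun i => F i (d - 2))) //.
by move=> i _; exact: inH_Hol.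
Qed.

Lemma iter_delta_sum p (I : Type) (r : seq I) (F : I -> Hv) : (forall i, inH (F i)) ->
  iter p (@delta R) (fun d z => \sum_(i <- r) F i d z) =
  fun d z => \sum_(i <- r) iter p (@delta R) (F i) d z.
Proof.
move=> FH; elim: p => //= p ->; rewrite delta_sum // => i; exact: inH_iter_delta.
Qed.

Lemma deltaZ c h : inH h -> delta (fun d z => c * h d z) = fun d z => c * delta h d z.
Proof. by move=> hH; apply/funext => d; rewrite /delta DkZ //; exact: inH_Hol. Qed.

Lemma delta_mulop k g h : Hol g -> inH h -> delta (mulop k g h) =
  fun d z => mulop (k + 2) (Dk k%:R g) h d z + mulop k g (delta h) d z.
Proof.
move=> gH hH; apply/funext => d; rewrite /delta /mulop.
have -> : d - 2 = k%:R + (d - k%:R - 2) by ring.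
have -> : k%:R + (d - k%:R - 2) - k%:R = d - k%:R - 2 by ring.
rewrite DkM //; last exact: inH_Hol.
by have -> : d - (k + 2)%:R = d - k%:R - 2 by rewrite natrD; ring.
Qed.

Lemma Hol_dM l w f : Mk w f -> Hol (dM l w f).
Proof. by move=> fM; exact: Mk_Hol (Mk_dM l fM). Qed.

(** Iterating [delta_mulop], the operator form of [xi g = g xi + delta(g)], with Pascal's rule. The
    binomials are those of [sk_mul], which makes [phi] multiplicative. *)
Lemma leibniz m w g h d z : Mk w g -> inH h ->
  iter m (@delta R) (mulop w g h) d z =
  \sum_(l < m.+1) 'C(m, l)%:R * mulop (w + 2 * l) (dM l w g) (iter (m - l) (@delta R) h) d z.
Proof.
move=> gM hH; elim: m d z => [|m IH] d z.
  by rewrite big_ord1 /= bin0 mul1r muln0 addn0.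
have inHA l j : inH (mulop (w + 2 * l) (dM l w g) (iter j (@delta R) h)).
  by apply: inH_mulop; [exact: Hol_dM|exact: inH_iter_delta].
have E : iter m (@delta R) (mulop w g h) = fun d z =>
    \sum_(l < m.+1) (fun d z => 'C(m, l)%:R * mulop (w + 2 * l) (dM l w g) (iter (m - l) (@delta R)
        h) d z) d z.
  by apply/funext => d'; apply/funext => z'; exact: IH.
rewrite iterS E delta_sum; last by move=> l; apply: inHZ.
pose A l j := mulop (w + 2 * l) (dM l w g) (iter j (@delta R) h) d z.
transitivity (\sum_(l < m.+1) ('C(m, l)%:R * A l.+1 (m - l)%N + 'C(m, l)%:R * A l (m - l).+1)).
  apply: eq_bigr => l _; rewrite deltaZ // delta_mulop; [|exact: Hol_dM|exact: inH_iter_delta].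
  by rewrite mulrDr /A mulnS addnA addnAC.
rewrite big_split /= [RHS]big_ord_recl /= bin0 mul1r.
have -> : \sum_(l < m.+1) 'C(m, l)%:R * A l (m - l).+1 =
    A 0%N m.+1 + \sum_(l < m.+1) 'C(m, l.+1)%:R * A l.+1 (m - l)%N.
  rewrite big_ord_recl /= bin0 mul1r subn0; congr (_ + _).
  rewrite [RHS]big_ord_recr /= bin_small // mul0r addr0; apply: eq_bigr => l _.
  by rewrite /bump /= add1n subnSK.
rewrite addrCA; congr (_ + _); rewrite -big_split; apply: eq_bigr => l _ /=.
by rewrite /bump /= add1n subSS binS natrD addrC -mulrDl.
Qed.

End Operators.

(** * The skew polynomial ring *)

Section SkewPolynomials.
Variable R : realType.
Local Notation C := R[i].
Local Notation Hv := (Hv R).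
Local Notation Op := (Op R).
Local Notation Sk := (Sk R).
Implicit Types (f g : C -> C) (z : C) (x y d : R) (c : C) (h : Hv) (s t u : Sk).
Implicit Types (k l m n p w N B : nat).

Local Opaque E2 E4 E6 dq Dk.

Definition supp_lt N s := forall k p, (N <= k)%N \/ (N <= p)%N -> s k p = fun=> 0.

Definition phi_trunc N s : Op := fun h d z =>
  \sum_(k < N) \sum_(p < N) s k p z * iter p (@delta R) h (d - k%:R) z.

(** [Sk] contains all families, so a truncation bound is chosen, with default 0 if there is none; by
    [phiE] every valid bound gives the same operator. *)
Definition phi s : Op := phi_trunc (xget 0%N [set N | supp_lt N s]) s.

Lemma supp_lt_le N B s : (N <= B)%N -> supp_lt N s -> supp_lt B s.
Proof. by move=> NB sN k p H; apply: sN; case: H => H; [left|right]; exact: leq_trans H. Qed.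

Lemma sum_ord_vanish N B (F : nat -> C) :
  (forall i, (N <= i)%N \/ (B <= i)%N -> F i = 0) -> \sum_(i < N) F i = \sum_(i < B) F i.
Proof.
wlog NB : N B / (N <= B)%N.
  move=> W H; have [NB|/ltnW NB] := leqP N B; first exact: W.
  by apply/esym/W => // i [] ?; apply: H; [right|left].
move=> H; rewrite (big_ord_widen B F NB) big_mkcond; apply: eq_bigr => i _.
by case: ltnP => // Ni; rewrite H //; left.
Qed.

Lemma phi_trunc_eq N B s : supp_lt N s -> supp_lt B s -> phi_trunc N s = phi_trunc B s.
Proof.
move=> sN sB; apply/funext => h; apply/funext => d; apply/funext => z; rewrite /phi_trunc.
rewrite (@sum_ord_vanish N B (fun k => \sum_(p < N) s k p z * iter p (@delta R) h (d - k%:R) z)).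
  apply: eq_bigr => k _; apply: (@sum_ord_vanish N B (fun p => s k p z * iter p (@delta R) h (d -
      k%:R) z)).
  by move=> p [Np|Bp]; [rewrite sN|rewrite sB]; rewrite ?mul0r //; right.
move=> k Hk; rewrite big1 // => p _.
by case: Hk => Hk; [rewrite sN|rewrite sB]; rewrite ?mul0r //; left.
Qed.

Lemma phiE N s : supp_lt N s -> phi s = phi_trunc N s.
Proof.
move=> sN; apply: phi_trunc_eq => //.
exact: (xgetPex 0%N (P := [set N | supp_lt N s]%classic) (ex_intro _ N sN)).
Qed.

Lemma isSk_supp s : isSk s -> exists N, supp_lt N s. Proof. by case. Qed.

Lemma isSk_supp2 s t : isSk s -> isSk t -> exists N, supp_lt N s /\ supp_lt N t.
Proof.
move=> [_ [N sN]] [_ [M tM]]; exists (maxn N M).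
by split; [apply: supp_lt_le sN; exact: leq_maxl|apply: supp_lt_le tM; exact: leq_maxr].
Qed.

Lemma supp_add N s t : supp_lt N s -> supp_lt N t -> supp_lt N (sk_add s t).
Proof.
move=> sN tN k p H; apply/funext => z; rewrite /sk_add sN // tN //; exact: addr0.
Qed.

Lemma supp_scale N c s : supp_lt N s -> supp_lt N (sk_scale c s).
Proof. by move=> sN k p H; apply/funext => z; rewrite /sk_scale sN // mulr0. Qed.

Lemma isSk_add s t : isSk s -> isSk t -> isSk (sk_add s t).
Proof.
move=> sS tS; have [N [sN tN]] := isSk_supp2 sS tS; split; last by exists N; exact: supp_add.
by move=> k p; apply: MkD; [case: sS|case: tS].
Qed.

Lemma isSk_scale c s : isSk s -> isSk (sk_scale c s).
Proof.
move=> [sM [N sN]]; split; last by exists N; exact: supp_scale.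
by move=> k p; exact: MkZ.
Qed.

Lemma isSk_mono i j k : isSk (@sk_mono R i j k).
Proof.
split=> [w p|].
  by rewrite /sk_mono; case: ifP => [/andP[/eqP -> _]|_]; [exact: Mk_mono|exact: Mk0].
exists (4 * i + 6 * j + k).+1 => w p H; rewrite /sk_mono; case: ifP => // /andP[/eqP E1 /eqP E2].
by case: H; rewrite ?E1 ?E2; lia.
Qed.

Lemma sk_one_mono : @sk_one R = sk_mono 0 0 0.
Proof.
by apply/funext => k; apply/funext => p; rewrite /sk_one /sk_mono mono00 !muln0 addn0.
Qed.

Lemma phi_add s t : isSk s -> isSk t -> phi (sk_add s t) = op_add (phi s) (phi t).
Proof.
move=> sS tS; have [N [sN tN]] := isSk_supp2 sS tS.
rewrite (phiE sN) (phiE tN) (phiE (supp_add sN tN)).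
apply/funext => h; apply/funext => d; apply/funext => z; rewrite /op_add /phi_trunc.
rewrite -big_split; apply: eq_bigr => k _; rewrite -big_split; apply: eq_bigr => p _.
by rewrite /= mulrDl.
Qed.

Lemma phi_scale c s : isSk s -> phi (sk_scale c s) = op_scale c (phi s).
Proof.
move=> sS; have [N sN] := isSk_supp sS.
rewrite (phiE sN) (phiE (supp_scale c sN)).
apply/funext => h; apply/funext => d; apply/funext => z; rewrite /op_scale /phi_trunc.
rewrite mulr_sumr; apply: eq_bigr => k _; rewrite mulr_sumr; apply: eq_bigr => p _.
by rewrite mulrA.
Qed.

Lemma phi_sk_mono i j k h d z : phi (sk_mono i j k) h d z =
  mono i j z * iter k (@delta R) h (d - (4 * i + 6 * j)%:R) z.
Proof.
pose N := (4 * i + 6 * j + k).+1.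
have sN : supp_lt N (@sk_mono R i j k).
  move=> w p H; rewrite /sk_mono; case: ifP => // /andP[/eqP E1 /eqP E2].
  by case: H; rewrite /N ?E1 ?E2; lia.
have h1 : (4 * i + 6 * j < N)%N by rewrite /N; lia.
have h2 : (k < N)%N by rewrite /N; lia.
rewrite (phiE sN) /phi_trunc (bigD1 (Ordinal h1)) //= (bigD1 (Ordinal h2)) //=.
rewrite /sk_mono !eqxx /= big1 ?addr0 => [|p np]; last first.
  by rewrite [_ == k](negbTE _) ?mul0r //; move: np; rewrite -val_eqE.
rewrite big1 ?addr0 // => w nw; rewrite big1 // => p _.
by rewrite [X in if X && _ then _ else _](negbTE _) ?mul0r //; move: nw; rewrite -val_eqE.
Qed.

Lemma iter_comp k (T : Op) h : iter k (fun S => T \o S) (@op_id R) h = iter k T h.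
Proof. by elim: k => //= k ->. Qed.

Lemma iter_e4e6 i j (T : Op) h d z : inH (T h) ->
  iter i (fun T => @e4 R \o T) (iter j (fun T => @e6 R \o T) T) h d z =
  mono i j z * T h (d - (4 * i + 6 * j)%:R) z.
Proof.
move=> TH; elim: i d => [|i IH] d /=.
  elim: j d => [|j IH] d /=.
    by rewrite mono00 subr0 oneH_mul //; exact: inH_Hol.
  rewrite /e6 IH monoS6 mulrA; congr (_ * T h _ z).
  by rewrite mulnS !natrD; ring.
rewrite /e4 IH monoS4 mulrA; congr (_ * T h _ z).
by rewrite mulnS !natrD; ring.
Qed.

Lemma phi_mono_iter i j k : opeq (phi (@sk_mono R i j k))
  (iter i (fun T => @e4 R \o T) (iter j (fun T => @e6 R \o T)
    (iter k (fun T => @delta R \o T) (@op_id R)))).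
Proof.
move=> h hH; apply/funext => d; apply/funext => z.
by rewrite phi_sk_mono iter_e4e6 ?iter_comp //; exact: inH_iter_delta.
Qed.

Lemma inH_phi s h : isSk s -> inH h -> inH (phi s h).
Proof.
move=> sS hH; have [N sN] := isSk_supp sS; rewrite (phiE sN).
apply: (@inH_sum R _ _ (fun (k : 'I_N) d z => \sum_(p < N) s k p z * iter p (@delta R) h (d - k%:R)
    z)) => k.
apply: (@inH_sum R _ _ (fun (p : 'I_N) d z => s k p z * iter p (@delta R) h (d - k%:R) z)) => p.
apply: (@inH_mulop R k (s k p)); last exact: inH_iter_delta.
by case: sS => /(_ k p) /Mk_Hol.
Qed.

Definition mul_term s t z (i : nat * nat * nat * nat * nat) : C :=
  let: (wa, wb, l, m, n) := i in
  'C(m, l)%:R * s wa m z * dM l wb (t wb n) z.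

Definition mul_cond k p (i : nat * nat * nat * nat * nat) : bool :=
  let: (wa, wb, l, m, n) := i in
  [&& (wa + wb + 2 * l)%N == k, (l <= m)%N & (m + n - l)%N == p].

Lemma dM0 l w : dM l w (fun=> 0) = (fun=> 0 : C).
Proof. by elim: l => //= l ->; exact: Dk0. Qed.

(** The condition in [sk_mul] already forces each index into its range, for instance
    [m <= p + l <= p + k], and the supports force it below [B]. Hence the ranges depending on [k]
    and [p] can be exchanged for a uniform one. *)
Lemma sk_mul_widen B s t k p z : supp_lt B s -> supp_lt B t ->
  sk_mul s t k p z =
  \sum_(wa < B) \sum_(wb < B) \sum_(l < B) \sum_(m < B) \sum_(n < B)
    if mul_cond k p (wa : nat, wb : nat, l : nat, m : nat, n : nat)
    then mul_term s t z (wa : nat, wb : nat, l : nat, m : nat, n : nat) else 0.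
Proof.
move=> sB tB; pose T (wa wb l m n : nat) : C :=
  if mul_cond k p (wa, wb, l, m, n) then mul_term s t z (wa, wb, l, m, n) else 0.
have T0 wa wb l m n : [\/ (k < wa)%N, (k < wb)%N, (k < l)%N | (p + k < m)%N] \/ (p < n)%N ->
    T wa wb l m n = 0.
  move=> H; rewrite /T /mul_cond; case: ifP => // /and3P[/eqP E1 E2 /eqP E3].
  by exfalso; case: H => [[] H|H]; lia.
have T1 wa wb l m n : [\/ (B <= wa)%N, (B <= wb)%N, (B <= l)%N | (B <= m)%N] \/ (B <= n)%N ->
    T wa wb l m n = 0.
  move=> H; rewrite /T /mul_cond /mul_term; case: ifP => // /and3P[_ E2 _].
  case: H => [[] H|H].
  - by rewrite sB ?mulr0 ?mul0r //; left.
  - by rewrite tB ?dM0 ?mulr0 //; left.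
  - by rewrite sB ?mulr0 ?mul0r //; right; exact: leq_trans E2.
  - by rewrite sB ?mulr0 ?mul0r //; right.
  by rewrite tB ?dM0 ?mulr0 //; right.
rewrite /sk_mul.
rewrite (@sum_ord_vanish k.+1 B (fun wa => \sum_(wb < k.+1) \sum_(l < k.+1) \sum_(m < (p + k).+1)
    \sum_(n < p.+1) T wa wb l m n)); last first.
  by move=> wa H; do 4 (rewrite big1 // => ? _); case: H => H; [apply: T0|apply: T1]; left;
      constructor 1.
apply: eq_bigr => wa _.
rewrite (@sum_ord_vanish k.+1 B (fun wb => \sum_(l < k.+1) \sum_(m < (p + k).+1) \sum_(n < p.+1) T
    wa wb l m n)); last first.
  by move=> wb H; do 3 (rewrite big1 // => ? _); case: H => H; [apply: T0|apply: T1]; left;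
      constructor 2.
apply: eq_bigr => wb _.
rewrite (@sum_ord_vanish k.+1 B (fun l => \sum_(m < (p + k).+1) \sum_(n < p.+1) T wa wb l m n));
    last first.
  by move=> l H; do 2 (rewrite big1 // => ? _); case: H => H; [apply: T0|apply: T1]; left; constructor 3.
apply: eq_bigr => l _.
rewrite (@sum_ord_vanish (p + k).+1 B (fun m => \sum_(n < p.+1) T wa wb l m n)); last first.
  by move=> m H; rewrite big1 // => ? _; case: H => H; [apply: T0|apply: T1]; left; constructor 4.
apply: eq_bigr => m _.
apply: (@sum_ord_vanish p.+1 B (fun n => T wa wb l m n)).
by move=> n H; case: H => H; [apply: T0|apply: T1]; right.
Qed.

(** [4 * B] covers the weight [wa + wb + 2 * l], whose three indices lie below [B]. *)
Lemma supp_mul B s t : supp_lt B s -> supp_lt B t -> supp_lt (4 * B) (sk_mul s t).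
Proof.
move=> sB tB k p H; apply/funext => z; rewrite (sk_mul_widen _ _ _ sB tB).
rewrite big1 // => wa _; rewrite big1 // => wb _; rewrite big1 // => l _.
rewrite big1 // => m _; rewrite big1 // => n _; rewrite /mul_cond.
have := ltn_ord wa; have := ltn_ord wb; have := ltn_ord l; have := ltn_ord m; have := ltn_ord n.
by case: ifP => // /and3P[/eqP E1 E2 /eqP E3]; lia.
Qed.

Lemma isSk_mul s t : isSk s -> isSk t -> isSk (sk_mul s t).
Proof.
move=> sS tS; have [B [sB tB]] := isSk_supp2 sS tS; split; last by exists (4 * B)%N; exact: supp_mul.
have [sM _] := sS; have [tM _] := tS.
move=> k p; apply: (@Mk_sum R k _ _ _ (fun (wa : 'I_k.+1) z => _)) => wa _.
apply: (@Mk_sum R k _ _ _ (fun (wb : 'I_k.+1) z => _)) => wb _.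
apply: (@Mk_sum R k _ _ _ (fun (l : 'I_k.+1) z => _)) => l _.
apply: (@Mk_sum R k _ _ _ (fun (m : 'I_(p + k).+1) z => _)) => m _.
apply: (@Mk_sum R k _ _ _ (fun (n : 'I_p.+1) z => _)) => n _.
case: (boolP [&& (wa + wb + 2 * l)%N == k, (l <= m)%N & (m + n - l)%N == p]) => [/and3P[/eqP E _ _]|_];
  last exact: Mk0.
have -> : (fun z => 'C(m, l)%:R * s wa m z * dM l wb (t wb n) z) =
    (fun z => 'C(m, l)%:R * (s wa m z * dM l wb (t wb n) z)) by apply/funext => z; rewrite mulrA.
have := MkM (sM wa m) (Mk_dM l (tM wb n)); rewrite addnA E; exact: MkZ.
Qed.

(** Both sides become one sum over the five indices of the product: on the left the condition
    determines [k] and [p]; on the right [leibniz] moves [delta^m] past the coefficients of [t]. *)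
Lemma phi_mul s t : isSk s -> isSk t -> opeq (phi (sk_mul s t)) (phi s \o phi t).
Proof.
move=> sS tS h hH; have [B [sB tB]] := isSk_supp2 sS tS.
have [sM _] := sS; have [tM _] := tS.
apply/funext => d; apply/funext => z /=.
rewrite (phiE (supp_mul sB tB)) (phiE sB) (phiE tB) {1 2}/phi_trunc.
pose D k p := iter p (@delta R) h (d - k%:R) z.
pose T (wa wb l m n : nat) := mul_term s t z (wa, wb, l, m, n).
transitivity (\sum_(wa < B) \sum_(wb < B) \sum_(l < B) \sum_(m < B) \sum_(n < B)
   if (l <= m)%N then T wa wb l m n * D (wa + wb + 2 * l)%N (m + n - l)%N else 0).
  transitivity (\sum_(k < 4 * B) \sum_(p < 4 * B) \sum_(wa < B) \sum_(wb < B) \sum_(l < B) \sum_(m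
      < B) \sum_(n < B)
      if mul_cond k p (wa : nat, wb : nat, l : nat, m : nat, n : nat) then T wa wb l m n * D k p else 0).
    apply: eq_bigr => k _; apply: eq_bigr => p _; rewrite (sk_mul_widen _ _ _ sB tB).
    do 5 (rewrite mulr_suml; apply: eq_bigr => ? _).
    by case: ifP => // _; rewrite mul0r.
  (* The sums over [k] and [p] are moved innermost, where at most one pair survives. *)
  under eq_bigr do rewrite exchange_big /=; rewrite exchange_big /=; apply: eq_bigr => wa _.
  under eq_bigr do rewrite exchange_big /=; rewrite exchange_big /=; apply: eq_bigr => wb _.
  under eq_bigr do rewrite exchange_big /=; rewrite exchange_big /=; apply: eq_bigr => l _.
  under eq_bigr do rewrite exchange_big /=; rewrite exchange_big /=; apply: eq_bigr => m _.
  under eq_bigr do rewrite exchange_big /=; rewrite exchange_big /=; apply: eq_bigr => n _.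
  have := ltn_ord wa; have := ltn_ord wb; have := ltn_ord l; have := ltn_ord m; have := ltn_ord n.
  move=> h1 h2 h3 h4 h5; rewrite /mul_cond; case: (leqP l m) => lm; last first.
    by rewrite big1 // => k _; rewrite big1 // => p _; rewrite andbF.
  have hk : (wa + wb + 2 * l < 4 * B)%N by lia.
  have hp : (m + n - l < 4 * B)%N by lia.
  rewrite (bigD1 (Ordinal hk)) //= (bigD1 (Ordinal hp)) //= !eqxx /=.
  rewrite big1 ?addr0 => [|p np]; last first.
    by rewrite [_ == val p](negbTE _) //; move: np; rewrite -val_eqE eq_sym.
  rewrite big1 ?addr0 // => k nk; rewrite big1 // => p _.
  by rewrite [_ == val k](negbTE _) //; move: nk; rewrite -val_eqE eq_sym.
apply: eq_bigr => wa _.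
under eq_bigr do rewrite exchange_big /=.
rewrite exchange_big /=; apply: eq_bigr => m _.
have tH wb n : inH (mulop wb (t wb n) (iter n (@delta R) h)).
  by apply: inH_mulop; [exact: Mk_Hol (tM wb n)|exact: inH_iter_delta].
have -> : phi_trunc B t h = fun d z => \sum_(wb < B) (fun d z => \sum_(n < B)
    mulop wb (t wb n) (iter n (@delta R) h) d z) d z by [].
rewrite iter_delta_sum; last by move=> wb; apply: (@inH_sum R _ _ (fun n : 'I_B => _)).
rewrite mulr_sumr; apply: eq_bigr => wb _.
rewrite (@iter_delta_sum R m _ _ (fun n : 'I_B => mulop wb (t wb n) (iter n (@delta R) h))) //.
rewrite mulr_sumr exchange_big /=; apply: eq_bigr => n _.
rewrite leibniz //; last exact: inH_iter_delta.
rewrite mulr_sumr.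
(* [leibniz] sums over [l <= m], the common form over [l < B]; the extra terms have [l > m] and are
   0. *)
rewrite (@sum_ord_vanish B m.+1 (fun l => if (l <= m)%N then
  T wa wb l m n * D (wa + wb + 2 * l)%N (m + n - l)%N else 0)).
  apply: eq_bigr => l _; have lm : (l <= m)%N by rewrite -ltnS.
  rewrite lm /T /D /mulop /= -iterD addnBAC // -addnA natrD opprD addrA.
  by rewrite -!mulrA mulrCA.
by move=> l Hl; case: leqP => // lm; have := ltn_ord m; case: Hl; lia.
Qed.

Lemma phi_one : opeq (phi (@sk_one R)) (@op_id R).
Proof.
move=> h hH; apply/funext => d; apply/funext => z.
by rewrite sk_one_mono phi_sk_mono mono00 subr0 oneH_mul //; exact: inH_Hol.
Qed.

(** Membership in the generated algebra up to [opeq], since [inRalg] describes functions on all of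
    [Hv] while operators are compared on [H]. *)
Definition image_of (S : Op) := exists T, inRalg T /\ opeq T S.

Lemma inRalg_iter i (T S : Op) : inRalg T -> inRalg S -> inRalg (iter i (fun S => T \o S) S).
Proof. by move=> TR SR; elim: i => //= i IH; exact: Ralg_comp. Qed.

Lemma image_of_zero : image_of (fun _ _ _ => 0).
Proof.
exists (op_scale 0 (@op_id R)); split; first by apply: Ralg_scale; exact: Ralg_id.
by move=> h _; apply/funext => d; apply/funext => z; rewrite /op_scale mul0r.
Qed.

Lemma image_of_add (S S' : Op) : image_of S -> image_of S' -> image_of (op_add S S').
Proof.
move=> [T [TR TS]] [T' [TR' TS']]; exists (op_add T T'); split; first exact: Ralg_add.
by move=> h hH; rewrite /op_add TS // TS'.
Qed.

Lemma image_of_scale c (S : Op) : image_of S -> image_of (op_scale c S).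
Proof.
move=> [T [TR TS]]; exists (op_scale c T); split; first exact: Ralg_scale.
by move=> h hH; rewrite /op_scale TS.
Qed.

Lemma image_of_sum (I : Type) (r : seq I) (F : I -> Op) : (forall i, image_of (F i)) ->
  image_of (fun h d z => \sum_(i <- r) F i h d z).
Proof.
move=> FH; elim: r => [|i r IH].
  have -> : (fun h d z => \sum_(i <- [::]) F i h d z) = (fun _ _ _ => 0) :> Op; last exact:
      image_of_zero.
  by apply/funext => h; apply/funext => d; apply/funext => z; rewrite big_nil.
have -> : (fun h d z => \sum_(i <- i :: r) F i h d z) =
    op_add (F i) (fun h d z => \sum_(i <- r) F i h d z).
  by apply/funext => h; apply/funext => d; apply/funext => z; rewrite big_cons.
exact: image_of_add.
Qed.

Lemma phi_in_image s : isSk s -> image_of (phi s).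
Proof.
move=> [sM [N sN]]; rewrite (phiE sN).
apply: (@image_of_sum _ _ (fun (k : 'I_N) h d z => \sum_(p < N) s k p z * iter p (@delta R) h (d -
    k%:R) z)) => k.
apply: (@image_of_sum _ _ (fun (p : 'I_N) h d z => s k p z * iter p (@delta R) h (d - k%:R) z)) => p.
move: (s k p) (sM k p); apply: Mk_ind.
- have -> : (fun h d z => 0 * iter p (@delta R) h (d - k%:R) z) = (fun _ _ _ => 0) :> Op; last
    exact: image_of_zero.
  by apply/funext => h; apply/funext => d; apply/funext => z; rewrite mul0r.
- move=> f g H H'; have := image_of_add H H'; congr image_of.
  by apply/funext => h; apply/funext => d; apply/funext => z; rewrite /op_add mulrDl.
- move=> c f H; have := image_of_scale c H; congr image_of.
  by apply/funext => h; apply/funext => d; apply/funext => z; rewrite /op_scale mulrA.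
move=> i j <-; exists (iter i (fun T => @e4 R \o T) (iter j (fun T => @e6 R \o T)
  (iter p (fun T => @delta R \o T) (@op_id R)))); split.
  by do 3 (apply: inRalg_iter; first by constructor); constructor.
move=> h hH; apply/funext => d; apply/funext => z.
by rewrite iter_e4e6 iter_comp //; exact: inH_iter_delta.
Qed.

Lemma image_in_phi (T : Op) : inRalg T -> exists s, isSk s /\ opeq T (phi s).
Proof.
elim=> [||||T1 S1 _ [s [sS sE]] _ [t [tS tE]]|c T1 _ [s [sS sE]]|T1 S1 T1R [s [sS sE]] S1R [t [tS tE]]].
- by exists (sk_mono 0 0 1); split; [exact: isSk_mono|move=> h hH; rewrite (phi_mono_iter 0 0 1 hH)].
- by exists (sk_mono 1 0 0); split; [exact: isSk_mono|move=> h hH; rewrite (phi_mono_iter 1 0 0 hH)].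
- by exists (sk_mono 0 1 0); split; [exact: isSk_mono|move=> h hH; rewrite (phi_mono_iter 0 1 0 hH)].
- by exists (sk_mono 0 0 0); split; [exact: isSk_mono|move=> h hH; rewrite (phi_mono_iter 0 0 0 hH)].
- exists (sk_add s t); split; first exact: isSk_add.
  by move=> h hH; rewrite phi_add // /op_add sE // tE.
- exists (sk_scale c s); split; first exact: isSk_scale.
  by move=> h hH; rewrite phi_scale // /op_scale sE.
exists (sk_mul s t); split; first exact: isSk_mul.
(* [opeq] compares operators on [H] only, so composition uses that [phi t] preserves [H]. *)
by move=> h hH; rewrite phi_mul //= tE // sE //; exact: inH_phi.
Qed.

End SkewPolynomials.

(** * Injectivity *)

Section Injectivity.
Variable R : realType.
Local Notation C := R[i].
Local Notation Hv := (Hv R).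
Implicit Types (f g : C -> C) (z w : C) (x y d : R) (c : C) (h : Hv) (s t u : Sk R).
Implicit Types (k l m p r e N : nat).

Local Opaque E2 E4 E6 dq.

(* Test functions for injectivity: [D^r] kills the value at [z] for [r < e] and
   not for [r = e]. *)
Definition uhp_power z e : C -> C := fun w => oneH w * (w - z) ^+ e.

Lemma Hol_uhp_power z e : Hol (uhp_power z e).
Proof.
apply: Hol_on_uhp => w _; eexists; apply: cdiffX; apply: cdiffB.
  exact: cdiff_id.
exact: cdiff_cst.
Qed.

Lemma dq_uhp_power z e : dq (uhp_power z e.+1) = fun w => (e.+1%:R / twopii R) * uhp_power z e w.
Proof.
apply/funext => w; have [wu|wu] := pselect (uhp w); last first.
  by rewrite (Hol_off (Hol_dq (Hol_uhp_power z e.+1)) wu) (Hol_off (Hol_uhp_power z e) wu) mulr0.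
rewrite (@dq_cdiff _ _ _ (e.+1%:R * (w - z) ^+ e * (1 - 0)) wu); last first.
  have H := cdiffX e.+1 (cdiffB (cdiff_id w) (cdiff_cst z w)).
  apply: (cdiff_near wu _ H) => h hw.
  by rewrite /uhp_power /oneH (asboolT (uhp_open wu hw)) mul1r.
by rewrite /uhp_power /oneH asboolT // mul1r subr0 mulr1 mulrAC.
Qed.

(** Each derivative lowers the order of vanishing at [z] by exactly one. *)
Lemma dM_uhp_power z r e : uhp z -> exists g, [/\ Hol g, g z != 0 &
  dM r 0 (uhp_power z (r + e)) = fun w => uhp_power z e w * g w].
Proof.
move=> zu; elim: r e => [|r IH] e.
  exists (@oneH R); split; first exact: Hol_oneH.
    by rewrite /oneH asboolT // oner_neq0.
  by apply/funext => w /=; rewrite mulrC oneH_mul //; exact: Hol_uhp_power.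
have [g [gH gz gE]] := IH e.+1.
(* At [w = z] only the first summand survives, and it is a nonzero multiple of [g z]. *)
exists (fun w => (e.+1%:R / twopii R) * g w + uhp_power z 1 w * Dk (0 + 2 * r)%:R g w); split.
- apply: HolD; first exact: HolZ.
  by apply: HolM; [exact: Hol_uhp_power|exact: Hol_Dk].
- rewrite /uhp_power subrr expr1 mulr0 mul0r addr0 !mulf_neq0 ?pnatr_eq0 //.
  by rewrite invr_eq0 twopii_neq0.
rewrite /= addSnnS gE.
(* The whole weight is put on [g], so that the power is differentiated by plain [dq]. *)
have -> : (0 + 2 * r)%:R = 0 + (0 + 2 * r)%:R :> R by rewrite add0r.
rewrite DkM //; last exact: Hol_uhp_power.
apply/funext => w; have -> : Dk 0 (uhp_power z e.+1) w = dq (uhp_power z e.+1) w.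
  by rewrite /Dk mul0r !mul0r subr0.
rewrite dq_uhp_power !add0r [RHS]mulrDr; congr (_ + _); first by rewrite -[LHS]mulrA mulrCA.
have E : oneH w * oneH w = oneH w :> C by exact: oneH_mul (Hol_oneH R).
rewrite [RHS]mulrA; congr (_ * _); rewrite /uhp_power exprS expr1 -[in LHS]E.
by move: (oneH w) (w - z) => a b; ring.
Qed.

Definition single f : Hv := fun n => if n == 0 then f else fun=> 0.

Lemma inH_single f : Hol f -> inH (single f).
Proof.
move=> fH; split=> [n|]; first by rewrite /single; case: eqP => _ //; exact: Hol0.
apply: (@sub_finite_set _ _ [set 0 : R]%classic); last exact: finite_set1.
by move=> n /=; rewrite /single; case: eqP.
Qed.

Lemma iter_delta_single f r n : iter r (@delta R) (single f) n =
  if n == (2 * r)%:R then dM r 0 f else fun=> 0.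
Proof.
elim: r n => [|r IH] n /=; first by rewrite /single muln0.
rewrite /delta IH subr_eq; have -> : (2 * r)%:R + 2 = (2 * r.+1)%:R :> R.
  by rewrite mulnS addnC natrD.
case: eqP => [->|_]; last exact: Dk0.
by rewrite add0n mulnS natrD addrAC subrr add0r.
Qed.

(** Descending induction on the exponent [p] of [xi]: apply the operator to the [p]-th power of
    [w - z], placed in degree 0, and read off the value at [z] in degree [k + 2 * p]. Only the term
    [(k, p)] survives, with a nonzero factor. *)
Lemma phi_eq0 u : isSk u -> (forall h, inH h -> phi u h = fun _ _ => 0) ->
  forall k p, u k p = fun=> 0.
Proof.
move=> [uM [N uN]] u0.
suff H j : forall k p, (N <= p + j)%N -> u k p = fun=> 0 by move=> k p; apply: (H N); exact: leq_addl.
elim: j => [|j IH] k p Hp; first by apply: uN; right; rewrite addn0 in Hp.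
have [|pj] := leqP N (p + j); first exact: IH.
have [kN|kN] := leqP N k; first by apply: uN; left.
have pN : (p < N)%N by lia.
apply/funext => z; have [zu|zu] := pselect (uhp z); last exact: Hol_off (Mk_Hol (uM k p)) zu.
have pH := Hol_uhp_power z p.
have := u0 _ (inH_single pH); rewrite (phiE uN).
move=> /(congr1 (fun h => h (k + 2 * p)%:R z)); rewrite /phi_trunc.
rewrite (bigD1 (Ordinal kN)) //= (bigD1 (Ordinal pN)) //=.
(* Terms with [q > p] are 0 by induction; for [q < p] the iterate still vanishes at [z]. *)
have vanish q k' : q != p -> u k' q z * iter q (@delta R) (single (uhp_power z p)) ((k + 2 * p)%:R
    - k'%:R) z = 0.
  move=> qp; rewrite iter_delta_single; case: eqP => _; last by rewrite mulr0.
  have [pq|qp'] := ltnP p q; first by rewrite IH ?mul0r //; lia.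
  have lt : (q < p)%N by rewrite ltn_neqAle qp.
  have [g [_ _ E]] := dM_uhp_power q (p - q) zu; rewrite subnKC 1?ltnW // in E.
  by rewrite E /uhp_power subrr expr0n subn_eq0 leqNgt lt /= !mulr0 mul0r mulr0.
rewrite [X in _ + X + _]big1 ?addr0 => [|q qp]; last by apply: vanish; move: qp; rewrite -val_eqE.
rewrite big1 ?addr0 => [|k' nk']; last first.
  (* For [q = p] the degree leaves only [k' = k]. *)
  rewrite big1 // => q _; have [->|qp] := eqVneq (q : nat) p; last exact: vanish.
  rewrite iter_delta_single natrD addrAC -subr_eq0 addrK subr_eq0 eqr_nat.
  rewrite [_ == _](negbTE _) ?mulr0 //; move: nk'; rewrite -val_eqE eq_sym; exact.
rewrite iter_delta_single natrD addrAC subrr add0r eqxx => /eqP.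
have [g [_ gz E]] := dM_uhp_power p 0 zu; rewrite addn0 in E.
rewrite E /uhp_power subrr expr0 mulr1 /oneH asboolT // mul1r mulf_eq0 (negbTE gz) orbF.
by move=> /eqP.
Qed.

Lemma phi_inj s t : isSk s -> isSk t -> opeq (phi s) (phi t) -> s = t.
Proof.
move=> sS tS st; have tS' := isSk_scale (-1) tS.
have u0 h : inH h -> phi (sk_add s (sk_scale (-1) t)) h = fun _ _ => 0.
  move=> hH; rewrite phi_add // phi_scale // /op_add /op_scale st //.
  by apply/funext => d; apply/funext => z; rewrite mulN1r subrr.
apply/funext => k; apply/funext => p; apply/funext => z.
have := phi_eq0 (isSk_add sS tS') u0 k p => /(congr1 (fun f => f z)).
by rewrite /sk_add /sk_scale mulN1r => /eqP; rewrite subr_eq0 => /eqP.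
Qed.

End Injectivity.

Theorem theorem3p6 (R : realType) :
  exists phi : Sk R -> Op R,
    (* phi is a C-algebra homomorphism M[xi;1,delta] -> End(H) *)
    (forall s t, isSk s -> isSk t ->
       opeq (phi (sk_add s t)) (op_add (phi s) (phi t))) /\
    (forall (c : R[i]) s, isSk s ->
       opeq (phi (sk_scale c s)) (op_scale c (phi s))) /\
    (forall s t, isSk s -> isSk t ->
       opeq (phi (sk_mul s t)) (phi s \o phi t)) /\
    opeq (phi (@sk_one R)) (@op_id R) /\
    (* phi is injective *)
    (forall s t, isSk s -> isSk t -> opeq (phi s) (phi t) -> s = t) /\
    (* the image of phi is exactly the subalgebra R generated by delta, e4, e6 *)
    (forall s, isSk s -> exists T, inRalg T /\ opeq T (phi s)) /\
    (forall T, inRalg T -> exists s, isSk s /\ opeq T (phi s)) /\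
    (* phi (E4^i E6^j xi^k) = e4^i e6^j delta^k *)
    (forall i j k : nat,
       opeq (phi (@sk_mono R i j k))
            (iter i (fun T => @e4 R \o T)
              (iter j (fun T => @e6 R \o T)
                (iter k (fun T => @delta R \o T) (@op_id R))))).
Proof.
exists (@phi R); split; first by move=> s t sS tS h _; rewrite phi_add.
split; first by move=> c s sS h _; rewrite phi_scale.
split; first exact: phi_mul.
split; first exact: phi_one.
split; first exact: phi_inj.
split; first exact: phi_in_image.
split; first exact: image_in_phi.
exact: phi_mono_iter.
Qed.
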